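(* Let $M_n$ denote the length of the largest interval after $n$ steps of Kakutani's interval-splitting process, and let $\sigma^2 := 16\log 2 - 10$. There exists a constant $C\in[0,\infty)$ such that for every $n\in\mathbb N=\{1,2,\dots\}$, \[ \sup_{x\in\mathbb R}\left|\Pr\left(\sqrt{\frac{n^3}{\sigma^2}}\left(M_n-\frac{2}{n}\right)\le x\right)-\Phi(x)\right|\le \frac{C}{\sqrt n}. \]
   Context: Kakutani's interval-splitting process: let $U_1,U_2,\dots$ be i.i.d. uniform random variables on $[0,1]$. At time $0$ the partition of $[0,1]$ consists of the single interval $[0,1]$. Given the partition at time $n\in\mathbb Z_+$ (which consists of $n+1$ intervals, whose lengths are a.s. distinct), let $[a,b]$ be the interval of maximal length; the partition at time $n+1$ is obtained by replacing $[a,b]$ by the two intervals $[a,a+U_{n+1}(b-a)]$ and $[a+U_{n+1}(b-a),b]$. Write $L_{n,1},\dots,L_{n,n+1}$ for the lengths of the $n+1$ intervals at time $n$ (in left-to-right order), $M_n:=\max_i L_{n,i}$ and $m_n:=\min_i L_{n,i}$. $\Phi$ is the standard normal distribution function. *)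

(* Defs.v *)
From HB Require Import structures.
From mathcomp Require Import all_boot all_order all_algebra.
From mathcomp Require Import all_classical all_reals all_analysis.
Set Implicit Arguments. Unset Strict Implicit. Unset Printing Implicit Defensive.
Import Order.TTheory GRing.Theory Num.Theory.
Import numFieldNormedType.Exports.
Local Open Scope classical_set_scope.
Local Open Scope ring_scope.

Section kakutani.
Variable R : realType.

(* an interval [a,b] is represented by the pair (a,b) *)
Definition ilen (p : R * R) : R := p.2 - p.1.

(* maximal length in a partition (lengths are nonnegative, so 0 is a safe
   initial value for the fold) *)
Definition maxlen (s : seq (R * R)) : R := foldr Num.max 0 (map ilen s).

Definition ksplit (v : R) (s : seq (R * R)) : seq (R * R) :=
  let i := find (fun p => ilen p == maxlen s) s in
  let p := nth (0, 0) s i in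
  let c := p.1 + v * (p.2 - p.1) in
  take i s ++ [:: (p.1, c); (c, p.2)] ++ drop i.+1 s.

(* partition at time n (left-to-right order); [u k] plays the role of
   U_{k+1}, i.e. the step from time n to time n+1 uses u n = U_{n+1} *)
Fixpoint kakutani (u : nat -> R) (n : nat) : seq (R * R) :=
  match n with
  | 0 => [:: (0, 1)]
  | n'.+1 => ksplit (u n') (kakutani u n')
  end.

Definition Mn (u : nat -> R) (n : nat) : R := maxlen (kakutani u n).

Definition Phi (x : R) : R := fine (normal_prob 0 1 `]-oo, x]).

End kakutani.

Definition mutually_independent d (T : measurableType d) (R : realType)
  (P : probability T R) (U : nat -> {RV P >-> R}) : Prop :=
  forall (s : seq nat) (B : nat -> set R), uniq s ->
    (forall i, measurable (B i)) ->
    P (\bigcap_(i in [set` s]) (U i @^-1` B i)) =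
    (\prod_(i <- s) P (U i @^-1` B i))%E.

(* Main.v *)
Require Import Defs.
From HB Require Import structures.
From mathcomp Require Import all_boot all_order all_algebra.
From mathcomp Require Import all_classical all_reals all_analysis.
From mathcomp Require Import measurable_realfun complex zify ring lra.
Set Implicit Arguments. Unset Strict Implicit. Unset Printing Implicit Defensive.
Import Order.TTheory GRing.Theory Num.Theory.
Import numFieldNormedType.Exports.
Local Open Scope classical_set_scope.
Local Open Scope ring_scope.

(* Let tau be the number of splits needed to bring every interval below length t, so that
   M_n <= t if and only if tau <= n almost surely. Conditioning on the first split, the
   characteristic function of tau at s, suitably normalised and seen as a function of
   y = 1 / t, satisfies r(y) = int_0^1 r(y u) r(y (1 - u)) du for y > 1 and is an explicit
   exponential for y <= 1. Solving this equation by Picard iteration around its expansion to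
   order s^2 gives |r(y) - 1| <= exp (K |s|^3 y) - 1: the cumulants of order at least three
   grow at most linearly in y, so the characteristic function of tau + 1 - 2 y is
   exp (- v y s^2 / 2 + O(s^3 y)) with v = 8 ln 2 - 5. The product of r over all current
   intervals is a martingale, which identifies r with the characteristic function of tau. A
   smoothing inequality in the manner of Esseen turns this into a bound O(1 / sqrt y) for the
   distance between the law of tau + 1 - 2 y and a centred normal law of variance v y, and
   substituting t = 2 / n + x sigma / n^(3/2) yields the theorem. *)

(** * Expectations of bounded real and complex functions *)

(** The shift in [tau + 1 - 2 * y] is dictated by additivity: when a length is split, [tau + 1] is
    the sum of the same quantities for the two pieces, and so is [y]. Multiplying the characteristic
    function by [exp (v * y * s^2 / 2)] therefore keeps the product form of the equation and turns
    the Gaussian limit into the constant 1. To second order, [tau + 1] has mean exactly [2 * y]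
    beyond 1 and variance exactly [v * y] beyond 2, so the expansion of [r] is 1 there and only
    short pieces carry corrections. The obstacle is uniformity in [y]: contraction in an exponential
    weight controls [r] on bounded ranges only, since its rate does not shrink with [s]. Large [y]
    are reached by an induction along the iterates in which the corrections of short pieces average
    out. The standard deviation of [tau] is of order [sqrt y], so frequencies up to a fixed
    threshold already give the rate [1 / sqrt y]; hence smoothing kernels whose transforms have
    compact support. The pathwise arguments are run on variables clamped to [0, 1], where they hold
    without exceptional sets. *)

Definition bmf d (T : measurableType d) (R : realType) (f : T -> R) : Prop :=
  measurable_fun setT f /\ exists M : R, forall x, `|f x| <= M.

Definition EX d (T : measurableType d) (R : realType) (mu : probability T R)
  (f : T -> R) : R := \int[mu]_x f x.

Section bmf_theory.
Context d (T : measurableType d) (R : realType).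
Implicit Types f g : T -> R.

Lemma bmf_cst (c : R) : bmf (fun _ : T => c).
Proof. by split; [exact: measurable_cst | exists `|c|]. Qed.

Lemma bmfD f g : bmf f -> bmf g -> bmf (fun x => f x + g x).
Proof.
move=> [mf [M Mf]] [mg [N Ng]]; split; first exact: measurable_funD.
by exists (M + N) => x; rewrite (le_trans (ler_normD _ _))// lerD.
Qed.

Lemma bmfN f : bmf f -> bmf (fun x => - f x).
Proof.
move=> [mf [M Mf]]; split; first exact: measurableT_comp.
by exists M => x; rewrite normrN.
Qed.

Lemma bmfB f g : bmf f -> bmf g -> bmf (fun x => f x - g x).
Proof. by move=> bf bg; apply: bmfD => //; exact: bmfN. Qed.

Lemma bmfM f g : bmf f -> bmf g -> bmf (fun x => f x * g x).
Proof.
move=> [mf [M Mf]] [mg [N Ng]]; split; first exact: measurable_funM.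
by exists (M * N) => x; rewrite normrM ler_pM.
Qed.

Lemma bmf_norm f : bmf f -> bmf (fun x => `|f x|).
Proof.
move=> [mf [M Mf]]; split; first exact: measurableT_comp.
by exists M => x; rewrite normr_id.
Qed.

Lemma eq_bmf f g : f =1 g -> bmf f -> bmf g.
Proof. by move=> /funext ->. Qed.
End bmf_theory.

Section EX_theory.
Context d (T : measurableType d) (R : realType) (mu : probability T R).
Implicit Types f g : T -> R.

Notation itg f := (mu.-integrable setT (EFin \o f)).

Lemma prob_lty : (mu setT < +oo)%E.
Proof. by rewrite (probability_setT mu) ltry. Qed.

Lemma bmf_itg f : bmf f -> itg f.
Proof.
move=> [mf [M Mf]]; apply: measurable_bounded_integrable => //.
  exact: prob_lty.
exists M; split; first exact: num_real.
by move=> x Mx y _; exact: (le_trans (Mf y) (ltW Mx)).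
Qed.

Lemma EX_cst (c : R) : EX mu (fun=> c) = c.
Proof.
transitivity (c * fine (mu setT)); first exact: Rintegral_cst.
by rewrite (probability_setT mu) mulr1.
Qed.

Lemma EX_D f g : itg f -> itg g -> EX mu (fun x => f x + g x) = EX mu f + EX mu g.
Proof. by move=> *; exact: RintegralD. Qed.

Lemma EX_B f g : itg f -> itg g -> EX mu (fun x => f x - g x) = EX mu f - EX mu g.
Proof. by move=> *; exact: RintegralB. Qed.

Lemma EX_Z (c : R) f : itg f -> EX mu (fun x => c * f x) = c * EX mu f.
Proof. by move=> *; exact: RintegralZl. Qed.

Lemma EX_N f : itg f -> EX mu (fun x => - f x) = - EX mu f.
Proof.
move=> mf; under eq_fun do rewrite -mulN1r.
by rewrite EX_Z// mulN1r.
Qed.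

Lemma EX_le f g : itg f -> itg g -> (forall x, f x <= g x) -> EX mu f <= EX mu g.
Proof. by move=> *; apply: le_Rintegral. Qed.

Lemma EX_ge0 f : (forall x, 0 <= f x) -> 0 <= EX mu f.
Proof. by move=> f0; apply: Rintegral_ge0. Qed.

Lemma EX_norm f : itg f -> `|EX mu f| <= EX mu (fun x => `|f x|).
Proof. by move=> *; apply: le_normr_Rintegral. Qed.

Lemma itg_norm f : itg f -> itg (fun x => `|f x|).
Proof. by move=> h; have := integrable_norm h. Qed.

Lemma EX_norm_le f (M : R) : bmf f -> (forall x, `|f x| <= M) -> `|EX mu f| <= M.
Proof.
move=> bf fM; rewrite (le_trans (EX_norm (bmf_itg bf)))//.
rewrite -[leRHS]EX_cst; apply: EX_le => //; apply: bmf_itg.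
  exact: bmf_norm.
exact: bmf_cst.
Qed.

Lemma EX_cvg_dom (f : nat -> T -> R) (g h : T -> R) : (forall n, measurable_fun setT (f n)) ->
  mu.-integrable setT (EFin \o h) ->
  (forall n x, `|f n x| <= h x) -> (forall x, f n x @[n --> \oo] --> g x) ->
  EX mu (f n) @[n --> \oo] --> EX mu g.
Proof.
move=> mf ih fh fg.
have mg : measurable_fun setT g by apply: (measurable_fun_cvg mf) => x _; exact: fg.
have [|||||ig _ c] := @dominated_convergence _ _ _ mu setT measurableT
  (fun n => EFin \o f n) (EFin \o g) (EFin \o h).
- by move=> n; exact/measurable_EFinP.
- exact/measurable_EFinP.
- by apply: aeW => x _ /=; apply: cvg_EFin => //; [exact: nearW | exact: fg].
- exact: ih.
- by apply: aeW => x n _ /=; rewrite lee_fin.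
rewrite /EX /Rintegral.
apply: (@fine_cvg R).
rewrite fineK//; exact: integrable_fin_num.
Qed.

Lemma EX_cvg (f : nat -> T -> R) g (M : R) : (forall n, measurable_fun setT (f n)) ->
  (forall n x, `|f n x| <= M) -> (forall x, f n x @[n --> \oo] --> g x) ->
  EX mu (f n) @[n --> \oo] --> EX mu g.
Proof.
move=> mf fM fg; apply: (@EX_cvg_dom f g (fun=> M)) => //.
exact/bmf_itg/bmf_cst.
Qed.

Lemma EX_indic (A : set T) : measurable A -> EX mu (\1_A : T -> R) = fine (mu A).
Proof. by move=> mA; rewrite /EX /Rintegral integral_indic// setIT. Qed.

Lemma bmf_indic (A : set T) : measurable A -> bmf (\1_A : T -> R).
Proof.
move=> mA; split; first exact: measurable_indic.
by exists 1 => x; rewrite indicE; case: (_ \in _); rewrite ?normr1 ?normr0.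
Qed.
End EX_theory.

Section EX_fubini.
Context d1 d2 (T1 : measurableType d1) (T2 : measurableType d2) (R : realType).
Variables (m1 : probability T1 R) (m2 : probability T2 R).

(** Tonelli gives measurability of partial integrals of nonnegative functions, so the positive and
    negative parts are treated apart. *)
Lemma measurable_EX (f : T1 * T2 -> R) : measurable_fun setT f ->
  measurable_fun setT (fun x => EX m2 (fun y => f (x, y))).
Proof.
move=> mf; rewrite /EX /Rintegral.
apply: (measurableT_comp (f := fine)) => //.
under eq_fun do rewrite integralE.
have mf' : measurable_fun setT (EFin \o f) by exact/measurable_EFinP.
apply: emeasurable_funB.
  rewrite [X in measurable_fun _ X](_ : _ = fubini_F m2 ((EFin \o f)^\+)%E); last first.
    by apply/funext => x; apply: eq_integral => y _; rewrite !funeposE.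
  apply: measurable_fun_fubini_tonelli_F.
  - exact: measurable_funepos.
  - by move=> x; exact: funepos_ge0.
rewrite [X in measurable_fun _ X](_ : _ = fubini_F m2 ((EFin \o f)^\-)%E); last first.
  by apply/funext => x; apply: eq_integral => y _; rewrite !funenegE.
apply: measurable_fun_fubini_tonelli_F.
- exact: measurable_funeneg.
- by move=> x; exact: funeneg_ge0.
Qed.

Lemma EX_fubini_itg (f : T1 * T2 -> R) :
  (m1 \x m2)%E.-integrable setT (EFin \o f) ->
  (forall x, m2.-integrable setT (EFin \o (fun y => f (x, y)))) ->
  (forall y, m1.-integrable setT (EFin \o (fun x => f (x, y)))) ->
  EX m1 (fun x => EX m2 (fun y => f (x, y))) =
  EX m2 (fun y => EX m1 (fun x => f (x, y))).
Proof.
move=> itf i2 i1; rewrite /EX /Rintegral.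
under eq_integral.
  move=> x _; rewrite fineK; last first.
    by have /= := integrable_fin_num measurableT (i2 x).
  over.
under [in RHS]eq_integral.
  move=> x _; rewrite fineK; last first.
    by have /= := integrable_fin_num measurableT (i1 x).
  over.
by rewrite (@Fubini _ _ _ _ _ m1 m2 (EFin \o f)).
Qed.

Lemma bmf_section1 (f : T1 * T2 -> R) x : bmf f -> bmf (fun y => f (x, y)).
Proof.
move=> [mf [M fM]]; split; last by exists M.
by apply: (measurableT_comp mf); exact: measurable_pair1.
Qed.

Lemma bmf_section2 (f : T1 * T2 -> R) y : bmf f -> bmf (fun x => f (x, y)).
Proof.
move=> [mf [M fM]]; split; last by exists M.
by apply: (measurableT_comp mf); exact: measurable_pair2.
Qed.

Lemma EX_fubini (f : T1 * T2 -> R) : bmf f ->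
  EX m1 (fun x => EX m2 (fun y => f (x, y))) =
  EX m2 (fun y => EX m1 (fun x => f (x, y))).
Proof.
move=> bf; apply: EX_fubini_itg.
- exact: (@bmf_itg _ _ _ (m1 \x m2)%E f bf).
- by move=> x; exact/bmf_itg/bmf_section1.
- by move=> x; exact/bmf_itg/bmf_section2.
Qed.

Lemma EX_prod (f : T1 * T2 -> R) : bmf f ->
  EX (m1 \x m2)%E f = EX m1 (fun x => EX m2 (fun y => f (x, y))).
Proof.
move=> bf; rewrite /EX /Rintegral.
under [in RHS]eq_integral.
  move=> x _; rewrite fineK; last first.
    have /bmf_itg := (@bmf_section1 f x bf) => /(_ m2) ib.
    by have /= := integrable_fin_num measurableT ib.
  over.
rewrite (@integral12_prod_meas1 _ _ _ _ _ m1 m2 (EFin \o f))//.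
exact: (@bmf_itg _ _ _ (m1 \x m2)%E f bf).
Qed.
End EX_fubini.

(** A modulus with values in [R] rather than in [R[i]], so that it can be integrated and compared
    with real bounds. *)
Definition cabs (R : realType) (z : R[i]) : R :=
  Num.sqrt (complex.Re z ^+ 2 + complex.Im z ^+ 2).

Definition cbmf d (T : measurableType d) (R : realType) (f : T -> R[i]) : Prop :=
  bmf (fun x => complex.Re (f x)) /\ bmf (fun x => complex.Im (f x)).

Definition CE d (T : measurableType d) (R : realType) (mu : probability T R)
  (f : T -> R[i]) : R[i] :=
  Complex (EX mu (fun x => complex.Re (f x))) (EX mu (fun x => complex.Im (f x))).

Section cabs_theory.
Variable R : realType.
Implicit Types z w : R[i].

Lemma cReM z w : complex.Re (z * w) =
  complex.Re z * complex.Re w - complex.Im z * complex.Im w.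
Proof. by case: z => a b; case: w. Qed.

Lemma cImM z w : complex.Im (z * w) =
  complex.Re z * complex.Im w + complex.Im z * complex.Re w.
Proof. by case: z => a b; case: w. Qed.

Lemma cReD z w : complex.Re (z + w) = complex.Re z + complex.Re w.
Proof. by case: z => a b; case: w. Qed.

Lemma cImD z w : complex.Im (z + w) = complex.Im z + complex.Im w.
Proof. by case: z => a b; case: w. Qed.

Lemma cReN z : complex.Re (- z) = - complex.Re z. Proof. by case: z. Qed.
Lemma cImN z : complex.Im (- z) = - complex.Im z. Proof. by case: z. Qed.

Lemma cabs_ge0 z : 0 <= cabs z. Proof. exact: sqrtr_ge0. Qed.

Lemma cabs_sqr z : cabs z ^+ 2 = complex.Re z ^+ 2 + complex.Im z ^+ 2.
Proof. by rewrite sqr_sqrtr// addr_ge0 ?sqr_ge0. Qed.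

Lemma cabsM z w : cabs (z * w) = cabs z * cabs w.
Proof.
rewrite /cabs -sqrtrM ?addr_ge0 ?sqr_ge0//; congr Num.sqrt.
by rewrite cReM cImM; ring.
Qed.

Lemma cabsN z : cabs (- z) = cabs z.
Proof. by rewrite /cabs cReN cImN !sqrrN. Qed.

Lemma cabs_Re z : `|complex.Re z| <= cabs z.
Proof.
rewrite -(@ler_pXn2r _ 2)// ?nnegrE ?cabs_ge0//.
by rewrite cabs_sqr real_normK ?num_real// lerDl sqr_ge0.
Qed.

Lemma cabs_Im z : `|complex.Im z| <= cabs z.
Proof.
rewrite -(@ler_pXn2r _ 2)// ?nnegrE ?cabs_ge0//.
by rewrite cabs_sqr real_normK ?num_real// lerDr sqr_ge0.
Qed.

Lemma cabs_le_ReIm z : cabs z <= `|complex.Re z| + `|complex.Im z|.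
Proof.
rewrite -(@ler_pXn2r _ 2)// ?nnegrE ?cabs_ge0 ?addr_ge0//.
rewrite cabs_sqr sqrrD !real_normK ?num_real//.
by rewrite lerD2r lerDl mulrn_wge0// mulr_ge0.
Qed.

Lemma Re_mul_le z w : complex.Re (z * w) <= cabs z * cabs w.
Proof. by rewrite -cabsM (le_trans (ler_norm _))// cabs_Re. Qed.

Lemma cabsD z w : cabs (z + w) <= cabs z + cabs w.
Proof.
rewrite -(@ler_pXn2r _ 2)// ?nnegrE ?cabs_ge0 ?addr_ge0 ?cabs_ge0//.
have h : complex.Re z * complex.Re w + complex.Im z * complex.Im w
    <= cabs z * cabs w.
  have := Re_mul_le z (Complex (complex.Re w) (- complex.Im w)).
  by rewrite cReM/= /cabs/= sqrrN mulrN opprK.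
rewrite sqrrD !cabs_sqr cReD cImD.
rewrite -subr_ge0.
rewrite (_ : _ - _ = (cabs z * cabs w -
  (complex.Re z * complex.Re w + complex.Im z * complex.Im w)) *+ 2); last by ring.
by rewrite mulrn_wge0// subr_ge0.
Qed.

Lemma cabsB z w : cabs (z - w) <= cabs z + cabs w.
Proof. by rewrite -(cabsN w); exact: cabsD. Qed.

Lemma cabs_real (x : R) : cabs (Complex x 0) = `|x|.
Proof. by rewrite /cabs/= expr0n/= addr0 sqrtr_sqr. Qed.

Lemma cabs1 : cabs (1 : R[i]) = 1.
Proof. by rewrite /cabs/= expr0n/= addr0 expr1n sqrtr1. Qed.

Lemma cabs0 : cabs (0 : R[i]) = 0.
Proof. by rewrite /cabs/= expr0n/= addr0 sqrtr0. Qed.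

Definition cis (t : R) : R[i] := Complex (cos t) (sin t).

Lemma cabs_cis t : cabs (cis t) = 1.
Proof. by rewrite /cabs/= cos2Dsin2 sqrtr1. Qed.

Lemma cisD a b : cis (a + b) = cis a * cis b.
Proof.
rewrite /cis cosD sinD; apply/eqP; rewrite eq_complex cReM cImM/=.
by rewrite eqxx/= addrC (mulrC (cos a)) (mulrC (sin a)); apply/eqP; ring.
Qed.

Lemma cis0 : cis 0 = 1.
Proof. by rewrite /cis cos0 sin0. Qed.
End cabs_theory.

Section CE_theory.
Context d (T : measurableType d) (R : realType) (mu : probability T R).
Implicit Types f g : T -> R[i].

Lemma cbmf_cst (c : R[i]) : cbmf (fun _ : T => c).
Proof. by split; exact: bmf_cst. Qed.

Lemma cbmfD f g : cbmf f -> cbmf g -> cbmf (fun x => f x + g x).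
Proof.
move=> [f1 f2] [g1 g2]; split.
  by under eq_fun do rewrite cReD; exact: bmfD.
by under eq_fun do rewrite cImD; exact: bmfD.
Qed.

Lemma cbmfN f : cbmf f -> cbmf (fun x => - f x).
Proof.
move=> [f1 f2]; split.
  by under eq_fun do rewrite cReN; exact: bmfN.
by under eq_fun do rewrite cImN; exact: bmfN.
Qed.

Lemma cbmfB f g : cbmf f -> cbmf g -> cbmf (fun x => f x - g x).
Proof. by move=> bf bg; apply: cbmfD => //; exact: cbmfN. Qed.

Lemma cbmfM f g : cbmf f -> cbmf g -> cbmf (fun x => f x * g x).
Proof.
move=> [f1 f2] [g1 g2]; split.
  by under eq_fun do rewrite cReM; apply: bmfB; exact: bmfM.
by under eq_fun do rewrite cImM; apply: bmfD; exact: bmfM.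
Qed.

Lemma bmf_cabs f : cbmf f -> bmf (fun x => cabs (f x)).
Proof.
move=> [[m1 [M1 b1]] [m2 [M2 b2]]]; split.
  rewrite /cabs; apply: (@measurableT_comp _ _ _ _ _ _ (@Num.sqrt R)).
    by apply: continuous_measurable_fun; exact: sqrt_continuous.
  by apply: measurable_funD; exact: measurable_funX.
exists (M1 + M2) => x; rewrite ger0_norm ?cabs_ge0//.
by rewrite (le_trans (cabs_le_ReIm _))// lerD.
Qed.

Lemma CE_cst c : CE mu (fun=> c) = c.
Proof. by rewrite /CE !EX_cst; case: c. Qed.

Lemma CE_D f g : cbmf f -> cbmf g -> CE mu (fun x => f x + g x) = CE mu f + CE mu g.
Proof.
move=> [f1 f2] [g1 g2]; rewrite /CE.
under eq_fun do rewrite cReD.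
under [X in Complex _ (EX _ X)]eq_fun do rewrite cImD.
by rewrite !EX_D//; exact: bmf_itg.
Qed.

Lemma CE_N f : cbmf f -> CE mu (fun x => - f x) = - CE mu f.
Proof.
move=> [f1 f2]; rewrite /CE.
under eq_fun do rewrite cReN.
under [X in Complex _ (EX _ X)]eq_fun do rewrite cImN.
by rewrite !EX_N//; exact: bmf_itg.
Qed.

Lemma CE_B f g : cbmf f -> cbmf g -> CE mu (fun x => f x - g x) = CE mu f - CE mu g.
Proof. by move=> bf bg; rewrite CE_D ?CE_N//; exact: cbmfN. Qed.

Lemma CE_Z c f : cbmf f -> CE mu (fun x => c * f x) = c * CE mu f.
Proof.
move=> [f1 f2]; rewrite /CE.
under eq_fun do rewrite cReM.
under [X in Complex _ (EX _ X)]eq_fun do rewrite cImM.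
rewrite EX_B ?EX_D ?EX_Z//; try exact: bmf_itg;
  try by apply: bmf_itg; apply: bmfM => //; exact: bmf_cst.
by apply/eqP; rewrite eq_complex cReM cImM/= !eqxx.
Qed.

(** With [c] the conjugate of the mean, the squared modulus of the mean is the real part of the mean
    of [c * f], and pointwise this real part is at most [cabs c * cabs (f x)]. Dividing by [cabs c]
    concludes. *)
Lemma CE_norm f : cbmf f -> cabs (CE mu f) <= EX mu (fun x => cabs (f x)).
Proof.
move=> bf.
have [->|z0] := eqVneq (cabs (CE mu f)) 0; first exact/EX_ge0/(fun x => cabs_ge0 _).
have zp : 0 < cabs (CE mu f) by rewrite lt_neqAle eq_sym z0 cabs_ge0.
rewrite -(ler_pM2l zp) -expr2.
set c := Complex (complex.Re (CE mu f)) (- complex.Im (CE mu f)).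
have cc : cabs c = cabs (CE mu f) by rewrite /c /cabs/= sqrrN.
have -> : cabs (CE mu f) ^+ 2 = complex.Re (CE mu (fun x => c * f x)).
  by rewrite CE_Z// cabs_sqr cReM /c/= mulNr opprK !expr2.
rewrite -cc -EX_Z; last exact/bmf_itg/bmf_cabs.
rewrite /CE/=; apply: EX_le.
- apply: bmf_itg; have [] : cbmf (fun x => c * f x) by apply: cbmfM => //; exact: cbmf_cst.
  by [].
- by apply: bmf_itg; apply: bmfM; [exact: bmf_cst | exact: bmf_cabs].
- by move=> x; exact: Re_mul_le.
Qed.

Lemma CE_norm_le f (g : T -> R) : cbmf f -> mu.-integrable setT (EFin \o g) ->
  (forall x, cabs (f x) <= g x) -> cabs (CE mu f) <= EX mu g.
Proof.
move=> bf bg fg; rewrite (le_trans (CE_norm bf))//; apply: EX_le => //.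
exact/bmf_itg/bmf_cabs.
Qed.
End CE_theory.

(** * Calculus and integration against the uniform law *)

Section deriv.
Variable R : realType.
Implicit Types (f g : R -> R) (x : R).

Definition isd f x (a : R) : Prop := is_derive x 1 f a.

Lemma dC x (c : R) : isd (fun _ : R => c) x 0.
Proof. exact: is_derive_cst. Qed.
Lemma dI x : isd (fun y : R => y) x 1.
Proof. exact: is_derive_id. Qed.
Lemma dD f g x a b : isd f x a -> isd g x b ->
  isd (fun y => f y + g y) x (a + b).
Proof. by move=> hf hg; exact: is_deriveD. Qed.
Lemma dN f x a : isd f x a -> isd (fun y => - f y) x (- a).
Proof. by move=> hf; exact: is_deriveN. Qed.
Lemma dM f g x a b : isd f x a -> isd g x b ->
  isd (fun y => f y * g y) x (f x * b + g x * a).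
Proof. by move=> hf hg; exact: is_deriveM. Qed.
Lemma dcomp f g x a b : isd f (g x) a -> isd g x b ->
  isd (fun y => f (g y)) x (a * b).
Proof. by move=> hf hg; exact: is_derive1_comp. Qed.
Lemma deq f x (a b : R) : isd f x a -> a = b -> isd f x b.
Proof. by move=> h <-. Qed.
Lemma dX f n x a : isd f x a ->
  isd (fun y => f y ^+ n) x (n%:R * f x ^+ n.-1 * a).
Proof.
case: n => [|n] hf.
  by rewrite mul0r mul0r; under eq_fun do rewrite expr0; exact: is_derive_cst.
elim: n => [|n IH].
  by under eq_fun do rewrite expr1; rewrite expr0 !mul1r.
under eq_fun do rewrite exprS.
apply: (@deq _ _ _ _ (dM hf IH)); rewrite /= exprS -(natr1 n.+1); ring.
Qed.
Lemma dexp f x a : isd f x a ->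
  isd (fun y => expR (f y)) x (expR (f x) * a).
Proof. by move=> hf; apply: (@dcomp expR) => //; exact: is_derive_expR. Qed.
Lemma dcos f x a : isd f x a ->
  isd (fun y => cos (f y)) x (- sin (f x) * a).
Proof. by move=> hf; exact: (@dcomp cos f x _ a (is_derive_cos (f x)) hf). Qed.
Lemma dsin f x a : isd f x a ->
  isd (fun y => sin (f y)) x (cos (f x) * a).
Proof. by move=> hf; exact: (@dcomp sin f x _ a (is_derive_sin (f x)) hf). Qed.
Lemma dln f x a : 0 < f x -> isd f x a ->
  isd (fun y => ln (f y)) x ((f x)^-1 * a).
Proof. by move=> f0 hf; apply: (@dcomp (@ln R)) => //; exact: is_derive1_ln. Qed.
Lemma dinv f x a : f x != 0 -> isd f x a ->
  isd (fun y => (f y)^-1) x (- (f x) ^- 2 * a).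
Proof. by move=> f0 hf; have := @is_deriveV _ f x a 1 f0 hf. Qed.
Lemma dvb f x a : isd f x a -> derivable f x 1.
Proof. by case. Qed.
Lemma dcont f x a : isd f x a -> {for x, continuous f}.
Proof. by case => h _; exact/differentiable_continuous/derivable1_diffP. Qed.
End deriv.

(** Syntax-directed differentiation: the derivative is built as an existential variable by the rules
    above, and the side conditions of [ln] and of the inverse are left as goals. [deq] then lets
    [ring] or [field] identify it with the expected formula. *)
Ltac dtac :=
  match goal with
  | |- isd (fun _ => ?c) _ _ => eapply dC
  | |- isd (fun x => x) _ _ => eapply dI
  | |- isd (fun x => @GRing.add _ (@?f x) (@?g x)) _ _ => eapply (@dD _ f g); dtac
  | |- isd (fun x => @GRing.opp _ (@?f x)) _ _ => eapply (@dN _ f); dtac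
  | |- isd (fun x => @GRing.mul _ (@?f x) (@?g x)) _ _ => eapply (@dM _ f g); dtac
  | |- isd (fun x => @GRing.exp _ (@?f x) _) _ _ => eapply (@dX _ f); dtac
  | |- isd (fun x => expR (@?f x)) _ _ => eapply (@dexp _ f); dtac
  | |- isd (fun x => cos (@?f x)) _ _ => eapply (@dcos _ f); dtac
  | |- isd (fun x => sin (@?f x)) _ _ => eapply (@dsin _ f); dtac
  | |- isd (fun x => ln (@?f x)) _ _ => eapply (@dln _ f); [|dtac]
  | |- isd (fun x => GRing.inv (@?f x)) _ _ => eapply (@dinv _ f); [|dtac]
  | _ => idtac
  end.

Section IL_theory.
Variable R : realType.
Implicit Types (f g : R -> R) (a b c : R).

(** Open intervals allow a piecewise function to be replaced by the formula of one branch without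
    looking at the breakpoints. *)
Definition IL a b f : R := \int[@lebesgue_measure R]_(x in `]a, b[) f x.

Definition lam : probability (measurableTypeR R) R := uniform_prob (@ltr01 R).

(* Composing with cl does not change an integral against lam, but it turns functions
   bounded on [0, 1] into bounded functions. *)
Definition cl (u : R) : R := Num.max 0 (Num.min u 1).

Lemma cl_ge0 u : 0 <= cl u. Proof. by rewrite /cl le_max lexx. Qed.
Lemma cl_le1 u : cl u <= 1.
Proof. by rewrite /cl ge_max ler01 ge_min lexx orbT. Qed.
Lemma cl_id u : 0 <= u <= 1 -> cl u = u.
Proof. by move=> /andP[u0 u1]; rewrite /cl min_l// max_r. Qed.

Lemma measurable_cl : measurable_fun setT cl.
Proof. by apply: measurable_maxr => //; exact: measurable_minr. Qed.

Lemma IL_eq a b f g : (forall x, a < x < b -> f x = g x) -> IL a b f = IL a b g.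
Proof.
by move=> fg; apply: eq_Rintegral => x; rewrite inE/= in_itv/= => /fg.
Qed.

Lemma itv_itg a b f : measurable_fun setT f ->
  (exists M : R, forall x, a < x < b -> `|f x| <= M) ->
  (@lebesgue_measure R).-integrable `]a, b[ (EFin \o f).
Proof.
move=> mf [M fM]; apply: measurable_bounded_integrable => //.
- have := @lebesgue_measure_itv R `]a, b[ => /= h; rewrite [X in (X < _)%E]h.
  by case: ifP => _; rewrite -?EFinD ltry.
- exact: measurable_funTS.
- exists M; split; first exact: num_real.
  move=> x Mx y /=; rewrite in_itv/= => /fM fy; exact: (le_trans fy (ltW Mx)).
Qed.

Lemma IL_cat a b c f : a <= b <= c -> measurable_fun setT f ->
  (exists M : R, forall x, a < x < c -> `|f x| <= M) ->
  IL a c f = IL a b f + IL b c f.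
Proof.
move=> /andP[]; rewrite le_eqVlt => /predU1P[<- _ _ _|ab].
  by rewrite /IL set_itvoo0// Rintegral_set0 add0r.
rewrite le_eqVlt => /predU1P[<- _ _|bc mf bf].
  by rewrite /IL [X in _ + X]/Rintegral set_itvoo0// -/(Rintegral _ _ _) Rintegral_set0 addr0.
have [M fM] := bf.
rewrite /IL.
have -> : `]a, c[%classic = `]a, b[%classic `|` `[b, c[%classic :> set R.
  apply/seteqP; split => x /=; rewrite !in_itv/=.
    by move=> /andP[-> ->]/=; rewrite andbT; case: (ltP x b) => ?; [left|right].
  move=> [/andP[-> /lt_trans->]//|/andP[/(lt_le_trans ab) -> ->]//].
rewrite Rintegral_setU//=.
- congr (_ + _); rewrite -Rintegral_itv_obnd_cbnd//.
  by apply: itv_itg => //; exists M => x /andP[bx xc]; apply: fM; rewrite (lt_trans ab bx).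
- apply: measurable_bounded_integrable => //.
  + exact: measurableU.
  + rewrite (le_lt_trans (measureU2 _ _ _))//= !lebesgue_measure_itv/=.
    by rewrite !lte_fin ab bc -!EFinD ltry.
  + exact: measurable_funTS.
  + exists M; split; first exact: num_real.
    move=> x Mx y /=; rewrite !in_itv/= => h; apply: (le_trans _ (ltW Mx)); apply: fM.
    by case: h => /andP[h1 h2]; rewrite ?(lt_le_trans ab h1) ?h1 ?(lt_trans h2 bc)//=.
- apply/disj_set2P; rewrite -subset0 => x /=; rewrite !in_itv/= => -[/andP[_ h] /andP[]].
  by rewrite leNgt h.
Qed.

Lemma leb01_lty : (@lebesgue_measure R `[0%R, 1%R]%classic < +oo)%E.
Proof. by rewrite lebesgue_measure_itv/= lte_fin ltr01 -EFinD ltry. Qed.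

Lemma EX_lamE f : bmf f -> EX lam f = IL 0 1 f.
Proof.
move=> [mf [M fM]].
have M0 : 0 <= M by rewrite (le_trans _ (fM 0)).
have bf : bmf f by split => //; exists M.
have i01 : (@lebesgue_measure R).-integrable `[0, 1] (EFin \o f).
  apply: measurable_bounded_integrable => //.
  - exact: leb01_lty.
  - exact: measurable_funTS.
  - by exists M; split; [exact: num_real|move=> x Mx y _; exact: (le_trans (fM y) (ltW Mx))].
have i01c : (@lebesgue_measure R).-integrable `[0, 1] (EFin \o cst M).
  apply: measurable_bounded_integrable => //.
    exact: leb01_lty.
  by exists `|M|; split; [exact: num_real|move=> x Mx y _; exact: ltW].
(* [integral_uniform] is applied to a nonnegative function, hence the shift by the bound [M],
   removed again by [addIr]. *)
have : EX lam (fun x => f x + M) = EX lam f + M.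
  by rewrite EX_D ?EX_cst//; apply: bmf_itg => //; exact: bmf_cst.
rewrite [X in X = _]/EX /Rintegral integral_uniform; last 2 first.
- by apply/measurable_EFinP; exact: measurable_funD.
- by move=> x; rewrite lee_fin -lerBlDr sub0r; have := fM x; rewrite ler_norml => /andP[].
rewrite subr0 invr1 mul1e -/(Rintegral _ _ _) RintegralD//.
rewrite Rintegral_cst//= lebesgue_measure_itv/= lte_fin ltr01 oppr0 adde0/= mulr1.
move=> /addIr <-; rewrite /IL.
rewrite Rintegral_itv_bndo_bndc; last first.
  by apply: itv_itg => //; exists M.
by rewrite Rintegral_itv_obnd_cbnd//; apply: integrableS i01 => //; exact: subset_itv_oc_cc.
Qed.

Lemma EX_lam_cl f : measurable_fun setT f ->
  (exists M : R, forall x, 0 <= x <= 1 -> `|f x| <= M) ->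
  EX lam (fun u => f (cl u)) = IL 0 1 f.
Proof.
move=> mf [M fM]; rewrite EX_lamE.
  by apply: IL_eq => x /andP[x0 x1]; rewrite cl_id// (ltW x0) (ltW x1).
split; first exact: measurableT_comp mf measurable_cl.
by exists M => x; apply: fM; rewrite cl_ge0 cl_le1.
Qed.

Lemma IL_FTC a b F f : a <= b ->
  (forall x, a <= x <= b -> isd F x (f x)) ->
  (forall x, a <= x <= b -> derivable f x 1) ->
  IL a b f = F b - F a.
Proof.
rewrite le_eqVlt => /predU1P[<- _ _|ab dF df].
  by rewrite /IL set_itvoo0// Rintegral_set0 subrr.
have cf x : a <= x <= b -> {for x, continuous f}.
  by move=> /df /derivable1_diffP/differentiable_continuous.
have cF x : a <= x <= b -> {for x, continuous F}.
  by move=> /dF [dx _]; exact/differentiable_continuous/derivable1_diffP.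
have wf : {within `[a, b], continuous f}.
  apply: continuous_in_subspaceT => x; rewrite inE/= in_itv/=; exact: cf.
have := @continuous_FTC2 R f F a b ab wf _ _.
move=> h.
have {}h : (\int[lebesgue_measure]_(x in `[a, b]) (f x)%:E)%E = ((F b)%:E - (F a)%:E)%E.
  apply: h.
  - split.
    + by move=> x; rewrite in_itv/= => /andP[ax xb]; have [] := dF x _; rewrite ?(ltW ax) ?(ltW xb).
    + by apply: cvg_at_right_filter; apply: cF; rewrite lexx ltW.
    + by apply: cvg_at_left_filter; apply: cF; rewrite lexx ltW.
  - move=> x; rewrite in_itv/= => /andP[ax xb]; rewrite derive1E.
    by have [|_ ->] := dF x _; rewrite ?(ltW ax) ?(ltW xb).
have ic : (@lebesgue_measure R).-integrable `[a, b] (EFin \o f).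
  by apply: continuous_compact_integrable => //; exact: segment_compact.
rewrite /IL Rintegral_itv_bndo_bndc; last first.
  by apply: integrableS ic => //; exact: subset_itv_oo_cc.
rewrite Rintegral_itv_obnd_cbnd; last first.
  by apply: integrableS ic => //; exact: subset_itv_oc_cc.
by rewrite /Rintegral h.
Qed.

(** Reflection sends half-open intervals to half-open intervals of the same length, and Lebesgue
    measure is determined by its values on such intervals. *)
Lemma lebesgue_onem (A : set R) : measurable A ->
  lebesgue_measure A = pushforward (@lebesgue_measure R) (fun x => 1 - x : R) A.
Proof.
move=> mA.
have mo : measurable_fun setT (fun x : measurableTypeR R => 1 - x : measurableTypeR R).
  exact: measurable_funB.
apply: (@lebesgue_measure_unique R (pushforward (@lebesgue_measure R) (fun x : measurableTypeR R => 1 - x : measurableTypeR R))) => //.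
move=> X [[x y] /= xy <-]; rewrite /pushforward.
rewrite (_ : _ @^-1` _ = `[1 - y, 1 - x[%classic :> set R); last first.
  apply/seteqP; split => z/=; rewrite !in_itv/=; lra.
rewrite !lebesgue_measure_itv/= !lte_fin.
rewrite (_ : (1 - y < 1 - x) = (x < y)); last by apply/idP/idP; lra.
case: ifP => // _; rewrite -!EFinD; congr EFin; lra.
Qed.

Lemma EX_reflect f : measurable_fun setT f ->
  (exists M : R, forall x, 0 <= x <= 1 -> `|f x| <= M) ->
  EX lam (fun u => f (1 - cl u)) = EX lam (fun u => f (cl u)).
Proof.
move=> mf [M fM].
have mo : measurable_fun setT (fun x : R => 1 - x) by exact: measurable_funB.
rewrite (@EX_lam_cl (fun u => f (1 - u))); last 2 first.
- exact: (measurableT_comp mf mo).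
- by exists M => x x01; apply: fM; move: x01; lra.
rewrite EX_lam_cl//; last by exists M.
have io : (@lebesgue_measure R).-integrable `]0, 1[ (EFin \o f).
  by apply: itv_itg => //; exists M => x /andP[x0 x1]; apply: fM; rewrite !ltW.
rewrite /IL /Rintegral; congr fine.
pose om : measurableTypeR R -> measurableTypeR R := fun x => 1 - x.
transitivity (\int[pushforward (@lebesgue_measure R) om]_(x in `]0%R, 1%R[) (f x)%:E)%E; last first.
  by apply: eq_measure_integral => A mA _; rewrite [RHS]lebesgue_onem.
have E : om @^-1` `]0, 1[ = `]0, 1[%classic :> set R.
  by apply/seteqP; split => z/=; rewrite !in_itv/= /om; lra.
rewrite (@integral_pushforward _ _ _ _ _ om).
- by rewrite E.
- exact: mo.
- exact/measurable_EFinP.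
- rewrite E; apply: (@itv_itg 0 1 (fun x => f (1 - x))).
    exact: (measurableT_comp mf mo).
  by exists M => x /andP[x0 x1]; apply: fM; lra.
- by [].
Qed.
End IL_theory.

(** * Elementary Taylor bounds *)

Section elementary.
Variable R : realType.
Implicit Types (f : R -> R) (t x M : R).

(** Applied repeatedly below, each Taylor bound serving as derivative bound for the next one. This
    loses the factorials of Taylor's formula, which are harmless here. *)
Lemma mvt_bound f (f' : R -> R) t M :
  (forall x, `|x| <= `|t| -> isd f x (f' x)) ->
  (forall x, `|x| <= `|t| -> `|f' x| <= M) -> `|f t - f 0| <= M * `|t|.
Proof.
move=> df bf.
wlog t0 : t f f' df bf / 0 <= t.
  move=> H; have [t0|t0] := leP 0 t; first exact: (H t f f' df bf t0).
  have := H (- t) (fun x => f (- x)) (fun x => - f' (- x)).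
  rewrite !normrN opprK oppr0; apply.
  - move=> x xt; have h := df (- x); rewrite normrN in h.
    apply: (@deq _ _ _ (f' (- x) * - 1)); last by rewrite mulrN1.
    by apply: (@dcomp _ f (fun x => - x)); [exact: h | apply: dN; exact: dI].
  - by move=> x xt; rewrite normrN; apply: bf; rewrite normrN.
  - by rewrite oppr_ge0 ltW.
have inb x : 0 <= x <= t -> `|x| <= `|t|.
  by move=> /andP[x0 xt]; rewrite !ger0_norm// (le_trans x0).
have [||c] := @MVT_segment R f f' 0 t t0.
- by move=> x; rewrite in_itv/= => /andP[x0 xt]; apply: df; apply: inb; rewrite !ltW.
- apply: continuous_in_subspaceT => x; rewrite inE/= in_itv/= => /inb /df.
  exact: dcont.
rewrite in_itv/= => /inb cb ->; rewrite subr0 normrM ler_wpM2r//.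
exact: bf.
Qed.

Lemma norm_sin_le t : `|sin t| <= `|t|.
Proof.
have := @mvt_bound sin cos t 1; rewrite sin0 subr0 mul1r; apply.
  by move=> x _; exact: is_derive_sin.
by move=> x _; exact: cos_max.
Qed.

Lemma cos_sub1_le t : `|cos t - 1| <= t ^+ 2.
Proof.
have := @mvt_bound cos (fun x => - sin x) t `|t|; rewrite cos0 -expr2 real_normK ?num_real//.
apply; first by move=> x _; exact: is_derive_cos.
by move=> x xt; rewrite normrN (le_trans (norm_sin_le x)).
Qed.

Lemma sin_sub_le t : `|sin t - t| <= `|t| ^+ 3.
Proof.
have := @mvt_bound (fun x => sin x - x) (fun x => cos x - 1) t (t ^+ 2).
rewrite sin0 !subr0 (exprSr _ 2) real_normK ?num_real//; apply.
  by move=> x _; eapply deq; [dtac|rewrite /=; ring].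
move=> x xt; rewrite (le_trans (cos_sub1_le x))//.
by rewrite -(real_normK (num_real x)) -(real_normK (num_real t)) lerXn2r.
Qed.

Lemma cos_taylor_le t : `|cos t - 1 + t ^+ 2 / 2| <= `|t| ^+ 4.
Proof.
have := @mvt_bound (fun x => cos x - 1 + x ^+ 2 / 2) (fun x => - (sin x - x)) t (`|t| ^+ 3).
rewrite cos0 subrr expr0n/= mul0r addr0 subr0 -exprSr; apply.
  by move=> x _; eapply deq; [dtac|rewrite /=; field].
move=> x xt; rewrite normrN (le_trans (sin_sub_le x))//.
by rewrite lerXn2r.
Qed.

Lemma expR_sub1_le t (B : R) : `|t| <= B -> `|expR t - 1| <= expR B * `|t|.
Proof.
move=> tB; have := @mvt_bound expR expR t (expR B); rewrite expR0; apply.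
  by move=> x _; exact: is_derive_expR.
move=> x xt; rewrite ger0_norm ?expR_ge0// ler_expR (le_trans (ler_norm _))//.
exact: le_trans xt tB.
Qed.

Lemma expR_taylor_le t (B : R) : `|t| <= B -> `|expR t - 1 - t| <= expR B * t ^+ 2.
Proof.
move=> tB.
have := @mvt_bound (fun x => expR x - 1 - x) (fun x => expR x - 1) t (expR B * `|t|).
rewrite expR0 subrr !subr0 -mulrA -expr2 real_normK ?num_real//; apply.
  by move=> x _; eapply deq; [dtac|rewrite /=; ring].
move=> x xt; rewrite (le_trans (expR_sub1_le (le_trans xt tB)))//.
by rewrite ler_wpM2l ?expR_ge0.
Qed.

End elementary.

(** * The splitting operator and its fixed point *)

Section first_order.
Variable R : realType.
Implicit Types (s y w u : R).

(* sigma2 = 2 * vK. The functions al and be are the coefficients of i s and s^2 in the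
   expansion of the fixed point rfix of split_op; R1 and R2 are primitives of the two
   branches of be. The value of vK is the one for which be has integral 0. *)
Definition vK : R := 8 * ln 2 - 5.
Definition bb w : R := 4 * w * (ln 2 - ln w) - 7 / 2 * w + 2 * w ^+ 2 - 1.
Definition al w : R := if w <= 1 then 1 - 2 * w else 0.
Definition be w : R := if w <= 1 then vK * w / 2 - (1 - 2 * w) ^+ 2 / 2
  else if w <= 2 then bb w else 0.
Definition R2 w : R := w ^+ 2 * (2 * (ln 2 - ln w) - 3 / 4) + 2 / 3 * w ^+ 3 - w - 1 / 3.
Definition R1 w : R := vK * w ^+ 2 / 4 + (1 - 2 * w) ^+ 3 / 12 - 1 / 12.

Lemma ln2_bounds : 0 <= ln (2 : R) <= 1.
Proof.
apply/andP; split; first by rewrite ln_ge0// ler1n.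
by have := @le_ln1Dx R 1; rewrite (_ : 1 + 1 = 2 :> R); [apply; lra | ring].
Qed.

Lemma al_bound w : 0 <= w -> `|al w| <= 1.
Proof. by rewrite /al => w0; case: ifP => h; rewrite ?normr0// ler_norml; lra. Qed.

Lemma ln_itv12 w : 1 <= w <= 2 -> 0 <= ln 2 - ln w <= 1.
Proof.
move=> /andP[w1 w2]; have := ln2_bounds => /andP[l0 l1].
have h1 : 0 <= ln w by apply: ln_ge0.
have h2 : ln w <= ln 2 by rewrite ler_ln ?posrE//; lra.
lra.
Qed.

Lemma be_bound w : 0 <= w -> `|be w| <= 24.
Proof.
rewrite /be => w0; have := ln2_bounds => /andP[l0 l1].
case: ifPn => [w1|]; first by rewrite ler_norml /vK; nra.
rewrite -ltNge => w1; case: ifP => w2; last by rewrite normr0.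
have /andP[h0 h1] : 0 <= ln 2 - ln w <= 1 by apply: ln_itv12; rewrite w2 ltW.
by rewrite ler_norml /bb; nra.
Qed.

Lemma measurable_al : measurable_fun setT al.
Proof.
apply: measurable_fun_ifT => //; first exact: measurable_fun_ler.
by apply: measurable_funB => //; exact: measurable_funM.
Qed.

Lemma measurable_be : measurable_fun setT be.
Proof.
apply: measurable_fun_ifT => //; first exact: measurable_fun_ler.
  apply: measurable_funB => //.
    by apply: measurable_funM => //; exact: measurable_funM.
  apply: measurable_funM => //; apply: measurable_funX.
  by apply: measurable_funB => //; exact: measurable_funM.
apply: measurable_fun_ifT => //; first exact: measurable_fun_ler.
rewrite /bb; apply: measurable_funB => //; apply: measurable_funD => //; last first.
  by apply: measurable_funM => //; exact: measurable_funX.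
apply: measurable_funB => //.
by apply: measurable_funM => //; apply: measurable_funB => //; exact: measurable_ln.
Qed.

Lemma measurable_scale y : measurable_fun setT (fun u : R => y * u).
Proof. exact: measurable_funM. Qed.

(** First-order part of the fixed-point equation: twice this mean has to be [al y], which is 0
    beyond 1. It reflects the mean [2 * y] of [tau + 1]. The primitive [u - y * u ^+ 2] vanishes at
    both 0 and [y^-1]. *)
Lemma EX_al y : 1 < y -> EX (lam R) (fun u => al (y * cl u)) = 0.
Proof.
move=> y1; have y0 : 0 < y by lra.
have yi : 0 < y^-1 < 1 by rewrite invr_gt0 y0 invf_lt1.
have yy : y * y^-1 = 1 by rewrite mulfV// gt_eqF.
have mm := measurableT_comp measurable_al (measurable_scale y).
rewrite (@EX_lam_cl _ (fun u => al (y * u)))//; last first.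
  by exists 1 => x /andP[x0 _]; apply: al_bound; rewrite mulr_ge0// ltW.
rewrite (@IL_cat _ 0 y^-1)//; last 2 first.
- by lra.
- by exists 1 => x /andP[x0 _]; apply: al_bound; rewrite mulr_ge0// ltW.
rewrite (@IL_eq _ _ _ _ (fun u => 1 - 2 * (y * u))); last first.
  by move=> x xx; rewrite /al ifT//; nra.
rewrite (@IL_eq _ y^-1 _ _ (fun u => 0)); last first.
  by move=> x xx; rewrite /al ifF//; apply/negbTE; rewrite -ltNge; nra.
rewrite (@IL_FTC _ _ _ (fun u => u - y * u ^+ 2)); first last.
- by move=> x _; eapply dvb; dtac.
- by move=> x _; eapply deq; [dtac|rewrite /=; ring].
- by lra.
rewrite (@IL_FTC _ _ _ (fun u => 0)); first last.
- by move=> x _; eapply dvb; dtac.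
- by move=> x _; exact: dC.
- by lra.
by rewrite expr2 mulrA yy; ring.
Qed.

Lemma is_derive_R1 y x : y != 0 -> isd (fun u => y^-1 * R1 (y * u)) x
  (y^-1 * (y * (vK * (y * x) / 2 - (1 - 2 * (y * x)) ^+ 2 / 2))).
Proof. by move=> y0; rewrite /R1; eapply deq; [dtac|rewrite /=; field]. Qed.

Lemma is_derive_R2 y x : 0 < y * x -> isd (fun u => y^-1 * R2 (y * u)) x
  (y^-1 * (y * bb (y * x))).
Proof.
move=> yx; rewrite /R2; eapply deq; first by dtac.
by rewrite /= /bb; field; move: yx; rewrite lt_neqAle eq_sym mulf_eq0 negb_or => /andP[].
Qed.

Lemma EX_be y : 1 < y ->
  EX (lam R) (fun u => be (y * cl u)) = if y <= 2 then R2 y / y else 0.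
Proof.
move=> y1; have y0 : 0 < y by lra.
have yi : 0 < y^-1 < 1 by rewrite invr_gt0 y0 invf_lt1.
have yn : y != 0 by rewrite gt_eqF.
have yy : y * y^-1 = 1 by rewrite mulfV.
have mm := measurableT_comp measurable_be (measurable_scale y).
have bnd a c : 0 <= a -> exists M : R, forall x, a < x < c -> `|be (y * x)| <= M.
  by move=> a0; exists 24 => x /andP[x0 _]; apply: be_bound; rewrite mulr_ge0//; lra.
rewrite (@EX_lam_cl _ (fun u => be (y * u)))//; last first.
  by exists 24 => x /andP[x0 _]; apply: be_bound; rewrite mulr_ge0// ltW.
rewrite (@IL_cat _ 0 y^-1)//; last 2 first.
- by lra.
- exact: bnd.
rewrite (@IL_eq _ _ _ _ (fun u => y^-1 * (y * (vK * (y * u) / 2 - (1 - 2 * (y * u)) ^+ 2 / 2)))); last first.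
  by move=> x xx; rewrite /be [RHS]mulrA (mulVf yn) mul1r ifT//; nra.
rewrite (@IL_FTC _ _ _ (fun u => y^-1 * R1 (y * u))); first last.
- by move=> x _; eapply dvb; dtac.
- by move=> x _; exact: is_derive_R1.
- by lra.
(* The value of [vK] enters here: it makes the two primitives fit together at 1. With [R2 2 = 0]
   below, the mean of [be] then vanishes for all [y] beyond 2. *)
have R21 : R1 1 - R1 0 = R2 1.
  by rewrite /R1 /R2 ln1 /vK; field.
rewrite yy mulr0 -mulrBr R21.
have mid b : y^-1 <= b -> b * y <= 2 ->
    IL y^-1 b (fun u => be (y * u)) = y^-1 * (R2 (y * b) - R2 1).
  move=> yb b2.
  rewrite (@IL_eq _ _ _ _ (fun u => y^-1 * (y * bb (y * u)))); last first.
    move=> x xx; rewrite /be [RHS]mulrA (mulVf yn) mul1r ifF ?ifT//; first by nra.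
    by apply/negbTE; rewrite -ltNge; nra.
  have xp x : y^-1 <= x <= b -> 0 < y * x by nra.
  rewrite (@IL_FTC _ _ _ (fun u => y^-1 * R2 (y * u))); first last.
  - by move=> x /xp xx; rewrite /bb; eapply dvb; dtac.
  - by move=> x /xp xx; exact: is_derive_R2.
  - by [].
  by rewrite yy; ring.
have [y2|y2] := leP y 2.
  by rewrite mid; [rewrite mulr1; field | lra | lra].
have y2i : y^-1 < 2 * y^-1 < 1 by move: yi yy y2; nra.
rewrite (@IL_cat _ y^-1 (2 * y^-1))//; last 2 first.
- by lra.
- by apply: bnd; lra.
rewrite mid; [|lra|nra].
rewrite (@IL_eq _ (2 * y^-1) _ _ (fun u => 0)); last first.
  move=> x xx; rewrite /be ifF ?ifF//; apply/negbTE; rewrite -ltNge; nra.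
rewrite (@IL_FTC _ _ _ (fun u => 0)); first last.
- by move=> x _; eapply dvb; dtac.
- by move=> x _; exact: dC.
- by lra.
have -> : y * (2 * y^-1) = 2 by rewrite mulrCA yy mulr1.
have -> : R2 2 = 0 by rewrite /R2 subrr; field.
by ring.
Qed.

(** Both factors are nonzero only if both pieces are at most 1, that is for [u] between [1 - y^-1]
    and [y^-1], a range that is empty beyond [y = 2]. This is why the correction [bb] stops at 2. *)
Lemma EX_alal y : 1 < y ->
  EX (lam R) (fun u => al (y * cl u) * al (y * (1 - cl u))) =
  if y <= 2 then (- (2 / 3) * y ^+ 3 + 2 * y ^+ 2 - y - 2 / 3) / y else 0.
Proof.
move=> y1; have y0 : 0 < y by lra.
have yi : 0 < y^-1 < 1 by rewrite invr_gt0 y0 invf_lt1.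
have yn : y != 0 by rewrite gt_eqF.
have yy : y * y^-1 = 1 by rewrite mulfV.
have mm : measurable_fun setT (fun u => al (y * u) * al (y * (1 - u))).
  apply: measurable_funM; first exact: measurableT_comp measurable_al (measurable_scale y).
  apply: (measurableT_comp measurable_al); apply: (measurableT_comp (measurable_scale y)).
  exact: measurable_funB.
have bnd x : 0 <= x <= 1 -> `|al (y * x) * al (y * (1 - x))| <= 1.
  move=> xx; rewrite normrM -[leRHS]mulr1 ler_pM//; apply: al_bound; nra.
rewrite (@EX_lam_cl _ (fun u => al (y * u) * al (y * (1 - u))))//; last by exists 1.
have z a b : a <= b -> IL a b (fun=> 0) = 0 :> R.
  move=> ab; rewrite (@IL_FTC _ _ _ (fun u => 0)) ?subrr// => x _.
  exact: dC.
have [y2|y2] := leP y 2; last first.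
  rewrite (@IL_eq _ _ _ _ (fun=> 0)) ?z// => x xx.
  rewrite /al; case: ifP => h1; last by rewrite mul0r.
  by rewrite ifF ?mulr0//; apply/negbTE; rewrite -ltNge; nra.
have h2 : 1 - y^-1 <= y^-1 by move: yy yi; nra.
rewrite (@IL_cat _ 0 (1 - y^-1))//; last 2 first.
- by lra.
- by exists 1 => x xx; apply: bnd; lra.
rewrite (@IL_cat _ (1 - y^-1) y^-1)//; last 2 first.
- by lra.
- by exists 1 => x xx; apply: bnd; lra.
rewrite (@IL_eq _ 0 _ _ (fun=> 0)); last first.
  move=> x xx; rewrite [X in _ * X]/al ifF ?mulr0//; apply/negbTE; rewrite -ltNge; nra.
rewrite (@IL_eq _ y^-1 _ _ (fun=> 0)); last first.
  move=> x xx; rewrite [X in X * _]/al ifF ?mul0r//; apply/negbTE; rewrite -ltNge; nra.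
rewrite !z; [|lra|lra]; rewrite add0r addr0.
rewrite (@IL_eq _ _ _ _ (fun u => (1 - 2 * (y * u)) * (1 - 2 * (y * (1 - u))))); last first.
  by move=> x xx; rewrite /al !ifT//; nra.
rewrite (@IL_FTC _ _ _ (fun u => (1 - 2 * y) * u + 4 * y ^+ 2 * (u ^+ 2 / 2 - u ^+ 3 / 3))); first last.
- by move=> x _; eapply dvb; dtac.
- by move=> x _; eapply deq; [dtac|rewrite /=; field].
- by [].
by field.
Qed.

(* This is the s^2 coefficient of the equation split_op rapp = rapp. *)
Lemma key_identity y : 1 < y ->
  2 * EX (lam R) (fun u => be (y * cl u)) -
  EX (lam R) (fun u => al (y * cl u) * al (y * (1 - cl u))) = be y.
Proof.
move=> y1; rewrite EX_be// EX_alal// /be [y <= 1]leNgt y1/=.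
case: ifP => _; last by rewrite mulr0 subrr.
by rewrite /bb /R2; field; rewrite gt_eqF//; lra.
Qed.
End first_order.

Definition cm d (T : measurableType d) (R : realType) (f : T -> R[i]) : Prop :=
  measurable_fun setT (fun x => complex.Re (f x)) /\
  measurable_fun setT (fun x => complex.Im (f x)).

Section cm_theory.
Context d (T : measurableType d) (R : realType).

Lemma cm_comp d' (T' : measurableType d') (f : T' -> R[i]) (g : T -> T') :
  cm f -> measurable_fun setT g -> cm (fun x => f (g x)).
Proof.
by move=> [f1 f2] mg; split; [exact: (measurableT_comp f1 mg)|exact: (measurableT_comp f2 mg)].
Qed.

Lemma cmM (f g : T -> R[i]) : cm f -> cm g -> cm (fun x => f x * g x).
Proof.
move=> [f1 f2] [g1 g2]; split.
  by under eq_fun do rewrite cReM; apply: measurable_funB; exact: measurable_funM.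
by under eq_fun do rewrite cImM; apply: measurable_funD; exact: measurable_funM.
Qed.

Lemma cm_if (b : T -> bool) (f g : T -> R[i]) : measurable_fun setT b ->
  cm f -> cm g -> cm (fun x => if b x then f x else g x).
Proof.
move=> mb [f1 f2] [g1 g2]; split.
  by rewrite (_ : (fun x => _) = fun x => if b x then complex.Re (f x) else complex.Re (g x));
    [exact: measurable_fun_ifT|apply/funext => x; case: ifP].
by rewrite (_ : (fun x => _) = fun x => if b x then complex.Im (f x) else complex.Im (g x));
    [exact: measurable_fun_ifT|apply/funext => x; case: ifP].
Qed.

Lemma cbmf_cm (f : T -> R[i]) (M : R) : cm f -> (forall x, cabs (f x) <= M) -> cbmf f.
Proof.
move=> [f1 f2] fM; split; split => //; exists M => x.
  exact: (le_trans (cabs_Re _)).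
exact: (le_trans (cabs_Im _)).
Qed.
End cm_theory.

Lemma lexx_eq (R : realType) (x y : R) : x = y -> x <= y.
Proof. by move=> ->. Qed.

Section operator.
Variable R : realType.
Implicit Types (s y w u h l B D M : R) (f g : R -> R[i]).

Definition split_op f y : R[i] := CE (lam R) (fun u => f (y * cl u) * f (y * (1 - cl u))).

Lemma measurable_ycl y : measurable_fun setT (fun u : R => y * cl u).
Proof. by apply: measurable_funM => //; exact: measurable_cl. Qed.

Lemma measurable_y1cl y : measurable_fun setT (fun u : R => y * (1 - cl u)).
Proof.
by apply: measurable_funM => //; apply: measurable_funB => //; exact: measurable_cl.
Qed.

Lemma ycl_itv y u : 0 <= y -> 0 <= y * cl u <= y.
Proof. by move=> y0; rewrite mulr_ge0 ?cl_ge0//= ler_piMr ?cl_le1. Qed.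

Lemma y1cl_itv y u : 0 <= y -> 0 <= y * (1 - cl u) <= y.
Proof.
move=> y0; rewrite mulr_ge0 ?subr_ge0 ?cl_le1//= ler_piMr// lerBlDr lerDl.
exact: cl_ge0.
Qed.

Lemma cbmf_ycl f y M : 0 <= y -> cm f -> (forall w, 0 <= w <= y -> cabs (f w) <= M) ->
  cbmf (fun u => f (y * cl u)).
Proof.
move=> y0 mf fM; apply: (@cbmf_cm _ _ _ _ M).
  exact: (cm_comp mf (measurable_ycl y)).
by move=> u; apply: fM; exact: ycl_itv.
Qed.

Lemma cbmf_y1cl f y M : 0 <= y -> cm f -> (forall w, 0 <= w <= y -> cabs (f w) <= M) ->
  cbmf (fun u => f (y * (1 - cl u))).
Proof.
move=> y0 mf fM; apply: (@cbmf_cm _ _ _ _ M).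
  exact: (cm_comp mf (measurable_y1cl y)).
by move=> u; apply: fM; exact: y1cl_itv.
Qed.

Lemma cm_split_op f : cm f -> cm (split_op f).
Proof.
move=> mf.
have m1 : measurable_fun setT (fun z : R * R => z.1 * cl z.2).
  by apply: measurable_funM => //; apply: (measurableT_comp (@measurable_cl R)).
have m2 : measurable_fun setT (fun z : R * R => z.1 * (1 - cl z.2)).
  apply: measurable_funM => //; apply: measurable_funB => //.
  by apply: (measurableT_comp (@measurable_cl R)).
have [h1 h2] := @cmM _ _ _ _ _ (cm_comp mf m1) (cm_comp mf m2).
split.
  exact: (@measurable_EX _ _ _ _ _ (lam R) _ h1).
exact: (@measurable_EX _ _ _ _ _ (lam R) _ h2).
Qed.

Lemma EX_expcl c : 0 < c -> EX (lam R) (fun u => expR (c * cl u)) = (expR c - 1) / c.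
Proof.
move=> c0; rewrite (@EX_lam_cl _ (fun u => expR (c * u))).
- rewrite (@IL_FTC _ _ _ (fun u => c^-1 * expR (c * u))).
  + by rewrite mulr1 mulr0 expR0 mulr1 mulrBl mul1r mulrC.
  + by [].
  + by move=> x _; eapply deq; [dtac|rewrite /=; field; rewrite gt_eqF].
  + by move=> x _; eapply dvb; dtac.
- by apply: (measurableT_comp (@measurable_expR R)); exact: measurable_funM.
- exists (expR c) => x /andP[x0 x1]; rewrite ger0_norm ?expR_ge0// ler_expR.
  by rewrite ler_piMr// ltW.
Qed.

Lemma bmf_expcl c : 0 <= c -> bmf (fun u => expR (c * cl u)).
Proof.
move=> c0; split.
  by apply: (measurableT_comp (@measurable_expR R)); exact: measurable_ycl.
exists (expR c) => u; rewrite ger0_norm ?expR_ge0// ler_expR.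
by rewrite ler_piMr ?cl_le1.
Qed.

Lemma bmf_exp1cl c : 0 <= c -> bmf (fun u => expR (c * (1 - cl u))).
Proof.
move=> c0; split.
  by apply: (measurableT_comp (@measurable_expR R)); exact: measurable_y1cl.
exists (expR c) => u; rewrite ger0_norm ?expR_ge0// ler_expR.
by have /andP[] := @y1cl_itv c u c0.
Qed.

Lemma EX_exp1cl c : 0 < c ->
  EX (lam R) (fun u => expR (c * (1 - cl u))) = (expR c - 1) / c.
Proof.
move=> c0; rewrite -EX_expcl// (@EX_reflect _ (fun u => expR (c * u)))//.
  by apply: (measurableT_comp (@measurable_expR R)); exact: measurable_funM.
exists (expR c) => x /andP[x0 x1]; rewrite ger0_norm ?expR_ge0// ler_expR.
by rewrite ler_piMr// ltW.
Qed.

(* The weight exp (l * y) makes split_op a contraction once l > 2 * B. *)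
Lemma split_op_diff f g B h l D y : 0 <= h -> 0 < l -> 1 <= y -> 0 <= B -> 0 <= D ->
  cm f -> cm g ->
  (forall w, 0 <= w -> cabs (f w) <= B * expR (h * w)) ->
  (forall w, 0 <= w -> cabs (g w) <= B * expR (h * w)) ->
  (forall w, 0 <= w -> cabs (f w - g w) <= D * expR ((h + l) * w)) ->
  cabs (split_op f y - split_op g y) <= 2 * B * D / l * expR ((h + l) * y).
Proof.
move=> h0 l0 y1 B0 D0 mf mg fB gB fgD.
have y0 : 0 <= y by lra.
have BB w : 0 <= w <= y -> B * expR (h * w) <= B * expR (h * y).
  by move=> /andP[w0 wy]; rewrite ler_wpM2l// ler_expR ler_wpM2l.
have fM w : 0 <= w <= y -> cabs (f w) <= B * expR (h * y).
  by move=> wy; apply: le_trans (BB _ wy); apply: fB; case/andP: wy.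
have gM w : 0 <= w <= y -> cabs (g w) <= B * expR (h * y).
  by move=> wy; apply: le_trans (BB _ wy); apply: gB; case/andP: wy.
have cf1 := cbmf_ycl y0 mf fM. have cf2 := cbmf_y1cl y0 mf fM.
have cg1 := cbmf_ycl y0 mg gM. have cg2 := cbmf_y1cl y0 mg gM.
have ly : 0 < l * y by rewrite mulr_gt0//; lra.
rewrite /split_op -CE_B; [|exact: cbmfM|exact: cbmfM].
(* As the two pieces add up to [y], their factors in [h] recombine into this constant. What remains
   is the weight in [l], whose mean is at most [expR (l * y) / l]. *)
set q := B * D * expR (h * y).
have q0 : 0 <= q by rewrite !mulr_ge0 ?expR_ge0.
have b1 : bmf (fun u => expR (l * y * cl u)) by exact/bmf_expcl/ltW.
have b2 : bmf (fun u => expR (l * y * (1 - cl u))) by exact/bmf_exp1cl/ltW.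
apply: (@le_trans _ _ (EX (lam R)
    (fun u => q * (expR (l * y * cl u) + expR (l * y * (1 - cl u)))))).
  apply: CE_norm_le.
  - by apply: cbmfB; exact: cbmfM.
  - by apply: bmf_itg; apply: bmfM; [exact: bmf_cst|exact: bmfD].
  move=> u; set w := y * cl u; set w' := y * (1 - cl u).
  have /andP[w0 _] : 0 <= w <= y by exact: ycl_itv.
  have /andP[w'0 _] : 0 <= w' <= y by exact: y1cl_itv.
  have ww : w + w' = y by rewrite /w /w'; ring.
  have e1 : expR (h * y) = expR (h * w) * expR (h * w') by rewrite -expRD -mulrDr ww.
  have e2 : l * y * cl u = l * w by rewrite /w mulrA.
  have e3 : l * y * (1 - cl u) = l * w' by rewrite /w' mulrA.
  have -> : f w * f w' - g w * g w' = (f w - g w) * f w' + g w * (f w' - g w').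
    by ring.
  rewrite (le_trans (cabsD _ _))// !cabsM mulrDr; apply: lerD.
    rewrite (le_trans (ler_pM (cabs_ge0 _) (cabs_ge0 _) (fgD w w0) (fB w' w'0)))//.
    by apply: lexx_eq; rewrite mulrDl expRD /q e1 e2; ring.
  rewrite (le_trans (ler_pM (cabs_ge0 _) (cabs_ge0 _) (gB w w0) (fgD w' w'0)))//.
  by apply: lexx_eq; rewrite mulrDl expRD /q e1 e3; ring.
rewrite EX_Z; last by apply: bmf_itg; exact: bmfD.
rewrite EX_D; [|exact: bmf_itg|exact: bmf_itg].
rewrite EX_expcl// EX_exp1cl//.
have hh : (expR (l * y) - 1) / (l * y) <= expR (l * y) / l.
  rewrite invfM mulrA ler_pdivrMr; last by lra.
  rewrite mulrAC ler_pM2r ?invr_gt0//.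
  have := expR_gt0 (l * y) => e0; rewrite (@le_trans _ _ (expR (l * y)))//; first lra.
  by rewrite ler_peMr// ltW.
rewrite (@le_trans _ _ (q * (expR (l * y) / l + expR (l * y) / l)))//.
  by rewrite ler_wpM2l// lerD.
by rewrite /q (mulrDl h l y) expRD; apply: lexx_eq; field; rewrite gt_eqF.
Qed.
End operator.

(** * Picard iterates and their distance to the second-order expansion *)

Section picard_iteration.
Variable R : realType.
Implicit Types (s y w u h l B D M : R) (f g : R -> R[i]).

(* With y = (length) / t, base is the value of rfix on intervals that are never split. *)
Definition base s y : R[i] :=
  Complex (expR (vK R * s ^+ 2 / 2 * y)) 0 * cis (s * (1 - 2 * y)).

Definition rapp s y : R[i] := Complex (1 + s ^+ 2 * be y) (s * al y).

Fixpoint picard s n y : R[i] :=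
  if y <= 1 then base s y else if n is m.+1 then split_op (picard s m) y else rapp s y.

Lemma vK_bounds : -5 <= vK R <= 3.
Proof. by rewrite /vK; have := ln2_bounds R; lra. Qed.

Lemma baseE s y : base s y =
  Complex (expR (vK R * s ^+ 2 / 2 * y) * cos (s * (1 - 2 * y)))
          (expR (vK R * s ^+ 2 / 2 * y) * sin (s * (1 - 2 * y))).
Proof. by apply/eqP; rewrite eq_complex cReM cImM/= !mul0r subr0 addr0 !eqxx. Qed.

Lemma cabs_base s y : cabs (base s y) = expR (vK R * s ^+ 2 / 2 * y).
Proof. by rewrite cabsM cabs_cis mulr1 cabs_real ger0_norm ?expR_ge0. Qed.

Lemma cm_base s : cm (base s).
Proof.
have m1 : measurable_fun setT (fun y : R => expR (vK R * s ^+ 2 / 2 * y)).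
  by apply: (measurableT_comp (@measurable_expR R)); exact: measurable_funM.
have m2 : measurable_fun setT (fun y : R => s * (1 - 2 * y)).
  by apply: measurable_funM => //; apply: measurable_funB => //; exact: measurable_funM.
have mc : measurable_fun setT (@cos R).
  by apply: continuous_measurable_fun; exact: continuous_cos.
have ms : measurable_fun setT (@sin R).
  by apply: continuous_measurable_fun; exact: continuous_sin.
split; under eq_fun do rewrite baseE /=; apply: measurable_funM => //.
  exact: (measurableT_comp mc m2).
exact: (measurableT_comp ms m2).
Qed.

Lemma cm_rapp s : cm (rapp s).
Proof.
split => /=.
  by apply: measurable_funD => //; apply: measurable_funM => //; exact: measurable_be.
by apply: measurable_funM => //; exact: measurable_al.
Qed.

Lemma cm_picard s n : cm (picard s n).
Proof.
have mb : measurable_fun setT (fun y : R => y <= 1) by exact: measurable_fun_ler.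
elim: n => [|n IH] /=.
  by apply: cm_if => //; [exact: cm_base|exact: cm_rapp].
by apply: cm_if => //; [exact: cm_base|exact: cm_split_op].
Qed.

(** On [0, 1] the coefficients [al] and [be] are those of the Taylor expansion of [base] in [s]. The
    constant adds [9 * expR 3 + 3 + 1] for the real part and [3 * expR 3 + 1] for the imaginary
    part, where 3 bounds [vK]. *)
Lemma base_rapp s y : `|s| <= 1 -> 0 <= y <= 1 ->
  cabs (base s y - rapp s y) <= (12 * expR 3 + 5) * `|s| ^+ 3.
Proof.
move=> s1 /andP[y0 y1]; have vb := vK_bounds.
set x := vK R * s ^+ 2 / 2 * y; set t := s * (1 - 2 * y).
have a0 : 0 <= `|s| by [].
have s2 : s ^+ 2 = `|s| ^+ 2 by rewrite real_normK ?num_real.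
have xb : `|x| <= 3 * `|s| ^+ 2.
  have -> : x = vK R * y / 2 * `|s| ^+ 2 by rewrite /x s2; field.
  rewrite normrM normrX normr_id ler_wpM2r ?sqr_ge0// ler_norml; nra.
have x3 : `|x| <= 3 by apply: (le_trans xb); have := exprn_ile1 2 a0 s1; lra.
have tb : `|t| <= `|s|.
  by rewrite /t normrM ler_piMr// ler_norml; lra.
have e1 : `|expR x - 1 - x| <= 9 * expR 3 * `|s| ^+ 3.
  apply: (le_trans (expR_taylor_le x3)).
  have : x ^+ 2 <= 9 * `|s| ^+ 3.
    rewrite -(real_normK (num_real x)).
    apply: (@le_trans _ _ ((3 * `|s| ^+ 2) ^+ 2)); first by rewrite lerXn2r ?nnegrE ?mulr_ge0.
    have -> : (3 * `|s| ^+ 2) ^+ 2 = 9 * `|s| ^+ 3 * `|s| by ring.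
    by rewrite ler_piMr// mulr_ge0// exprn_ge0.
  have := expR_gt0 (3 : R); nra.
have e2 : `|cos t - 1 + t ^+ 2 / 2| <= `|s| ^+ 3.
  apply: (le_trans (cos_taylor_le t)).
  apply: (@le_trans _ _ (`|s| ^+ 4)); first by rewrite lerXn2r ?nnegrE.
  by rewrite exprS ler_piMl// exprn_ge0.
have e3 : `|x * (cos t - 1)| <= 3 * `|s| ^+ 3.
  rewrite normrM; apply: (@le_trans _ _ (3 * `|s| ^+ 2 * `|s| ^+ 2)).
    apply: ler_pM => //; apply: (le_trans (cos_sub1_le t)).
    by rewrite -(real_normK (num_real t)) lerXn2r ?nnegrE.
  have -> : 3 * `|s| ^+ 2 * `|s| ^+ 2 = 3 * `|s| ^+ 3 * `|s| by ring.
  by rewrite ler_piMr// mulr_ge0// exprn_ge0.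
have e4 : `|sin t - t| <= `|s| ^+ 3.
  by apply: (le_trans (sin_sub_le t)); rewrite lerXn2r ?nnegrE.
have e5 : `|(expR x - 1) * sin t| <= 3 * expR 3 * `|s| ^+ 3.
  rewrite normrM; apply: (@le_trans _ _ (expR 3 * (3 * `|s| ^+ 2) * `|s|)).
    apply: ler_pM => //; last exact: (le_trans (norm_sin_le t)).
    apply: (le_trans (expR_sub1_le x3)).
    by rewrite ler_wpM2l ?expR_ge0.
  by apply: lexx_eq; ring.
apply: (le_trans (cabs_le_ReIm _)).
rewrite baseE /rapp !(cReD, cImD, cReN, cImN)/= -/x -/t /be /al y1.
have -> : expR x * cos t - (1 + s ^+ 2 * (vK R * y / 2 - (1 - 2 * y) ^+ 2 / 2)) =
    (expR x - 1 - x) * cos t + x * (cos t - 1) + (cos t - 1 + t ^+ 2 / 2).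
  by rewrite /t /x; field.
have -> : expR x * sin t - t = (expR x - 1) * sin t + (sin t - t) by ring.
have e1' : `|(expR x - 1 - x) * cos t| <= 9 * expR 3 * `|s| ^+ 3.
  by rewrite normrM; apply: le_trans e1; rewrite ler_piMr// cos_max.
have := ler_normD ((expR x - 1 - x) * cos t + x * (cos t - 1)) (cos t - 1 + t ^+ 2 / 2).
have := ler_normD ((expR x - 1 - x) * cos t) (x * (cos t - 1)).
have := ler_normD ((expR x - 1) * sin t) (sin t - t).
lra.
Qed.

Lemma bmf_al y : 0 <= y -> bmf (fun u => al (y * cl u)) /\ bmf (fun u => al (y * (1 - cl u))).
Proof.
move=> y0; split; split.
- exact: (measurableT_comp (@measurable_al R) (measurable_ycl y)).
- by exists 1 => u; apply: al_bound; have /andP[] := @ycl_itv _ y u y0.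
- exact: (measurableT_comp (@measurable_al R) (measurable_y1cl y)).
- by exists 1 => u; apply: al_bound; have /andP[] := @y1cl_itv _ y u y0.
Qed.

Lemma bmf_be y : 0 <= y -> bmf (fun u => be (y * cl u)) /\ bmf (fun u => be (y * (1 - cl u))).
Proof.
move=> y0; split; split.
- exact: (measurableT_comp (@measurable_be R) (measurable_ycl y)).
- by exists 24 => u; apply: be_bound; have /andP[] := @ycl_itv _ y u y0.
- exact: (measurableT_comp (@measurable_be R) (measurable_y1cl y)).
- by exists 24 => u; apply: be_bound; have /andP[] := @y1cl_itv _ y u y0.
Qed.

Lemma EX_al1 y : 1 < y -> EX (lam R) (fun u => al (y * (1 - cl u))) = 0.
Proof.
move=> y1; have y0 : 0 <= y by lra.
rewrite (@EX_reflect _ (fun u => al (y * u))) ?EX_al//.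
  exact: (measurableT_comp (@measurable_al R) (@measurable_scale R y)).
by exists 1 => x /andP[x0 _]; apply: al_bound; rewrite mulr_ge0.
Qed.

Lemma EX_be1 y : 0 <= y -> EX (lam R) (fun u => be (y * (1 - cl u))) =
  EX (lam R) (fun u => be (y * cl u)).
Proof.
move=> y0; rewrite (@EX_reflect _ (fun u => be (y * u)))//.
  exact: (measurableT_comp (@measurable_be R) (@measurable_scale R y)).
by exists 24 => x /andP[x0 _]; apply: be_bound; rewrite mulr_ge0.
Qed.

(** The terms of order [s] cancel by [EX_al], those of order [s ^+ 2] by [key_identity]. The
    remainder consists of the products [be * be] and [al * be], whence [624 = 24 * 24 + 2 * 24]. *)
Lemma split_op_rapp s y : `|s| <= 1 -> 1 < y -> cabs (split_op (rapp s) y - rapp s y) <= 624 * `|s| ^+ 3.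
Proof.
move=> s1 y1; have y0 : 0 <= y by lra.
have [a1 a2] := bmf_al y0; have [b1 b2] := bmf_be y0.
have aa := bmfM a1 a2; have bbM := bmfM b1 b2.
have ab := bmfM a1 b2; have ba := bmfM b1 a2.
set E1 := EX (lam R) (fun u => be (y * cl u) * be (y * (1 - cl u))).
set E2 := EX (lam R) (fun u => be (y * cl u) * al (y * (1 - cl u)) +
                               al (y * cl u) * be (y * (1 - cl u))).
have -> : split_op (rapp s) y - rapp s y = Complex (s ^+ 4 * E1) (s ^+ 3 * E2).
  apply/eqP; rewrite eq_complex cReD cImD cReN cImN/=; apply/andP; split; apply/eqP.
    rewrite (_ : (fun u => _) = (fun u => 1 + (s ^+ 2 * (be (y * cl u) + be (y * (1 - cl u)) -
        al (y * cl u) * al (y * (1 - cl u))) + s ^+ 4 * (be (y * cl u) * be (y * (1 - cl u)))))); last first.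
      by apply/funext => u; ring.
    rewrite EX_D; last 2 first.
    - by apply: bmf_itg; exact: bmf_cst.
    - apply: bmf_itg; apply: bmfD; last by apply: bmfM; [exact: bmf_cst|].
      by apply: bmfM; [exact: bmf_cst|apply: bmfB => //; exact: bmfD].
    rewrite EX_cst EX_D; last 2 first.
    - by apply: bmf_itg; apply: bmfM; [exact: bmf_cst|apply: bmfB => //; exact: bmfD].
    - by apply: bmf_itg; apply: bmfM; [exact: bmf_cst|].
    rewrite EX_Z; last by apply: bmf_itg; apply: bmfB => //; exact: bmfD.
    rewrite EX_Z; last exact: bmf_itg.
    rewrite EX_B; last 2 first.
    - by apply: bmf_itg; exact: bmfD.
    - exact: bmf_itg.
    rewrite EX_D; [|exact: bmf_itg|exact: bmf_itg].
    by rewrite EX_be1// -(key_identity y1) -/E1; ring.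
  rewrite (_ : (fun u => _) = (fun u => s * (al (y * cl u) + al (y * (1 - cl u))) +
     s ^+ 3 * (be (y * cl u) * al (y * (1 - cl u)) + al (y * cl u) * be (y * (1 - cl u))))); last first.
    by apply/funext => u; ring.
  rewrite EX_D; last 2 first.
  - by apply: bmf_itg; apply: bmfM; [exact: bmf_cst|exact: bmfD].
  - by apply: bmf_itg; apply: bmfM; [exact: bmf_cst|exact: bmfD].
  rewrite EX_Z; last by apply: bmf_itg; exact: bmfD.
  rewrite EX_Z; last by apply: bmf_itg; exact: bmfD.
  rewrite EX_D; [|exact: bmf_itg|exact: bmf_itg].
  by rewrite EX_al// EX_al1// /al leNgt y1/= -/E2; ring.
apply: (le_trans (cabs_le_ReIm _)) => /=.
have h1 : `|E1| <= 576.
  apply: EX_norm_le => // u; rewrite normrM (_ : 576 = 24 * 24); last by ring.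
  apply: ler_pM => //; apply: be_bound.
    by have /andP[] := @ycl_itv _ y u y0.
  by have /andP[] := @y1cl_itv _ y u y0.
have h2 : `|E2| <= 48.
  apply: EX_norm_le; first exact: bmfD.
  move=> u; have /andP[w0 _] := @ycl_itv _ y u y0; have /andP[w'0 _] := @y1cl_itv _ y u y0.
  rewrite (le_trans (ler_normD _ _))// !normrM.
  have := be_bound w0; have := be_bound w'0; have := al_bound w0; have := al_bound w'0.
  have := normr_ge0 (al (y * cl u)); have := normr_ge0 (al (y * (1 - cl u))).
  have := normr_ge0 (be (y * cl u)); have := normr_ge0 (be (y * (1 - cl u))).
  nra.
rewrite normrM [X in _ + X]normrM !normrX.
have s3 : 0 <= `|s| ^+ 3 by rewrite exprn_ge0.
have s4 : `|s| ^+ 4 <= `|s| ^+ 3 by rewrite exprS ler_piMl.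
have s40 : 0 <= `|s| ^+ 4 by rewrite exprn_ge0.
have := normr_ge0 E1; have := normr_ge0 E2.
nra.
Qed.

Lemma rapp_bound s y : `|s| <= 1 -> 0 <= y -> cabs (rapp s y) <= 26.
Proof.
move=> s1 y0; apply: (le_trans (cabs_le_ReIm _)) => /=.
have := al_bound y0; have := be_bound y0; have := normr_ge0 (al y); have := normr_ge0 (be y).
have s2 : 0 <= s ^+ 2 <= 1.
  by rewrite sqr_ge0/= -(real_normK (num_real s)) exprn_ile1.
move=> p1 p2 p3 p4.
have h1 : `|1 + s ^+ 2 * be y| <= 25.
  rewrite (le_trans (ler_normD _ _))// normr1 normrM (ger0_norm (sqr_ge0 s)); nra.
have h2 : `|s * al y| <= 1 by rewrite normrM; have := normr_ge0 s; nra.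
lra.
Qed.

(** The bound is multiplicative over two pieces of total length [y], so [split_op] preserves it. At
    the start, [rapp] is real beyond 1 and [1 + x <= expR x] applies, with 24 the bound on [be]. *)
Lemma picard_bound s n y : 0 <= y -> cabs (picard s n y) <= expR (24 * s ^+ 2 * y).
Proof.
have s2 := sqr_ge0 s; have vb := vK_bounds.
have bb' z : 0 <= z -> cabs (base s z) <= expR (24 * s ^+ 2 * z).
  move=> z0; rewrite cabs_base ler_expR ler_wpM2r//; nra.
elim: n y => [|n IH] y y0 /=; case: ifPn => [_|]; try exact: bb';
    rewrite -ltNge => y1.
  have -> : rapp s y = Complex (1 + s ^+ 2 * be y) 0 by rewrite /rapp /al leNgt y1 /= mulr0.
  rewrite cabs_real (le_trans (ler_normD _ _))// normr1 normrM (ger0_norm s2).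
  apply: (@le_trans _ _ (1 + 24 * s ^+ 2 * y)); last exact: expR_ge1Dx.
  by have := be_bound y0; have := normr_ge0 (be y); nra.
have fM w : 0 <= w <= y -> cabs (picard s n w) <= expR (24 * s ^+ 2 * y).
  move=> /andP[w0 wy]; apply: (le_trans (IH _ w0)); rewrite ler_expR; nra.
rewrite -[leRHS](EX_cst (lam R)); apply: CE_norm_le.
- by apply: cbmfM; [exact: (cbmf_ycl y0 (cm_picard s n) fM)|exact: (cbmf_y1cl y0 (cm_picard s n) fM)].
- by apply: bmf_itg; exact: bmf_cst.
move=> u; have /andP[w0 _] := @ycl_itv _ y u y0; have /andP[w'0 _] := @y1cl_itv _ y u y0.
rewrite cabsM.
apply: (le_trans (ler_pM (cabs_ge0 _) (cabs_ge0 _) (IH _ w0) (IH _ w'0))).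
by rewrite -expRD -mulrDr -mulrDr addrCA subrr addr0 mulr1.
Qed.

(** [split_op_diff] with [B = 1] and [l = 4] contracts by [2 / 4], which yields the geometric
    factor. *)
Lemma picard_cauchy s n y : 0 <= y -> cabs (picard s n.+1 y - picard s n y) <=
  2 / 2 ^+ n * expR ((24 * s ^+ 2 + 4) * y).
Proof.
have s2 := sqr_ge0 s.
elim: n y => [|n IH] y y0.
  apply: (le_trans (cabsB _ _)); have := picard_bound s 1 y0; have := picard_bound s 0 y0.
  rewrite expr0 divr1 => h1 h2.
  have : expR (24 * s ^+ 2 * y) <= expR ((24 * s ^+ 2 + 4) * y) by rewrite ler_expR; nra.
  lra.
have [y1|y1] := leP y 1.
  by rewrite /= y1 subrr cabs0 mulr_ge0 ?expR_ge0// divr_ge0// exprn_ge0.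
have picardS m : picard s m.+1 y = split_op (picard s m) y by rewrite /= leNgt y1.
rewrite (picardS n.+1) (picardS n).
have := @split_op_diff R (picard s n.+1) (picard s n) 1 (24 * s ^+ 2) 4 (2 / 2 ^+ n) y.
move=> /(_ _ _ _ _ _ (cm_picard s n.+1) (cm_picard s n)) H.
apply: le_trans (H _ _ _ _ _ _ _ IH) _ => //.
- by rewrite mulr_ge0.
- exact: ltW.
- by move=> w w0; rewrite mul1r; exact: picard_bound.
- by move=> w w0; rewrite mul1r; exact: picard_bound.
apply: lexx_eq; rewrite (exprS 2 n); field.
by rewrite expf_neq0.
Qed.

(** Twice the sum of the constants of [base_rapp] and [split_op_rapp]. In [picard_rapp] the
    contraction returns one half of the error, and the other half has to cover the defect of [rapp]
    in the equation. *)
Definition rapp_cst : R := 2 * (12 * expR 3 + 5 + 624).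

Lemma rapp_cst_gt0 : 0 < rapp_cst.
Proof. by rewrite /rapp_cst; have := expR_gt0 (3 : R); lra. Qed.

(** Contraction around [rapp]: since 26 bounds it, [l = 104] gives the factor
    [2 * 26 / 104 = 1 / 2]. The rate 104 does not shrink with [s], so the estimate serves on bounded
    ranges of [y]. *)
Lemma picard_rapp s n y : `|s| <= 1 -> 0 <= y -> cabs (picard s n y - rapp s y) <=
  rapp_cst * `|s| ^+ 3 * expR ((24 * s ^+ 2 + 104) * y).
Proof.
move=> s1; have s2 := sqr_ge0 s; have A0 := rapp_cst_gt0.
have s3 : 0 <= `|s| ^+ 3 by rewrite exprn_ge0.
have e3 := expR_gt0 (3 : R).
have E1 z : 0 <= z -> 1 <= expR ((24 * s ^+ 2 + 104) * z).
  by move=> z0; rewrite -[leLHS]expR0 ler_expR; nra.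
have bs z : 0 <= z <= 1 -> cabs (base s z - rapp s z) <=
    rapp_cst * `|s| ^+ 3 * expR ((24 * s ^+ 2 + 104) * z).
  move=> /[dup] zz /andP[z0 _]; apply: (le_trans (base_rapp s1 zz)).
  apply: (@le_trans _ _ (rapp_cst * `|s| ^+ 3)); first by rewrite ler_wpM2r// /rapp_cst; lra.
  by rewrite ler_peMr ?E1// mulr_ge0// ltW.
elim: n y => [|n IH] y y0 /=; have [y1|y1] := leP y 1.
- by apply: bs; rewrite y0 y1.
- rewrite subrr cabs0; apply: mulr_ge0; last exact: expR_ge0.
  by apply: mulr_ge0 => //; exact: ltW.
- by apply: bs; rewrite y0 y1.
have -> : split_op (picard s n) y - rapp s y = (split_op (picard s n) y - split_op (rapp s) y) + (split_op (rapp s) y - rapp s y) by ring.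
apply: (le_trans (cabsD _ _)).
have := @split_op_diff R (picard s n) (rapp s) 26 (24 * s ^+ 2) 104 (rapp_cst * `|s| ^+ 3) y.
move=> /(_ _ _ _ _ _ (cm_picard s n) (cm_rapp s)) H.
have {}H : cabs (split_op (picard s n) y - split_op (rapp s) y) <=
   2 * 26 * (rapp_cst * `|s| ^+ 3) / 104 * expR ((24 * s ^+ 2 + 104) * y).
  apply: H => //.
  - by rewrite mulr_ge0.
  - exact: ltW.
  - by rewrite mulr_ge0// ltW.
  - move=> w w0; apply: (le_trans (picard_bound s n w0)); rewrite ler_peMl ?expR_ge0//.
    by rewrite ler1n.
  - move=> w w0; apply: (le_trans (rapp_bound s1 w0)); rewrite ler_peMr//.
    by rewrite -[leLHS]expR0 ler_expR; nra.
have := split_op_rapp s1 y1; have := E1 y y0.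
set E := expR _ in H *; move=> E1y Tr.
have a624 : 624 * `|s| ^+ 3 <= rapp_cst / 2 * `|s| ^+ 3 * E.
  apply: (@le_trans _ _ (rapp_cst / 2 * `|s| ^+ 3)); first by rewrite ler_wpM2r// /rapp_cst; lra.
  by rewrite ler_peMr// mulr_ge0// divr_ge0// ltW.
lra.
Qed.

Definition lt2 (w : R) : R := if w < 2 then 1 else 0.

Lemma lt2_le1 w : `|lt2 w| <= 1.
Proof. by rewrite /lt2; case: ifP => _; rewrite ?normr1 ?normr0. Qed.

Lemma measurable_lt2 : measurable_fun setT lt2.
Proof. by apply: measurable_fun_ifT => //; exact: measurable_fun_ltr. Qed.

Lemma EX_lt2 y : 8 < y -> EX (lam R) (fun u => lt2 (y * cl u)) = 2 / y
  /\ EX (lam R) (fun u => lt2 (y * (1 - cl u))) = 2 / y.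
Proof.
move=> y8; have y0 : 0 < y by lra.
have yi : 0 < y^-1 by rewrite invr_gt0.
have yy : y * y^-1 = 1 by rewrite mulfV// gt_eqF.
have m : measurable_fun setT (fun u : R => lt2 (y * u)).
  exact: (measurableT_comp measurable_lt2 (@measurable_scale R y)).
have b (x : R) : 0 <= x <= 1 -> `|lt2 (y * x)| <= 1 by move=> _; exact: lt2_le1.
have z a c : a <= c -> IL a c (fun=> 0) = 0 :> R.
  move=> ab; rewrite (@IL_FTC _ _ _ (fun u => 0)) ?subrr// => x _; exact: dC.
have E : EX (lam R) (fun u => lt2 (y * cl u)) = 2 / y.
  rewrite (@EX_lam_cl _ (fun u => lt2 (y * u)))//; last by exists 1.
  rewrite (@IL_cat _ 0 (2 / y))//; last 2 first.
  - by apply/andP; split; nra.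
  - by exists 1 => x xx; apply: b; lra.
  rewrite (@IL_eq _ _ _ _ (fun=> 1)); last by move=> x xx; rewrite /lt2 ifT//; nra.
  rewrite (@IL_eq _ (2 / y) _ _ (fun=> 0)); last first.
    by move=> x xx; rewrite /lt2 ifF//; apply/negbTE; rewrite -leNgt; nra.
  rewrite z; last by nra.
  rewrite (@IL_FTC _ _ _ (fun u => u)) ?subr0 ?addr0//.
  - by nra.
  - by move=> x _; exact: dI.
split => //; rewrite -{}E.
by rewrite (@EX_reflect _ (fun u => lt2 (y * u)))//; exists 1.
Qed.

(** The cancellation behind [theta_step]: both [al] and [be] have mean 0 at scales beyond 2. *)
Lemma CE_theta s y : 8 < y -> CE (lam R) (fun u => rapp s (y * cl u) - 1) = 0 /\
  CE (lam R) (fun u => rapp s (y * (1 - cl u)) - 1) = 0.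
Proof.
move=> y8; have y0 : 0 <= y by lra. have y1 : 1 < y by lra.
have [a1 a2] := bmf_al y0; have [b1 b2] := bmf_be y0.
have y2 : (y <= 2) = false by apply/negbTE; rewrite -ltNge; lra.
rewrite /CE; split.
  rewrite (_ : (fun u => complex.Re _) = (fun u => s ^+ 2 * be (y * cl u))); last first.
    by apply/funext => u; rewrite cReD/=; ring.
  rewrite (_ : (fun u => complex.Im _) = (fun u => s * al (y * cl u))); last first.
    by apply/funext => u; rewrite cImD/=; ring.
  rewrite EX_Z; last exact: bmf_itg.
  by rewrite EX_Z ?EX_be// ?EX_al// ?y2 ?mulr0//; exact: bmf_itg.
rewrite (_ : (fun u => complex.Re _) = (fun u => s ^+ 2 * be (y * (1 - cl u)))); last first.
  by apply/funext => u; rewrite cReD/=; ring.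
rewrite (_ : (fun u => complex.Im _) = (fun u => s * al (y * (1 - cl u)))); last first.
  by apply/funext => u; rewrite cImD/=; ring.
rewrite EX_Z; last exact: bmf_itg.
by rewrite EX_Z ?EX_be1 ?EX_be// ?EX_al1// ?y2 ?mulr0//; exact: bmf_itg.
Qed.

Lemma rapp_ge2 s w : 2 <= w -> rapp s w = 1.
Proof.
move=> w2; rewrite /rapp /al /be.
have -> : (w <= 1) = false by apply/negbTE; rewrite -ltNge; lra.
(* The endpoint 2 still belongs to the branch [bb], which vanishes there. *)
have [w2'|_] := leP w 2; last by rewrite !mulr0 addr0.
have -> : w = 2 by lra.
by rewrite /bb subrr !mulr0; apply/eqP; rewrite eq_complex/= eqxx andbT; apply/eqP; field.
Qed.

(* For y > 8 at most one of the two pieces is shorter than 2, and rapp - 1 vanishes beyond 2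
   and has mean 0, so a short piece costs only O(|s|^3); without this cancellation the rate
   in the exponent would be of order |s|. *)
Lemma theta_step f s y (a b A q : R) M : 8 < y -> 0 <= a -> 0 <= b <= 2^-1 -> 0 <= A -> 0 <= q ->
  `|s| <= 1 -> cm f -> (forall w, 0 <= w <= y -> cabs (f w) <= M) ->
  (forall w, 0 <= w <= 2 -> cabs (f w - rapp s w) <= A) ->
  (forall w, 0 <= w <= 2 -> cabs (f w - 1) <= q) ->
  (forall w, 2 <= w <= y -> cabs (f w - 1) <= (1 - b) * expR (a * w) - 1) ->
  A <= b / 4 -> 16 * q * a <= b / 2 ->
  cabs (split_op f y - 1) <= (1 - b) * expR (a * y) - 1.
Proof.
move=> y8 a0 /andP[b0 b2] A0 q0 s1 mf fM H1 H2 H3 Ab qab.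
have y0 : 0 <= y by lra.
set E := expR (a * y).
have E1 : 1 <= E by rewrite /E -[leLHS]expR0 ler_expR mulr_ge0.
have cf1 := cbmf_ycl y0 mf fM. have cf2 := cbmf_y1cl y0 mf fM.
have rM w : 0 <= w <= y -> cabs (rapp s w) <= 26 by move=> /andP[w0 _]; exact: rapp_bound.
have cr1 := cbmf_ycl y0 (cm_rapp s) rM. have cr2 := cbmf_y1cl y0 (cm_rapp s) rM.
have c1 : cbmf (fun _ : R => 1 : R[i]) by exact: cbmf_cst.
have [T1 T2] := CE_theta s y8.
have -> : split_op f y - 1 = CE (lam R) (fun u => f (y * cl u) * f (y * (1 - cl u)) - 1 -
     (rapp s (y * cl u) - 1) - (rapp s (y * (1 - cl u)) - 1)).
  have k1 := cbmfM cf1 cf2; have k2 := cbmfB k1 c1; have k3 := cbmfB cr1 c1.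
  have k4 := cbmfB cr2 c1; have k5 := cbmfB k2 k3.
  rewrite [RHS](CE_B (lam R) k5 k4) [X in _ = _ - X]T2 subr0.
  rewrite [RHS](CE_B (lam R) k2 k3) [X in _ = _ - X]T1 subr0.
  by rewrite [RHS](CE_B (lam R) k1 c1) CE_cst.
(* [X2] bounds the integrand when both pieces are long: the two bounds multiply and gain a factor
   [1 - b] over the target. [X1] is for one short piece, where this gain is absent. The gain in the
   first case has to pay for the excess in the second. *)
set X2 := (1 - b) ^+ 2 * E - 1.
set X1 := A + (1 + q) * ((1 - b) * E - 1).
have m1 : bmf (fun u => lt2 (y * cl u)).
  split; last by exists 1 => u; exact: lt2_le1.
  exact: (measurableT_comp measurable_lt2 (measurable_ycl y)).
have m2 : bmf (fun u => lt2 (y * (1 - cl u))).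
  split; last by exists 1 => u; exact: lt2_le1.
  exact: (measurableT_comp measurable_lt2 (measurable_y1cl y)).
have side w w' : w + w' = y -> 0 <= w -> w < 2 ->
    cabs (f w * f w' - 1 - (rapp s w - 1) - (rapp s w' - 1)) <= X1.
  move=> ww w0 w2.
  have w'2 : 2 <= w' <= y by lra.
  have /andP[w'2l _] := w'2.
  rewrite (rapp_ge2 s w'2l) subrr subr0.
  have -> : f w * f w' - 1 - (rapp s w - 1) = (f w - rapp s w) + ((f w - 1) + 1) * (f w' - 1).
    by ring.
  rewrite (le_trans (cabsD _ _))// cabsM; apply: lerD; first by apply: H1; rewrite w0 ltW.
  have p1 : cabs (f w - 1 + 1) <= 1 + q.
    by rewrite (le_trans (cabsD _ _))// cabs1 addrC lerD2l H2// w0 ltW.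
  apply: ler_pM; rewrite ?cabs_ge0//; apply: (le_trans (H3 _ w'2)).
  rewrite lerB// ler_wpM2l ?ler_expR//; first by lra.
  by rewrite ler_wpM2l//; lra.
have mid w w' : w + w' = y -> 2 <= w -> 2 <= w' ->
    cabs (f w * f w' - 1 - (rapp s w - 1) - (rapp s w' - 1)) <= X2.
  move=> ww w2 w'2; rewrite !rapp_ge2// subrr !subr0.
  have -> : f w * f w' - 1 = (f w - 1) + (f w' - 1) + (f w - 1) * (f w' - 1) by ring.
  rewrite (le_trans (cabsD _ _))// cabsM.
  have := cabsD (f w - 1) (f w' - 1).
  have h1 := H3 w _; have h2 := H3 w' _.
  have {}h1 : cabs (f w - 1) <= (1 - b) * expR (a * w) - 1 by apply: h1; lra.
  have {}h2 : cabs (f w' - 1) <= (1 - b) * expR (a * w') - 1 by apply: h2; lra.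
  have EE : E = expR (a * w) * expR (a * w') by rewrite /E -ww mulrDr expRD.
  have g1 := cabs_ge0 (f w - 1); have g2 := cabs_ge0 (f w' - 1).
  rewrite /X2 EE; nra.
apply: (@le_trans _ _ (EX (lam R) (fun u => X2 + (X1 - X2) *
   (lt2 (y * cl u) + lt2 (y * (1 - cl u)))))).
  apply: CE_norm_le.
  - by repeat apply: cbmfB => //; exact: cbmfM.
  - apply: bmf_itg; apply: bmfD; first exact: bmf_cst.
    by apply: bmfM; [exact: bmf_cst|exact: bmfD].
  move=> u; set w := y * cl u; set w' := y * (1 - cl u).
  have /andP[w0 _] : 0 <= w <= y by exact: ycl_itv.
  have /andP[w'0 _] : 0 <= w' <= y by exact: y1cl_itv.
  have ww : w + w' = y by rewrite /w /w'; ring.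
  rewrite /lt2; have [h1|h1] := ltP w 2; have [h2|h2] := ltP w' 2.
  - by exfalso; move: ww y8 h1 h2; lra.
  - by rewrite addr0 mulr1 (addrC X2) subrK; exact: side.
  - rewrite add0r mulr1 (addrC X2) subrK.
    have -> : f w * f w' - 1 - (rapp s w - 1) - (rapp s w' - 1) =
      f w' * f w - 1 - (rapp s w' - 1) - (rapp s w - 1) by ring.
    by apply: side => //; rewrite addrC.
  - by rewrite addr0 mulr0 addr0; exact: mid.
have [L1 L2] := EX_lt2 y8.
rewrite EX_D; last 2 first.
- exact/bmf_itg/bmf_cst.
- by apply: bmf_itg; apply: bmfM; [exact: bmf_cst|exact: bmfD].
rewrite EX_cst EX_Z; last by apply: bmf_itg; exact: bmfD.
rewrite EX_D; [|exact: bmf_itg|exact: bmf_itg].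
rewrite L1 L2.
have yy : y * y^-1 = 1 by rewrite mulfV// gt_eqF//; lra.
have yi : 0 < y^-1 by rewrite invr_gt0; lra.
have -> : 2 / y + 2 / y = 4 / y by ring.
(* The probability of a short piece. Its decay in [y] cancels the factor [y] of [Em], so that the
   cost in [g3] is a multiple of [q * a * E] uniformly in [y]. *)
set j := 4 / y.
have jy : j * y = 4 by rewrite /j -mulrA mulVf ?mulr1// gt_eqF//; lra.
have j0 : 0 < j by rewrite /j; lra.
have j2 : j <= 2^-1 by nra.
have Em : E - 1 <= a * y * E.
  have h := expR_ge1Dx (- (a * y)).
  have EN : expR (- (a * y)) * E = 1 by rewrite /E -expRD addNr expR0.
  have := expR_gt0 (a * y); rewrite -/E => Ep; nra.
(* The gain from two long pieces is at least [b * E / 4]; each of the costs [g2] and [g3] takes at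
   most half of that. *)
have g1 : (1 - j) * (b * (1 - b) * E) >= b * E / 4.
  have p : 4^-1 <= (1 - j) * (1 - b) by nra.
  have := mulr_ge0 b0 (le_trans ler01 E1) => bE; nra.
have g2 : j * A <= b * E / 8.
  have : j * A <= 2^-1 * (b / 4) by rewrite ler_pM// ltW.
  have : b <= b * E by rewrite ler_peMr.
  lra.
have g3 : j * (q * ((1 - b) * E - 1)) <= b * E / 8.
  have h1 : (1 - b) * E - 1 <= a * y * E by nra.
  have h2 : j * (q * ((1 - b) * E - 1)) <= j * (q * (a * y * E)).
    by rewrite ler_wpM2l ?(ltW j0)// ler_wpM2l.
  apply: (le_trans h2).
  have -> : j * (q * (a * y * E)) = (j * y) * (q * a) * E by ring.
  rewrite jy.
  have : (4 * (q * a)) <= b / 8 by lra.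
  have E0 : 0 <= E by lra.
  move=> h; have := ler_wpM2r E0 h; lra.
have -> : X2 + (X1 - X2) * j = ((1 - b) * E - 1) - (1 - j) * (b * (1 - b) * E) +
   j * A + j * (q * ((1 - b) * E - 1)) by rewrite /X1 /X2; ring.
lra.
Qed.

(** Up to [y = 8] the distance to [rapp], in units of [|s| ^+ 3], is at most [A8], because
    [24 * s ^+ 2 + 104 <= 128]; beyond 8 the induction goes through [theta_step]. The condition
    [A <= b / 4] there dictates the coefficient 4 of [b]. On [2, 8] one needs
    [2 * a - b - 2 * b * a] to exceed [A8 * |s| ^+ 3], which the coefficient 5 of [a] provides. The
    smallness of [s] gives [b <= 1 / 2] and the condition on [q]. *)
Lemma picard_tail (A8 : R) s n y : rapp_cst * expR (128 * 8) <= A8 -> `|s| <= (640 * (25 + A8))^-1 -> 2 <= y ->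
  cabs (picard s n y - 1) <=
  (1 - 4 * A8 * `|s| ^+ 3) * expR (5 * A8 * `|s| ^+ 3 * y) - 1.
Proof.
move=> hA ss; have A' := rapp_cst_gt0.
have A0 : 0 < A8 by apply: lt_le_trans hA; rewrite mulr_gt0// expR_gt0.
have sC : `|s| * (640 * (25 + A8)) <= 1.
  have C0 : 0 < 640 * (25 + A8) by lra.
  by move: ss; rewrite -[X in _ <= X]div1r ler_pdivlMr.
have s0 := normr_ge0 s.
have sA : `|s| * A8 <= 640^-1 by nra.
have s1 : `|s| <= 1 by nra.
have sg0 : 0 <= `|s| ^+ 3 by rewrite exprn_ge0.
have sg1 : `|s| ^+ 3 <= `|s| by rewrite exprS ler_piMr// exprn_ile1.
set sg := `|s| ^+ 3 in sg0 sg1 *.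
have s2 : 0 <= s ^+ 2 <= 1.
  by rewrite sqr_ge0/= -(real_normK (num_real s)) exprn_ile1.
have A8b z m : 0 <= z <= 8 -> cabs (picard s m z - rapp s z) <= A8 * sg.
  move=> /andP[z0 z8]; apply: (le_trans (picard_rapp m s1 z0)).
  rewrite -/sg mulrAC; apply: ler_wpM2r => //; apply: le_trans hA.
  apply: ler_wpM2l; first exact: ltW.
  by rewrite ler_expR; nra.
set b := 4 * A8 * sg; set a := 5 * A8 * sg.
have b0 : 0 <= b by rewrite /b !mulr_ge0// ltW.
have a0 : 0 <= a by rewrite /a !mulr_ge0// ltW.
have b2 : b <= 2^-1 by rewrite /b; nra.
have low z : 2 <= z -> A8 * sg <= (1 - b) * expR (a * z) - 1.
  move=> z2; have h := expR_ge1Dx (a * z).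
  have : (1 - b) * (1 + 2 * a) - 1 >= A8 * sg.
    have -> : (1 - b) * (1 + 2 * a) - 1 = 2 * a - b - 2 * b * a by ring.
    have : 2 * b * a <= a by rewrite ler_piMl//; lra.
    rewrite /a /b; lra.
  have : (1 - b) * (1 + 2 * a) <= (1 - b) * expR (a * z).
    rewrite ler_wpM2l//; first by lra.
    by apply: le_trans h; rewrite lerD2l mulrC ler_wpM2l.
  lra.
elim: n y => [|n IH] y y2.
  have [y1|y1] := leP y 8.
    by rewrite -(rapp_ge2 s y2); apply: (le_trans _ (low _ y2)); apply: A8b; lra.
  rewrite /= (_ : (y <= 1) = false); last by apply/negbTE; rewrite -ltNge; lra.
  rewrite rapp_ge2// subrr cabs0; apply: (le_trans _ (low _ y2)).
  by rewrite mulr_ge0// ltW.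
have [y1|y1] := leP y 8.
  by rewrite -(rapp_ge2 s y2); apply: (le_trans _ (low _ y2)); apply: A8b; lra.
rewrite [picard s n.+1 y]/= (_ : (y <= 1) = false); last by apply/negbTE; rewrite -ltNge; lra.
have y0 : 0 <= y by lra.
apply: (@theta_step _ s _ _ _ (A8 * sg) ((25 + A8) * `|s|) (expR (24 * s ^+ 2 * y))) => //.
- by rewrite b0.
- by rewrite mulr_ge0// ltW.
- by rewrite mulr_ge0//; lra.
- exact: cm_picard.
- move=> w /andP[w0 wy]; apply: (le_trans (picard_bound s n w0)).
  by rewrite ler_expR ler_wpM2l// mulr_ge0//; lra.
- by move=> w ww; apply: A8b; lra.
- move=> w /andP[w0 w2].
  have -> : picard s n w - 1 = (picard s n w - rapp s w) + (rapp s w - 1) by ring.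
  rewrite (le_trans (cabsD _ _))//.
  have h1 : cabs (picard s n w - rapp s w) <= A8 * `|s|.
    by apply: (@le_trans _ _ (A8 * sg)); [apply: A8b; lra|rewrite ler_wpM2l// ltW].
  have h2 : cabs (rapp s w - 1) <= 25 * `|s|.
    apply: (le_trans (cabs_le_ReIm _)); rewrite /rapp cReD cImD/= subr0.
    have -> : 1 + s ^+ 2 * be w - 1 = s ^+ 2 * be w by ring.
    rewrite normrM [X in _ + X]normrM (ger0_norm (sqr_ge0 s)).
    have := be_bound w0; have := al_bound w0.
    have : s ^+ 2 <= `|s| by rewrite -(real_normK (num_real s)) expr2 ler_piMr.
    have := normr_ge0 (be w); have := normr_ge0 (al w); nra.
  lra.
- by move=> w /andP[w2 _]; exact: IH.
- by rewrite /b; lra.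
rewrite /a /b.
have -> : 16 * ((25 + A8) * `|s|) * (5 * A8 * sg) = (80 * (`|s| * (25 + A8))) * (A8 * sg) by ring.
have : 80 * (`|s| * (25 + A8)) <= 8^-1 by lra.
have : 0 <= A8 * sg by rewrite mulr_ge0// ltW.
nra.
Qed.
End picard_iteration.

(** * The limit of the Picard iterates *)

Section limit.
Variable R : realType.
Implicit Types (s y w u h l B D M : R) (f g : R -> R[i]).

Lemma geo_cvg (a : nat -> R) D : (forall n, `|a n.+1 - a n| <= D / 2 ^+ n) -> cvgn a.
Proof.
move=> aD; pose b := fun n => a n.+1 - a n.
have c1 : cvgn (series b).
  apply: normed_cvg.
  apply: (@series_le_cvg _ _ (geometric D 2^-1)).
  - by move=> n /=.
  - by move=> n; rewrite /geometric/= exprVn; apply: le_trans (aD n).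
  - by move=> n; rewrite /geometric/= exprVn; exact: aD.
  - by apply: is_cvg_geometric_series; rewrite ger0_norm ?invr_ge0// invf_lt1// ltr1n.
have -> : a = (fun n => a 0%N + series b n).
  apply/funext => n; elim: n => [|n IH]; first by rewrite /series/= big_geq// addr0.
  by rewrite seriesSr addrA -IH /b addrC subrK.
by apply: is_cvgD => //; exact: is_cvg_cst.
Qed.

Lemma cabs_lim_le (z : nat -> R[i]) (x y M : R) :
  complex.Re (z n) @[n --> \oo] --> x -> complex.Im (z n) @[n --> \oo] --> y ->
  (forall n, cabs (z n) <= M) -> cabs (Complex x y) <= M.
Proof.
move=> zx zy zM.
have M0 : 0 <= M by apply: le_trans (zM 0%N); exact: cabs_ge0.
rewrite -(@ler_pXn2r _ 2)// ?nnegrE ?cabs_ge0// cabs_sqr/=.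
have c : (complex.Re (z n) ^+ 2 + complex.Im (z n) ^+ 2) @[n --> \oo] --> x ^+ 2 + y ^+ 2.
  by apply: cvgD; rewrite !expr2; under eq_fun do rewrite expr2; exact: cvgM.
apply: (@closed_cvg _ _ \oo _ _ (fun t => t <= M ^+ 2)) c => //.
by apply: nearW => n; rewrite -cabs_sqr lerXn2r ?nnegrE ?cabs_ge0.
Qed.

Definition rfix s y : R[i] :=
  Complex (limn (fun n => complex.Re (picard s n y))) (limn (fun n => complex.Im (picard s n y))).

Lemma picard_le1 s n y : y <= 1 -> picard s n y = base s y.
Proof. by case: n => [|n] /= ->. Qed.

Lemma picard_cvg s y : complex.Re (picard s n y) @[n --> \oo] --> complex.Re (rfix s y) /\
  complex.Im (picard s n y) @[n --> \oo] --> complex.Im (rfix s y).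
Proof.
suff [c1 c2] : cvgn (fun n => complex.Re (picard s n y)) /\ cvgn (fun n => complex.Im (picard s n y)).
  by split; [exact: c1|exact: c2].
have [y1|y1] := leP y 1.
  by split; [under eq_fun do rewrite picard_le1//|under eq_fun do rewrite picard_le1//]; exact: is_cvg_cst.
have y0 : 0 <= y by lra.
pose D := 2 * expR ((24 * s ^+ 2 + 4) * y).
split; apply: (@geo_cvg _ D) => n.
  rewrite -cReN -cReD; apply: (le_trans (cabs_Re _)); apply: (le_trans (picard_cauchy s n y0)).
  by apply: lexx_eq; rewrite /D; ring.
rewrite -cImN -cImD; apply: (le_trans (cabs_Im _)); apply: (le_trans (picard_cauchy s n y0)).
by apply: lexx_eq; rewrite /D; ring.
Qed.

Lemma cm_rfix s : cm (rfix s).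
Proof.
split.
  apply: (measurable_fun_cvg (h := fun n y => complex.Re (picard s n y))).
  - by move=> n; have [] := cm_picard s n.
  - by move=> x _; have [] := picard_cvg s x.
apply: (measurable_fun_cvg (h := fun n y => complex.Im (picard s n y))).
- by move=> n; have [] := cm_picard s n.
- by move=> x _; have [] := picard_cvg s x.
Qed.

Lemma rfix_bound s y : 0 <= y -> cabs (rfix s y) <= expR (24 * s ^+ 2 * y).
Proof.
move=> y0; have [c1 c2] := picard_cvg s y.
apply: (cabs_lim_le c1 c2) => n; exact: picard_bound.
Qed.

Lemma rfix_le1 s y : y <= 1 -> rfix s y = base s y.
Proof.
move=> y1; rewrite /rfix; under eq_fun do rewrite picard_le1//.
under [X in Complex _ (limn X)]eq_fun do rewrite picard_le1//.
by rewrite !lim_cst; case: (base s y).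
Qed.

(** Bounded convergence in the recursion for [picard]; the majorant [ybnd] is constant in [u]
    because [picard_bound] is multiplicative over the two pieces. *)
Lemma rfix_fix s y : 1 < y -> rfix s y = split_op (rfix s) y.
Proof.
move=> y1; have y0 : 0 <= y by lra.
have ybnd n u : cabs (picard s n (y * cl u) * picard s n (y * (1 - cl u))) <= expR (24 * s ^+ 2 * y).
  have /andP[w0 _] := @ycl_itv _ y u y0; have /andP[w'0 _] := @y1cl_itv _ y u y0.
  rewrite cabsM.
  apply: (le_trans (ler_pM (cabs_ge0 _) (cabs_ge0 _) (picard_bound s n w0) (picard_bound s n w'0))).
  by rewrite -expRD -mulrDr -mulrDr addrCA subrr addr0 mulr1.
have mm n := cmM (cm_comp (cm_picard s n) (measurable_ycl y)) (cm_comp (cm_picard s n) (measurable_y1cl y)).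
have [c1 c2] := picard_cvg s y.
have E1 : complex.Re (split_op (picard s n) y) @[n --> \oo] --> complex.Re (split_op (rfix s) y).
  apply: (@EX_cvg _ _ _ (lam R) (fun n u => complex.Re (picard s n (y * cl u) * picard s n (y * (1 - cl u)))) _
    (expR (24 * s ^+ 2 * y))).
  - by move=> n; have [] := mm n.
  - by move=> n u; apply: (le_trans (cabs_Re _)).
  - move=> u; rewrite cReM; under eq_fun do rewrite cReM.
    have [p1 p2] := picard_cvg s (y * cl u); have [q1 q2] := picard_cvg s (y * (1 - cl u)).
    by apply: cvgB; exact: cvgM.
have E2 : complex.Im (split_op (picard s n) y) @[n --> \oo] --> complex.Im (split_op (rfix s) y).
  apply: (@EX_cvg _ _ _ (lam R) (fun n u => complex.Im (picard s n (y * cl u) * picard s n (y * (1 - cl u)))) _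
    (expR (24 * s ^+ 2 * y))).
  - by move=> n; have [] := mm n.
  - by move=> n u; apply: (le_trans (cabs_Im _)).
  - move=> u; rewrite cImM; under eq_fun do rewrite cImM.
    have [p1 p2] := picard_cvg s (y * cl u); have [q1 q2] := picard_cvg s (y * (1 - cl u)).
    by apply: cvgD; exact: cvgM.
have rS n : split_op (picard s n) y = picard s n.+1 y by rewrite /= leNgt y1.
apply/eqP; rewrite eq_complex; apply/andP; split; apply/eqP.
  have h : complex.Re (picard s n y) @[n --> \oo] --> complex.Re (split_op (rfix s) y).
    by rewrite -cvg_shiftS; move: E1; under eq_fun do rewrite rS.
  exact: (cvg_unique _ c1 h).
have h : complex.Im (picard s n y) @[n --> \oo] --> complex.Im (split_op (rfix s) y).
  by rewrite -cvg_shiftS; move: E2; under eq_fun do rewrite rS.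
exact: (cvg_unique _ c2 h).
Qed.

(** The factor [1 - 4 * A * |s| ^+ 3] of [picard_tail] served the induction and is dropped in the
    limit. *)
Lemma fixpoint_solution : exists s0 K : R, [/\ 0 < s0, 0 < K & forall s, `|s| <= s0 ->
  forall y, 2 <= y -> cabs (rfix s y - 1) <= expR (K * `|s| ^+ 3 * y) - 1].
Proof.
have [A hA] : exists A, rapp_cst R * expR (128 * 8) <= A by exists (rapp_cst R * expR (128 * 8)).
have A0 : 0 < A by apply: lt_le_trans hA; rewrite mulr_gt0 ?expR_gt0 ?rapp_cst_gt0.
exists (640 * (25 + A))^-1, (5 * A); split.
- by rewrite invr_gt0; lra.
- by lra.
move=> s ss y y2; have [c1 c2] := picard_cvg s y.
have -> : rfix s y - 1 = Complex (complex.Re (rfix s y) - 1) (complex.Im (rfix s y)).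
  by apply/eqP; rewrite eq_complex cReD cImD/= subr0 !eqxx.
apply: (@cabs_lim_le (fun n => picard s n y - 1)).
- by under eq_fun do rewrite cReD /=; apply: cvgB => //; exact: cvg_cst.
- by under eq_fun do rewrite cImD /= oppr0 addr0.
move=> n; apply: (le_trans (picard_tail n hA ss y2)).
rewrite lerB// ler_piMl ?expR_ge0// lerBlDr lerDl mulr_ge0 ?exprn_ge0//.
by rewrite mulr_ge0// ltW.
Qed.
End limit.

(** * Interval lengths and the law of the splitting variables *)

Section lengths.
Variable R : realType.
Implicit Types (l : seq R) (v : R) (u : nat -> R).

Definition lmax l : R := foldr Num.max 0 l.

(** Lengths evolve autonomously, so the endpoints of the intervals can be forgotten; [map_kakutani]
    makes the link. *)
Definition lsplit v l : seq R :=
  let i := find (fun x => x == lmax l) l in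
  take i l ++ [:: v * nth 0 l i; (1 - v) * nth 0 l i] ++ drop i.+1 l.

Fixpoint lens u n : seq R :=
  if n is m.+1 then lsplit (u m) (lens u m) else [:: 1].

Lemma map_ksplit v (s : seq (R * R)) :
  map (@ilen R) (ksplit v s) = lsplit v (map (@ilen R) s).
Proof.
rewrite /ksplit /lsplit.
have E : find (fun p => ilen p == maxlen s) s =
         find (fun x => x == lmax (map (@ilen R) s)) (map (@ilen R) s).
  by rewrite find_map.
rewrite -{}E; set i := find _ s.
(* The default interval [(0, 0)] has the default length 0, so the identity persists when no entry
   attains the maximum. *)
have Ep : ilen (nth (0, 0) s i) = nth 0 (map (@ilen R) s) i.
  have [h|h] := ltnP i (size s); first by rewrite (nth_map (0, 0)).
  by rewrite !nth_default ?size_map// /ilen/= subrr.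
rewrite !map_cat map_take map_drop -Ep/= /ilen/=.
by congr (_ ++ [:: _, _ & _]); ring.
Qed.

Lemma map_kakutani u n : map (@ilen R) (kakutani u n) = lens u n.
Proof.
elim: n => [|n IH] /=; first by rewrite /ilen/= subr0.
by rewrite map_ksplit IH.
Qed.

Lemma MnE u n : Mn u n = lmax (lens u n).
Proof. by rewrite /Mn /maxlen map_kakutani. Qed.

Lemma lmax_ge0 l : 0 <= lmax l.
Proof. by elim: l => [|x l IH] //=; rewrite le_max IH orbT. Qed.

Lemma lmax_mem l : (forall x, x \in l -> 0 <= x) -> l != [::] -> lmax l \in l.
Proof.
elim: l => // x [|y l] IH l0 _.
  by rewrite /= max_l ?mem_head// l0// mem_head.
have {}IH : lmax (y :: l) \in y :: l by apply: IH => // z zl; apply: l0; rewrite in_cons zl orbT.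
rewrite -[lmax (x :: y :: l)]/(Num.max x (lmax (y :: l))) in_cons.
by case: leP => _; rewrite ?IH ?eqxx ?orbT.
Qed.

Lemma lmax_ub l x : x \in l -> x <= lmax l.
Proof.
elim: l => // y l IH; rewrite in_cons => /predU1P[->|/IH h] /=; rewrite le_max ?lexx//.
by rewrite h orbT.
Qed.

Lemma lmax_le l (M : R) : 0 <= M -> (forall x, x \in l -> x <= M) -> lmax l <= M.
Proof.
move=> M0; elim: l => //= x l IH h; rewrite ge_max h ?mem_head//= IH// => y yl.
by apply: h; rewrite in_cons yl orbT.
Qed.

(** All functionals used later (sum, product, maximum, size) are symmetric, so this description up
    to permutation replaces the positional one. *)
Lemma lsplit_perm v l : lmax l \in l ->
  perm_eq (lsplit v l) (v * lmax l :: (1 - v) * lmax l :: rem (lmax l) l).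
Proof.
move=> ml; rewrite /lsplit.
have hs : has (fun x => x == lmax l) l by apply/hasP; exists (lmax l).
have sz : (find (fun x => x == lmax l) l < size l)%N by rewrite -has_find.
have nE : nth 0 l (find (fun x => x == lmax l) l) = lmax l by apply/eqP; exact: (nth_find 0 hs).
rewrite nE; set i := find _ l.
have pl : perm_eq l (lmax l :: (take i l ++ drop i.+1 l)).
  rewrite -[X in perm_eq X _](cat_take_drop i l) (drop_nth 0)// nE.
  by rewrite -cat1s perm_catCA.
have pr : perm_eq (rem (lmax l) l) (take i l ++ drop i.+1 l).
  by rewrite -(perm_cons (lmax l)) -(permPl (perm_to_rem ml)).
rewrite -[X in perm_eq _ X]/([:: v * lmax l; (1 - v) * lmax l] ++ rem (lmax l) l).
by rewrite perm_catCA perm_cat2l perm_sym.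
Qed.

Definition okl l := (forall x, x \in l -> 0 <= x) /\ lmax l \in l.

Lemma lsplit_ok v l : 0 <= v <= 1 -> okl l -> okl (lsplit v l).
Proof.
move=> /andP[v0 v1] [l0 ml].
have h x : x \in lsplit v l -> 0 <= x.
  rewrite (perm_mem (lsplit_perm v ml)) !in_cons => /or3P[/eqP->|/eqP->|/mem_rem/l0//].
    by rewrite mulr_ge0// l0.
  by rewrite mulr_ge0 ?subr_ge0// l0.
split => //; apply: lmax_mem => //.
by rewrite -size_eq0 (perm_size (lsplit_perm v ml)).
Qed.

Lemma lsplit_lmax v l : 0 <= v <= 1 -> okl l -> lmax (lsplit v l) <= lmax l.
Proof.
move=> /andP[v0 v1] [l0 ml]; apply: lmax_le; first exact: lmax_ge0.
move=> x; rewrite (perm_mem (lsplit_perm v ml)) !in_cons.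
have m0 := lmax_ge0 l.
move=> /or3P[/eqP->|/eqP->|/mem_rem/lmax_ub//].
  by rewrite ler_piMl.
by rewrite ler_piMl// lerBlDr lerDl.
Qed.

Lemma size_lsplit v l : lmax l \in l -> size (lsplit v l) = (size l).+1.
Proof.
move=> ml; rewrite (perm_size (lsplit_perm v ml))/= size_rem//.
by case: l ml.
Qed.

Section admissible.
Variable u : nat -> R.
Hypothesis u01 : forall k, 0 <= u k <= 1.

Lemma lens_ok n : okl (lens u n).
Proof.
elim: n => [|n IH]; last exact: lsplit_ok.
split; first by move=> x; rewrite inE => /eqP ->.
by rewrite /= max_l// mem_head.
Qed.

Lemma size_lens n : size (lens u n) = n.+1.
Proof. by elim: n => //= n IH; rewrite size_lsplit ?IH//; case: (lens_ok n). Qed.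

Lemma lmax_lens_S n : lmax (lens u n.+1) <= lmax (lens u n).
Proof. by apply: lsplit_lmax => //; exact: lens_ok. Qed.

Lemma lmax_lens_le m n : (m <= n)%N -> lmax (lens u n) <= lmax (lens u m).
Proof.
elim: n => [|n IH]; first by rewrite leqn0 => /eqP ->.
rewrite leq_eqVlt => /predU1P[->//|]; rewrite ltnS => /IH.
exact: le_trans (lmax_lens_S n).
Qed.

Lemma sum_lens n : \sum_(x <- lens u n) x = 1.
Proof.
elim: n => [|n IH]; first by rewrite /= big_seq1.
have [_ ml] := lens_ok n.
rewrite /= (perm_big _ (lsplit_perm (u n) ml))/= !big_cons.
have e := IH; rewrite (perm_big _ (perm_to_rem ml))/= big_cons in e.
by rewrite -[RHS]e; ring.
Qed.
End admissible.

Lemma lens_ext u u' n : (forall k, (k < n)%N -> u k = u' k) -> lens u n = lens u' n.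
Proof.
elim: n => //= n IH h; rewrite IH ?h// => k kn; apply: h.
by rewrite ltnS ltnW.
Qed.

Lemma nth_lsplit v l j : let i := find (fun x => x == lmax l) l in
  nth 0 (lsplit v l) j = if (j < i)%N then nth 0 l j
    else if (j < i.+1)%N then v * nth 0 l i
    else if (j < i.+2)%N then (1 - v) * nth 0 l i else nth 0 l j.-1.
Proof.
move=> i; rewrite /lsplit -/i nth_cat size_take_min.
have il : (i <= size l)%N by exact: find_size.
rewrite (minn_idPl il).
case: ltnP => [ji|ij]; first by rewrite nth_take.
have [k ->] : exists k, j = (i + k)%N by exists (j - i)%N; rewrite subnKC.
rewrite addKn; case: k => [|[|k]] /=.
- by rewrite addn0 ltnSn.
- by rewrite addn1 ltnNge leqnn/= ltnSn.
- rewrite nth_drop !addnS !ltnS !ltnNge -addSn !leq_addr/=.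
  by rewrite (leq_trans (leqnSn i) (leq_addr _ _)).
Qed.

End lengths.

(** * Measurability of the interval lengths *)

Section measurable_lengths.
Context d (E : measurableType d) (R : realType).
Variable U : nat -> E -> R.
Hypothesis mU : forall k, measurable_fun setT (U k).

Lemma measurable_foldmax (s : seq nat) (G : nat -> E -> R) :
  (forall i, measurable_fun setT (G i)) ->
  measurable_fun setT (fun w => lmax [seq G i w | i <- s]).
Proof.
move=> mG; elim: s => [|a s IH] /=; first exact: measurable_cst.
exact: measurable_maxr.
Qed.

Lemma measurable_has (s : seq nat) (G : nat -> E -> bool) :
  (forall i, measurable_fun setT (G i)) ->
  measurable_fun setT (fun w => has (fun i => G i w) s).
Proof.
move=> mG; elim: s => [|a s IH] /=; first exact: measurable_cst.
exact: measurable_or.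
Qed.

Lemma mxE_nth (l : seq R) N : (size l <= N)%N -> lmax l = lmax [seq nth 0 l i | i <- iota 0 N].
Proof.
move=> lN; apply/eqP; rewrite eq_le; apply/andP; split; apply: lmax_le; try exact: lmax_ge0.
  move=> x /(nthP 0)[i il <-]; apply: lmax_ub; apply/mapP; exists i => //.
  by rewrite mem_iota add0n (leq_trans il).
move=> x /mapP[i _ ->]; have [il|li] := ltnP i (size l).
  by apply: lmax_ub; exact: mem_nth.
by rewrite nth_default// lmax_ge0.
Qed.

(** The sequence [u] is arbitrary here: if every entry were negative, the value 0 of [lmax] would
    not be attained and [lsplit] would append two entries. Hence a growth of at most 2 per step. *)
Lemma size_lens_le (u : nat -> R) n : (size (lens u n) <= 2 * n + 1)%N.
Proof.
elim: n => //= n IH; rewrite /lsplit !size_cat/= size_take_min size_drop.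
set i := find _ _; have ii : (i <= size (lens u n))%N by exact: find_size.
rewrite (minn_idPl ii); lia.
Qed.

(** The size is treated as random too, since [U] is not yet confined to [0, 1]; sizes and entries
    are therefore handled in one induction, entry by entry through [nth_lsplit]. *)
Lemma measurable_lens n :
  (forall j, measurable_fun setT (fun w => (j < size (lens (U ^~ w) n))%N)) /\
  (forall j, measurable_fun setT (fun w => nth 0 (lens (U ^~ w) n) j)).
Proof.
elim: n => [|n [IHs IHn]] /=; first by split=> j; exact: measurable_cst.
set l := fun w => lens (U ^~ w) n.
have mm : measurable_fun setT (fun w => lmax (l w)).
  rewrite (_ : (fun w => _) = fun w => lmax [seq nth 0 (l w) i | i <- iota 0 (2 * n + 1)]).
    exact: (@measurable_foldmax _ (fun i w => nth 0 (l w) i)).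
  by apply/funext => w; apply: mxE_nth; exact: size_lens_le.
pose p w := fun x => x == lmax (l w).
pose Q k w := (k < size (l w))%N && (nth 0 (l w) k == lmax (l w)).
have mQ k : measurable_fun setT (Q k).
  by apply: measurable_and => //; exact: measurable_fun_eqr.
have hasE w : has (p w) (l w) = has (fun k => Q k w) (iota 0 (2 * n + 1)).
  apply/idP/hasP => [h|[k _ /andP[kl pk]]].
    exists (find (p w) (l w)).
      rewrite mem_iota add0n; apply: leq_trans (size_lens_le (U ^~ w) n).
      by rewrite -has_find.
    by rewrite /Q -has_find h/=; exact: (nth_find 0 h).
  by apply/hasP; exists (nth 0 (l w) k) => //; exact: mem_nth.
have mhas : measurable_fun setT (fun w => has (p w) (l w)).
  by under eq_fun do rewrite hasE; exact: measurable_has.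
(* The split index is random, but comparing it with a fixed [j] involves finitely many of the events
   [Q k], together with the size in case the maximum is not attained. *)
pose B j w := (find (p w) (l w) < j)%N.
have mB j : measurable_fun setT (B j).
  rewrite (_ : B j = fun w => has (fun k => Q k w) (iota 0 j) ||
     (if j is j'.+1 then ~~ (j' < size (l w))%N else false)).
    apply: measurable_or; first exact: measurable_has.
    case: j => [|j]; first exact: measurable_cst.
    by apply: measurable_neg.
  apply/funext => w; apply/idP/orP => [h|].
    have [hp|hp] := boolP (has (p w) (l w)).
      left; apply/hasP; exists (find (p w) (l w)); first by rewrite mem_iota.
      by rewrite /Q -has_find hp/=; exact: (nth_find 0 hp).
    right; move: h; rewrite /B hasNfind//; case: j => // j.
    by rewrite -leqNgt ltnS.
  case.
    move=> /hasP[k]; rewrite mem_iota/= add0n => kj /andP[_ pk].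
    rewrite /B ltnNge; apply/negP => jf.
    by have := before_find 0 (leq_trans kj jf); rewrite /p pk.
  by rewrite /B; case: j => // j; rewrite -leqNgt ltnS; apply: leq_trans; exact: find_size.
(* The value read at the split index: the maximum, or the default 0 of [nth] if the maximum is not
   attained. *)
pose m w := if has (p w) (l w) then lmax (l w) else 0.
have mE w : nth 0 (l w) (find (p w) (l w)) = m w.
  rewrite /m; case: ifPn => h; first by apply/eqP; exact: (nth_find 0 h).
  by rewrite hasNfind// nth_default.
have m_m : measurable_fun setT m by exact: measurable_fun_ifT.
split=> j.
  rewrite (_ : (fun w => _) = fun w => if has (p w) (l w)
     then (if j is j'.+1 then (j' < size (l w))%N else true)
     else (if j is j'.+2 then (j' < size (l w))%N else true)); last first.
    apply/funext => w; rewrite /lsplit !size_cat/= size_take_min size_drop.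
    rewrite -/(l w) -/(p w); have fl : (find (p w) (l w) <= size (l w))%N by exact: find_size.
    rewrite (minn_idPl fl); case: ifPn => h.
      have : (find (p w) (l w) < size (l w))%N by rewrite -has_find.
      by move: (find _ _) (size _) => a b ab; case: j => [|j]; apply/idP/idP; lia.
    by rewrite hasNfind//; move: (size _) => b; case: j => [|[|j]]; apply/idP/idP; lia.
  apply: measurable_fun_ifT => //; first by case: j => [|j]//; exact: measurable_cst.
  by case: j => [|[|j]]//; exact: measurable_cst.
rewrite (_ : (fun w => _) = fun w => if ~~ B j.+1 w then nth 0 (l w) j
   else if ~~ B j w then U n w * m w
   else if ~~ B j.-1 w then (1 - U n w) * m w
   else nth 0 (l w) j.-1); last first.
  apply/funext => w; rewrite nth_lsplit -/(l w) -/(p w) mE /B -!leqNgt !ltnS.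
  case: ifP => // h1; case: ifP => // h2.
  have j0 : (0 < j)%N by rewrite lt0n; apply: contraFneq h2 => ->.
  by rewrite -[X in (X <= _.+1)%N](prednK j0) ltnS.
have mneg b : measurable_fun setT b -> measurable_fun setT (fun w : E => ~~ b w).
  by move=> mb; exact: measurable_neg.
apply: measurable_fun_ifT; [exact: mneg|exact: IHn|].
apply: measurable_fun_ifT; [exact: mneg|exact: measurable_funM|].
apply: measurable_fun_ifT; [exact: mneg| |exact: IHn].
by apply: measurable_funM => //; exact: measurable_funB.
Qed.

Lemma measurable_nth_lens n i : measurable_fun setT (fun w => nth 0 (lens (U ^~ w) n) i).
Proof. by have [_] := measurable_lens n. Qed.

Lemma measurable_lmax_lens n : measurable_fun setT (fun w => lmax (lens (U ^~ w) n)).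
Proof.
rewrite (_ : (fun w => _) = fun w => lmax [seq nth 0 (lens (U ^~ w) n) i | i <- iota 0 (2 * n + 1)]).
  by apply: (@measurable_foldmax _ (fun i w => nth 0 (lens (U ^~ w) n) i)) => i; exact: measurable_nth_lens.
by apply/funext => w; apply: mxE_nth; exact: size_lens_le.
Qed.

Hypothesis U01 : forall k w, 0 <= U k w <= 1.

Lemma cm_prod_nat (s : seq nat) (F : nat -> E -> R[i]) : (forall i, cm (F i)) ->
  cm (fun w => \prod_(i <- s) F i w).
Proof.
move=> cF; elim: s => [|a s IH].
  by under eq_fun do rewrite big_nil; split; exact: measurable_cst.
by under eq_fun do rewrite big_cons; exact: cmM.
Qed.

Lemma cm_prod_lens n (F : R -> R[i]) : cm F -> cm (fun w => \prod_(x <- lens (U ^~ w) n) F x).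
Proof.
move=> cF; rewrite (_ : (fun w => _) =
    fun w => \prod_(i <- iota 0 n.+1) F (nth 0 (lens (U ^~ w) n) i)).
  apply: (@cm_prod_nat _ (fun i w => F (nth 0 (lens (U ^~ w) n) i))) => i.
  exact: (cm_comp cF (measurable_nth_lens n i)).
apply/funext => w; rewrite (big_nth 0) size_lens//.
Qed.

Lemma measurable_sum_lens n (F : R -> R) : measurable_fun setT F ->
  measurable_fun setT (fun w => \sum_(x <- lens (U ^~ w) n) F x).
Proof.
move=> mF; rewrite (_ : (fun w => _) =
    fun w => \sum_(i <- iota 0 n.+1) F (nth 0 (lens (U ^~ w) n) i)).
  by apply: measurable_sum => i; exact: (measurableT_comp mF (measurable_nth_lens n i)).
by apply/funext => w; rewrite (big_nth 0) size_lens.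
Qed.
End measurable_lengths.

(** * Joint law of the splitting variables *)

Section joint_law.
Context d (T : measurableType d) (R : realType) (P : probability T R)
  (U : nat -> {RV P >-> R}).
Hypothesis indU : mutually_independent U.
Hypothesis lawU : forall k (A : set R), measurable A ->
     distribution P (U k) A = uniform_prob (@ltr01 R) A.

Definition Xn n (w : T) : n.-tuple R := [tuple U i w | i < n].
(** The last variable is replaced by a fresh uniform one living on a second factor; under
    [P \x lam R] this tuple has the law of [Xn n.+1]. *)
Definition Yn n (z : T * measurableTypeR R) : n.+1.-tuple R :=
  [tuple if (i < n)%N then U i z.1 else z.2 | i < n.+1].

Lemma measurable_Xn n : measurable_fun setT (Xn n).
Proof.
apply/measurable_fun_tnthP => i.
rewrite (_ : _ \o _ = U i); last by apply/funext => w /=; rewrite tnth_mktuple.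
exact: measurable_funP.
Qed.

Lemma measurable_Yn n : measurable_fun setT (Yn n).
Proof.
apply/measurable_fun_tnthP => i.
rewrite (_ : _ \o _ = fun z : T * measurableTypeR R => if (i < n)%N then U i z.1 else z.2); last first.
  by apply/funext => w /=; rewrite tnth_mktuple.
case: (i < n)%N; last exact: measurable_snd.
apply: (@measurableT_comp _ _ _ _ _ _ (U i)); last exact: measurable_fst.
exact: measurable_funP.
Qed.

(** Boxes are stable under intersection and generate the sigma-algebra of tuples, so two
    probabilities that agree on them coincide. *)
Lemma box_unique n (m1 m2 : probability (n.-tuple R) R) :
  (forall B : nat -> set R, (forall i, measurable (B i)) ->
     m1 [set x | forall i : 'I_n, B i (tnth x i)] = m2 [set x | forall i : 'I_n, B i (tnth x i)]) ->
  forall A, measurable A -> m1 A = m2 A.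
Proof.
move=> h.
pose box (B : nat -> set R) := [set x : n.-tuple R | forall i : 'I_n, B i (tnth x i)].
pose G := [set A | exists2 B : nat -> set R, (forall i, measurable (B i)) & A = box B].
have mbox B : (forall i, measurable (B i)) -> measurable (box B).
  move=> mB; rewrite (_ : box B = \bigcap_(i in [set: 'I_n]) ((fun x : n.-tuple R => tnth x i) @^-1` B i)).
    apply: fin_bigcap_measurable => // i _; rewrite -[X in measurable X]setTI.
    by apply: measurable_tnth.
  by apply/seteqP; split => x /= hx i; [move=> _; exact: hx|exact: hx].
apply: (@measure_unique _ _ _ G (fun=> setT)).
- apply/seteqP; split => [A|].
    move: A; apply: smallest_sub; first exact: smallest_sigma_algebra.
    apply: (big_ind (fun X => X `<=` <<s G >>)) => //.
      by move=> X Y hX hY A [/hX|/hY].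
    move=> i _ A [B mB <-]; apply: sub_sigma_algebra.
    exists (fun k => if k == nat_of_ord i then B : set R else setT) => [k|]; first by case: ifP.
    rewrite setTI; apply/seteqP; split => x /= hx.
      by move=> j; case: ifP => // /eqP/val_inj ->.
    by have := hx i; rewrite eqxx.
  apply: smallest_sub; first exact: sigma_algebra_measurable.
  by move=> A [B mB ->]; exact: mbox.
- move=> A B [A' mA' ->] [B' mB' ->]; exists (fun i => A' i `&` B' i) => [i|].
    exact: measurableI.
  apply/seteqP; split => x /=; first by move=> [h1 h2] i; split.
  by move=> h1; split => i; have [] := h1 i.
- by move=> _; exists (fun=> setT) => //; apply/seteqP; split.
- by rewrite bigcup_const//; exists 0%N.
- by move=> A [B mB ->]; exact: h.
- by move=> _; exact: prob_lty.
Qed.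

HB.instance Definition _ n := isMeasurableFun.Build _ _ _ _ (Xn n) (@measurable_Xn n).
HB.instance Definition _ n := isMeasurableFun.Build _ _ _ _ (Yn n) (@measurable_Yn n).

Lemma law_box n (B : nat -> set R) : (forall i, measurable (B i)) ->
  P (\bigcap_(i in [set` iota 0 n]) (U i @^-1` B i)) =
  (\prod_(i <- iota 0 n) lam R (B i))%E.
Proof.
move=> mB; rewrite indU ?iota_uniq//; apply: eq_bigr => i _.
by rewrite -[RHS](lawU i (mB i)).
Qed.

Lemma mem_iota0 m i : [set` iota 0 m] i <-> (i < m)%N.
Proof. by rewrite /mkset/= mem_iota add0n. Qed.

(* Independence enters only through this equality of laws. *)
Lemma law_XY n A : measurable A ->
  distribution P (Xn n.+1) A = distribution (P \x lam R)%E (Yn n) A.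
Proof.
apply: box_unique => B mB.
have E1 : Xn n.+1 @^-1` [set x | forall i : 'I_n.+1, B i (tnth x i)] =
    \bigcap_(i in [set` iota 0 n.+1]) (U i @^-1` B i).
  apply/seteqP; split => w h i.
    by move=> /mem_iota0 ni; have := h (Ordinal ni); rewrite tnth_mktuple.
  by rewrite tnth_mktuple; apply: h; apply/mem_iota0.
have E2 : Yn n @^-1` [set x | forall i : 'I_n.+1, B i (tnth x i)] =
    (\bigcap_(i in [set` iota 0 n]) (U i @^-1` B i)) `*` B n.
  apply/seteqP; split => [[w v] h|[w v] [h1 h2] i].
    split.
      move=> i /mem_iota0 ni.
      by have := h (Ordinal (ltnW ni : (i < n.+1)%N)); rewrite tnth_mktuple/= ni.
    by have := h ord_max; rewrite tnth_mktuple/= ltnn.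
  rewrite tnth_mktuple/=; case: ifPn => ni.
    by apply: h1; apply/mem_iota0.
  suff -> : nat_of_ord i = n by [].
  by apply/eqP; rewrite eqn_leq -ltnS ltn_ord/= leqNgt.
have mI : measurable (\bigcap_(i in [set` iota 0 n]) (U i @^-1` B i)).
  apply: fin_bigcap_measurable => // i _; rewrite -[X in measurable X]setTI.
  exact: measurable_funP.
transitivity (P (\bigcap_(i in [set` iota 0 n.+1]) (U i @^-1` B i))); first by rewrite -E1.
transitivity ((P \x lam R)%E ((\bigcap_(i in [set` iota 0 n]) (U i @^-1` B i)) `*` B n)); last by rewrite -E2.
rewrite (@law_box n.+1 B mB).
transitivity ((\prod_(i <- iota 0 n) lam R (B i)) * lam R (B n))%E; last first.
  by rewrite -(@law_box n B mB); exact/esym/(product_measure1E P (lam R) mI (mB n)).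
by rewrite -[in LHS]addn1 iotaD big_cat/= big_seq1 add0n.
Qed.

(** Conditioning on the first [n] variables, in Fubini form: the last variable is integrated out
    with the others frozen. *)
Lemma law_step n (H : n.+1.-tuple R -> R) : bmf H ->
  EX P (fun w => H (Xn n.+1 w)) = EX P (fun w => EX (lam R) (fun v => H (Yn n (w, v)))).
Proof.
move=> bH; have [mH [M HM]] := bH.
have b2 : bmf (fun z => H (Yn n z)).
  by split; [exact: (measurableT_comp mH (@measurable_Yn n))|exists M].
have b1 : bmf (fun w => H (Xn n.+1 w)).
  by split; [exact: (measurableT_comp mH (@measurable_Xn n.+1))|exists M].
rewrite -(@EX_prod _ _ _ _ _ P (lam R) _ b2) /EX /Rintegral; congr fine.
have h1 := @integral_distribution _ _ _ _ _ P (Xn n.+1) (EFin \o H).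
have h2 := @integral_distribution _ _ _ _ _ (P \x lam R)%E (Yn n) (EFin \o H).
rewrite -[LHS]h1; last 2 first.
- exact/measurable_EFinP.
- exact: (bmf_itg P b1).
rewrite -[RHS]h2; last 2 first.
- exact/measurable_EFinP.
- exact: (@bmf_itg _ _ _ (P \x lam R)%E _ b2).
by apply: eq_measure_integral => A mA _; exact: law_XY.
Qed.
End joint_law.

(** * Martingales of the splitting process *)

Section martingale.
Variable R : realType.
Variables (s t : R).
Hypothesis t0 : 0 < t.
Implicit Types (u : nat -> R) (v w : R).

(* idle counts the splits made once every interval has length at most t. *)
Definition idle u n : R := \sum_(k < n) (if lmax (lens u k) <= t then 1 else 0).
(** Below level [t] each further split multiplies the product by [cis s] (see [base_split]); the
    factor in [idle] undoes this, so the process need not be stopped to have constant mean. *)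
Definition mgale u n : R[i] := (\prod_(x <- lens u n) rfix s (x / t)) * cis (- s * idle u n).
Definition upd u n v : nat -> R := fun k => if (k < n)%N then u k else v.

(* The function hpot solves hpot y = 1 + 2 * E (hpot (y * V)) for y > 1, so that potential is a
   martingale; it bounds the mean number of splits needed to reach level t. *)
Definition hpot (y : R) : R := if y <= 1 then 0 else 2 * y - 1.
Definition potential u n : R := \sum_(x <- lens u n) hpot (x / t) + (n%:R - idle u n).

Lemma idle_ext u u' n : (forall k, (k < n)%N -> u k = u' k) -> idle u n = idle u' n.
Proof.
move=> h; apply: eq_bigr => k _; rewrite (@lens_ext _ u u')// => j jk.
by apply: h; exact: ltn_trans (ltn_ord k).
Qed.

Lemma mgale_ext u u' n : (forall k, (k < n)%N -> u k = u' k) -> mgale u n = mgale u' n.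
Proof. by move=> h; rewrite /mgale (lens_ext h) (idle_ext h). Qed.

Lemma potential_ext u u' n : (forall k, (k < n)%N -> u k = u' k) -> potential u n = potential u' n.
Proof. by move=> h; rewrite /potential (lens_ext h) (idle_ext h). Qed.

Lemma lens_upd u n v : lens (upd u n v) n.+1 = lsplit v (lens u n).
Proof.
rewrite /= (@lens_ext _ _ u); first by rewrite /upd ltnn.
by move=> k kn; rewrite /upd kn.
Qed.

Lemma idle_upd u n v : idle (upd u n v) n.+1 = idle u n + (if lmax (lens u n) <= t then 1 else 0).
Proof.
have e k : (k <= n)%N -> lens (upd u n v) k = lens u k.
  by move=> kn; apply: lens_ext => j jk; rewrite /upd (leq_trans jk kn).
rewrite /idle big_ord_recr/= e//; congr (_ + _).
by apply: eq_bigr => k _; rewrite e// ltnW.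
Qed.

Lemma cabs_prod_exp (l : seq R) (F : R -> R[i]) (c : R) :
  (forall x, x \in l -> cabs (F x) <= expR (c * x)) ->
  cabs (\prod_(x <- l) F x) <= expR (c * \sum_(x <- l) x).
Proof.
elim: l => [|a l IH] h; first by rewrite !big_nil cabs1 mulr0 expR0.
rewrite !big_cons cabsM mulrDr expRD ler_pM ?cabs_ge0//.
  by apply: h; rewrite mem_head.
by apply: IH => x xl; apply: h; rewrite in_cons xl orbT.
Qed.

Section fixed.
Variable u : nat -> R.
Hypothesis u01 : forall k, 0 <= u k <= 1.

Lemma mgale_bound n : cabs (mgale u n) <= expR (24 * s ^+ 2 / t).
Proof.
rewrite cabsM cabs_cis mulr1.
have -> : expR (24 * s ^+ 2 / t) = expR (24 * s ^+ 2 / t * \sum_(x <- lens u n) x).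
  by rewrite sum_lens// mulr1.
apply: cabs_prod_exp => x xl; have [l0 _] := lens_ok u01 n.
apply: (le_trans (@rfix_bound _ s (x / t) _)).
  by apply: divr_ge0; [exact: l0|exact: ltW].
by apply: lexx_eq; congr expR; ring.
Qed.

(** The exponent of [base] is affine in [y]; its linear part is additive over the pieces, while its
    constant part [s] is counted once per interval, whence one extra [cis s]. *)
Lemma base_split (y v : R) : base s (y * v) * base s (y * (1 - v)) = base s y * cis s.
Proof.
rewrite /base [LHS]mulrACA -cisD -[RHS]mulrA -cisD.
have -> : s * (1 - 2 * (y * v)) + s * (1 - 2 * (y * (1 - v))) = s * (1 - 2 * y) + s by ring.
congr (_ * _); apply/eqP; rewrite eq_complex cReM cImM/= !mulr0 !mul0r subr0 addr0 eqxx andbT.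
by rewrite -expRD; apply/eqP; congr expR; ring.
Qed.

Lemma mgale_step n : CE (lam R) (fun v => mgale (upd u n (cl v)) n.+1) = mgale u n.
Proof.
have [l0 ml] := lens_ok u01 n; set m := lmax (lens u n).
have m0 : 0 <= m by exact: lmax_ge0.
set A := \prod_(x <- rem m (lens u n)) rfix s (x / t).
have E v : mgale (upd u n (cl v)) n.+1 = (A * cis (- s * (idle u n + (if m <= t then 1 else 0)))) *
    (rfix s (m / t * cl v) * rfix s (m / t * (1 - cl v))).
  rewrite /mgale lens_upd idle_upd (perm_big _ (lsplit_perm (cl v) ml))/= !big_cons -/m -/A.
  have -> : cl v * m / t = m / t * cl v by ring.
  have -> : (1 - cl v) * m / t = m / t * (1 - cl v) by ring.
  by ring.
have EG : mgale u n = A * cis (- s * idle u n) * rfix s (m / t).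
  rewrite /mgale (perm_big _ (perm_to_rem ml))/= big_cons -/m -/A; ring.
have y0 : 0 <= m / t by rewrite divr_ge0// ltW.
under eq_fun do rewrite E.
(* Either no length exceeds [t], and the extra [cis s] of [base_split] meets the new term of [idle];
   or the longest length exceeds [t], and the step is the equation [rfix_fix] at [m / t]. *)
have [mt|mt] := leP m t.
  have y1 : m / t <= 1 by rewrite ler_pdivrMr// mul1r.
  under eq_fun => v.
    rewrite rfix_le1; last first.
      by apply: le_trans y1; have /andP[] := @ycl_itv _ (m / t) v y0.
    rewrite rfix_le1; last first.
      by apply: le_trans y1; have /andP[] := @y1cl_itv _ (m / t) v y0.
    rewrite base_split.
    over.
  rewrite CE_cst EG rfix_le1// mulrDr mulr1 cisD.
  have : cis (- s) * cis s = 1 by rewrite -cisD addNr cis0.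
  move=> h; rewrite -[RHS]mulr1 -h; ring.
have y1 : 1 < m / t by rewrite ltr_pdivlMr// mul1r.
rewrite addr0 CE_Z.
  by rewrite -/(split_op (rfix s) (m / t)) -rfix_fix.
have fM w : 0 <= w <= m / t -> cabs (rfix s w) <= expR (24 * s ^+ 2 * (m / t)).
  move=> /andP[w0 wy]; apply: (le_trans (rfix_bound s w0)).
  by rewrite ler_expR ler_wpM2l// mulr_ge0// sqr_ge0.
apply: cbmfM; first exact: (cbmf_ycl y0 (cm_rfix s) fM).
exact: (cbmf_y1cl y0 (cm_rfix s) fM).
Qed.

Lemma hpot_bound w y : 0 <= w <= y -> 0 <= hpot w <= 2 * y.
Proof. by rewrite /hpot; case: (leP w 1); lra. Qed.

Lemma measurable_hpot : measurable_fun setT hpot.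
Proof.
apply: measurable_fun_ifT => //; first exact: measurable_fun_ler.
by apply: measurable_funB => //; exact: measurable_funM.
Qed.

Lemma EX_hpot y : 1 < y -> EX (lam R) (fun z => hpot (y * cl z)) = y - 1 /\
  EX (lam R) (fun z => hpot (y * (1 - cl z))) = y - 1.
Proof.
move=> y1; have y0 : 0 < y by lra.
have yi : 0 < y^-1 < 1 by rewrite invr_gt0 y0 invf_lt1.
have yy : y * y^-1 = 1 by rewrite mulfV// gt_eqF.
have mm := measurableT_comp measurable_hpot (@measurable_scale R y).
have bb x : 0 <= x <= 1 -> `|hpot (y * x)| <= 2 * y.
  move=> xx; have /andP[h1 h2] : 0 <= hpot (y * x) <= 2 * y by apply: hpot_bound; nra.
  by rewrite ger0_norm.
have E : EX (lam R) (fun z => hpot (y * cl z)) = y - 1.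
  rewrite (@EX_lam_cl _ (fun z => hpot (y * z)))//; last by exists (2 * y).
  rewrite (@IL_cat _ 0 y^-1)//; last 2 first.
  - by lra.
  - by exists (2 * y) => x xx; apply: bb; lra.
  rewrite (@IL_eq _ _ _ _ (fun z => 0)); last first.
    by move=> x xx; rewrite /hpot ifT//; nra.
  rewrite (@IL_eq _ y^-1 _ _ (fun z => 2 * (y * z) - 1)); last first.
    by move=> x xx; rewrite /hpot ifF//; apply/negbTE; rewrite -ltNge; nra.
  rewrite (@IL_FTC _ _ _ (fun z => 0)); first last.
  - by move=> x _; eapply dvb; dtac.
  - by move=> x _; exact: dC.
  - by lra.
  rewrite (@IL_FTC _ _ _ (fun z => y * z ^+ 2 - z)); first last.
  - by move=> x _; eapply dvb; dtac.
  - by move=> x _; eapply deq; [dtac|rewrite /=; ring].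
  - by lra.
  by field; rewrite gt_eqF.
split=> //; rewrite -E (@EX_reflect _ (fun z => hpot (y * z)))//.
by exists (2 * y).
Qed.

Lemma bmf_hpot y : 0 <= y -> bmf (fun z => hpot (y * cl z)) /\ bmf (fun z => hpot (y * (1 - cl z))).
Proof.
move=> y0; split; split.
- exact: (measurableT_comp measurable_hpot (measurable_ycl y)).
- exists (2 * y) => v; have /andP[h1 h2] := hpot_bound (@ycl_itv _ y v y0).
  by rewrite ger0_norm.
- exact: (measurableT_comp measurable_hpot (measurable_y1cl y)).
- exists (2 * y) => v; have /andP[h1 h2] := hpot_bound (@y1cl_itv _ y v y0).
  by rewrite ger0_norm.
Qed.

Lemma potential_step n : EX (lam R) (fun v => potential (upd u n (cl v)) n.+1) = potential u n.
Proof.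
have [l0 ml] := lens_ok u01 n; set m := lmax (lens u n).
have m0 : 0 <= m by exact: lmax_ge0.
set A := \sum_(x <- rem m (lens u n)) hpot (x / t).
have E v : potential (upd u n (cl v)) n.+1 = (A + n%:R + 1 - idle u n - (if m <= t then 1 else 0)) +
    (hpot (m / t * cl v) + hpot (m / t * (1 - cl v))).
  rewrite /potential lens_upd idle_upd (perm_big _ (lsplit_perm (cl v) ml))/= !big_cons -/m -/A.
  have -> : cl v * m / t = m / t * cl v by ring.
  have -> : (1 - cl v) * m / t = m / t * (1 - cl v) by ring.
  by move: (if m <= t then 1 else 0 : R) => c; rewrite -(natr1 n); ring.
have EG : potential u n = A + n%:R - idle u n + hpot (m / t).
  rewrite /potential (perm_big _ (perm_to_rem ml))/= big_cons -/m -/A; ring.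
have y0 : 0 <= m / t by rewrite divr_ge0// ltW.
under eq_fun do rewrite E.
have [mt|mt] := leP m t.
  have y1 : m / t <= 1 by rewrite ler_pdivrMr// mul1r.
  under eq_fun => v.
    rewrite {1}/hpot ifT; last first.
      by apply: le_trans y1; have /andP[] := @ycl_itv _ (m / t) v y0.
    rewrite /hpot ifT; last first.
      by apply: le_trans y1; have /andP[] := @y1cl_itv _ (m / t) v y0.
    over.
  by rewrite EX_cst EG /hpot y1; ring.
have y1 : 1 < m / t by rewrite ltr_pdivlMr// mul1r.
have [b1 b2] := bmf_hpot y0; have [h1 h2] := EX_hpot y1.
rewrite EX_D; last 2 first.
- exact/bmf_itg/bmf_cst.
- by apply: bmf_itg; exact: bmfD.
rewrite EX_cst EX_D; [|exact: bmf_itg|exact: bmf_itg].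
by rewrite h1 h2 EG /hpot leNgt y1/=; ring.
Qed.

Lemma idle_bounds n : 0 <= idle u n <= n%:R.
Proof.
rewrite /idle sumr_ge0/=; last by move=> i _; case: ifP.
rewrite -[n in leRHS]card_ord -sumr_const; apply: ler_sum => i _; case: ifP => //.
Qed.

(** The lower bound converts the constant mean of [potential] into a bound on the mean number of
    splits; the upper one gives boundedness. *)
Lemma potential_bounds n : n%:R - idle u n <= potential u n <= 2 / t * n.+1%:R + n%:R.
Proof.
have [l0 ml] := lens_ok u01 n.
have hb x : x \in lens u n -> 0 <= hpot (x / t) <= 2 / t.
  move=> xl; have x0 := l0 x xl.
  have x1 : x <= 1.
    rewrite -(sum_lens u01 n) (perm_big _ (perm_to_rem xl))/= big_cons lerDl.
    by rewrite big_seq sumr_ge0// => z /mem_rem /l0.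
  have := @hpot_bound (x / t) t^-1; apply.
  by rewrite divr_ge0 ?(ltW t0)//= ler_pdivrMr// mulVf// gt_eqF.
have /andP[c0 c1] := idle_bounds n.
apply/andP; split.
  by rewrite /potential lerDr big_seq sumr_ge0// => x /hb /andP[].
rewrite /potential lerD//; last by lra.
have : \sum_(x <- lens u n) hpot (x / t) <= \sum_(x <- lens u n) (2 / t).
  by rewrite big_seq [leRHS]big_seq; apply: ler_sum => x /hb /andP[].
by rewrite big_const_seq count_predT size_lens// iter_addr_0 mulr_natr.
Qed.
End fixed.
End martingale.

Lemma cabs_eq0 (R : realType) (z : R[i]) : cabs z = 0 -> z = 0.
Proof.
move=> z0; have := cabs_sqr z; rewrite z0 expr0n/= => /esym/eqP.
rewrite paddr_eq0 ?sqr_ge0// !sqrf_eq0 => /andP[/eqP h1 /eqP h2].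
by apply/eqP; rewrite eq_complex h1 h2 !eqxx.
Qed.

(** * The number of splits before level t *)

Section cm_mgale.
Context d (E : measurableType d) (R : realType).
Variable U : nat -> E -> R.
Hypothesis mU : forall k, measurable_fun setT (U k).
Hypothesis U01 : forall k w, 0 <= U k w <= 1.
Variables (s t : R).
Hypothesis t0 : 0 < t.

Lemma measurable_idle n : measurable_fun setT (fun w => idle t (U ^~ w) n).
Proof.
apply: measurable_sum => k; apply: measurable_fun_ifT => //.
by apply: measurable_fun_ler => //; exact: measurable_lmax_lens.
Qed.

Lemma cm_cis (f : E -> R) : measurable_fun setT f -> cm (fun w => cis (f w)).
Proof.
move=> mf; split => /=.
  apply: (@measurableT_comp _ _ _ _ _ _ (@cos R)) => //.
  by apply: continuous_measurable_fun; exact: continuous_cos.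
apply: (@measurableT_comp _ _ _ _ _ _ (@sin R)) => //.
by apply: continuous_measurable_fun; exact: continuous_sin.
Qed.

Lemma cbmf_mgale n : cbmf (fun w => mgale s t (U ^~ w) n).
Proof.
apply: (@cbmf_cm _ _ _ _ (expR (24 * s ^+ 2 / t))); last first.
  by move=> w; apply: mgale_bound => // k.
apply: cmM.
  apply: (cm_prod_lens mU U01 n (F := fun x => rfix s (x / t))).
  by apply: (cm_comp (cm_rfix s)); exact: measurable_funM.
by apply: cm_cis; apply: measurable_funM => //; exact: measurable_idle.
Qed.

Lemma bmf_potential n : bmf (fun w => potential t (U ^~ w) n).
Proof.
split.
  apply: measurable_funD; last by apply: measurable_funB => //; exact: measurable_idle.
  apply: (measurable_sum_lens mU U01 n (F := fun x => hpot (x / t))).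
  by apply: (measurableT_comp (@measurable_hpot R)); exact: measurable_funM.
exists (2 / t * n.+1%:R + n%:R) => w.
have /andP[h1 h2] := potential_bounds t0 (U01 ^~ w) n.
have /andP[c0 c1] := idle_bounds t (U ^~ w) n.
by rewrite ger0_norm//; apply: le_trans h1; rewrite subr_ge0.
Qed.
End cm_mgale.

Section stopping.
Context d (T : measurableType d) (R : realType) (P : probability T R)
  (U : nat -> {RV P >-> R}).
Hypothesis indU : mutually_independent U.
Hypothesis lawU : forall k (A : set R), measurable A ->
     distribution P (U k) A = uniform_prob (@ltr01 R) A.
Variable t : R.
Hypothesis t0 : 0 < t.

(** Clamping makes the pathwise lemmas valid at every [w]; [clamp_null] shows that it changes
    nothing almost surely. *)
Definition cU (k : nat) (w : T) : R := cl (U k w).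

Lemma mcU k : measurable_fun setT (cU k).
Proof.
by apply: (measurableT_comp (@measurable_cl R)); exact: measurable_funP.
Qed.

Lemma cU01 k w : 0 <= cU k w <= 1.
Proof. by rewrite cl_ge0 cl_le1. Qed.

Definition tU n (k : nat) (x : n.-tuple R) : R := cl (nth 0 x k).

Lemma mtU n k : measurable_fun setT (@tU n k).
Proof.
apply: (measurableT_comp (@measurable_cl R)).
have [kn|nk] := ltnP k n.
  rewrite (_ : (fun x => _) = fun x : n.-tuple R => tnth x (Ordinal kn)).
    exact: measurable_tnth.
  by apply/funext => x; rewrite (tnth_nth 0).
rewrite (_ : (fun x => _) = fun=> 0); first exact: measurable_cst.
by apply/funext => x; rewrite nth_default// size_tuple.
Qed.

Lemma tU01 n k (x : n.-tuple R) : 0 <= tU k x <= 1.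
Proof. by rewrite cl_ge0 cl_le1. Qed.

Lemma tU_Xn n w k : (k < n)%N -> tU k (Xn U n w) = cU k w.
Proof.
by move=> kn; rewrite /tU /cU -[k]/(nat_of_ord (Ordinal kn)) -tnth_nth tnth_mktuple.
Qed.

Lemma tU_Yn n w v k : (k < n.+1)%N -> tU k (Yn U n (w, v)) = upd (cU ^~ w) n (cl v) k.
Proof.
move=> kn; rewrite /tU /upd /cU -[X in nth _ _ X]/(nat_of_ord (Ordinal kn)) -tnth_nth tnth_mktuple/=.
by case: ifP.
Qed.

Lemma CE_mgale s n : CE P (fun w => mgale s t (cU ^~ w) n) = rfix s (1 / t).
Proof.
elim: n => [|n IH].
  rewrite (_ : (fun w => _) = fun=> rfix s (1 / t)); first exact: CE_cst.
  apply/funext => w; rewrite /mgale /= big_seq1 /idle big_ord0 mulr0.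
  by rewrite (_ : cis 0 = 1) ?mulr1// cis0.
have [bR bI] : cbmf (fun x : n.+1.-tuple R => mgale s t (fun k => tU k x) n.+1).
  by apply: cbmf_mgale => //; [exact: mtU|move=> k x; exact: tU01].
have X w : mgale s t (fun k => tU k (Xn U n.+1 w)) n.+1 = mgale s t (cU ^~ w) n.+1.
  by apply: mgale_ext => k kn; exact: tU_Xn.
have Y w v : mgale s t (fun k => tU k (Yn U n (w, v))) n.+1 = mgale s t (upd (cU ^~ w) n (cl v)) n.+1.
  by apply: mgale_ext => k kn; exact: tU_Yn.
have hR := law_step indU lawU bR; have hI := law_step indU lawU bI.
rewrite -IH; apply/eqP; rewrite eq_complex /CE; apply/andP; split; apply/eqP => /=.
  transitivity (EX P (fun w => complex.Re (mgale s t (fun k => tU k (Xn U n.+1 w)) n.+1))).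
    by congr (EX P _); apply/funext => w; rewrite X.
  rewrite hR; congr (EX P _); apply/funext => w.
  under eq_fun do rewrite Y.
  by rewrite -(mgale_step s t0 (cU01 ^~ w) n).
transitivity (EX P (fun w => complex.Im (mgale s t (fun k => tU k (Xn U n.+1 w)) n.+1))).
    by congr (EX P _); apply/funext => w; rewrite X.
  rewrite hI; congr (EX P _); apply/funext => w.
under eq_fun do rewrite Y.
by rewrite -(mgale_step s t0 (cU01 ^~ w) n).
Qed.

Lemma EX_potential n : EX P (fun w => potential t (cU ^~ w) n) = hpot (1 / t).
Proof.
elim: n => [|n IH].
  rewrite (_ : (fun w => _) = fun=> hpot (1 / t)); first exact: EX_cst.
  by apply/funext => w; rewrite /potential /= big_seq1 /idle big_ord0 subr0 addr0.
have bR : bmf (fun x : n.+1.-tuple R => potential t (fun k => tU k x) n.+1).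
  by apply: bmf_potential => //; [exact: mtU|move=> k x; exact: tU01].
have X w : potential t (fun k => tU k (Xn U n.+1 w)) n.+1 = potential t (cU ^~ w) n.+1.
  by apply: potential_ext => k kn; exact: tU_Xn.
have Y w v : potential t (fun k => tU k (Yn U n (w, v))) n.+1 = potential t (upd (cU ^~ w) n (cl v)) n.+1.
  by apply: potential_ext => k kn; exact: tU_Yn.
have hR := law_step indU lawU bR.
rewrite -IH.
transitivity (EX P (fun w => potential t (fun k => tU k (Xn U n.+1 w)) n.+1)).
  by congr (EX P _); apply/funext => w; rewrite X.
rewrite hR; congr (EX P _); apply/funext => w.
under eq_fun do rewrite Y.
by rewrite (potential_step t0 (cU01 ^~ w) n).
Qed.

Definition Mw n (w : T) : R := lmax (lens (cU ^~ w) n).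
(** Since the maximum does not increase, this is the minimum of [n] and the number of splits needed
    to reach level [t]. *)
Definition tn n (w : T) : R := n%:R - idle t (cU ^~ w) n.

Lemma mMw n : measurable_fun setT (Mw n).
Proof. exact: (measurable_lmax_lens mcU n). Qed.

Lemma bmf_tn n : bmf (tn n).
Proof.
split; first by apply: measurable_funB => //; exact: (measurable_idle mcU t n).
exists n%:R => w; have /andP[c0 c1] := idle_bounds t (cU ^~ w) n.
by rewrite ger0_norm ?subr_ge0// lerBlDr lerDl.
Qed.

Lemma tn_ge0 n w : 0 <= tn n w.
Proof. by have /andP[c0 c1] := idle_bounds t (cU ^~ w) n; rewrite subr_ge0. Qed.

Lemma EX_tn n : EX P (tn n) <= 2 / t.
Proof.
apply: (@le_trans _ _ (EX P (fun w => potential t (cU ^~ w) n))).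
  apply: EX_le => [||w]; first exact/bmf_itg/bmf_tn.
    by apply: bmf_itg; apply: bmf_potential => //; [exact: mcU|move=> k w; exact: cU01].
  by have /andP[] := potential_bounds t0 (cU01 ^~ w) n.
rewrite EX_potential; have ti : 0 < t^-1 by rewrite invr_gt0.
by rewrite /hpot; case: ifP => _; lra.
Qed.

Lemma tnS n w : tn n.+1 w = tn n w + (if Mw n w <= t then 0 else 1).
Proof.
rewrite /tn /idle big_ord_recr/= -/(Mw n w) -(natr1 n).
by case: ifP => _; ring.
Qed.

Lemma tn_stable N n w : Mw N w <= t -> (N <= n)%N -> Mw n w <= t /\ tn n w = tn N w.
Proof.
move=> MN Nn.
have M_le m : (N <= m)%N -> Mw m w <= t.
  by move=> Nm; apply: le_trans MN; apply: lmax_lens_le => // k; exact: cU01.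
split; first exact: M_le.
elim: n Nn => [|n IH]; first by rewrite leqn0 => /eqP ->.
rewrite leq_eqVlt => /predU1P[->//|]; rewrite ltnS => Nn.
by rewrite tnS M_le// addr0 IH.
Qed.

Lemma tn_full n w : t < Mw n w -> tn n.+1 w = n.+1%:R.
Proof.
move=> tM.
have M_gt m : (m <= n)%N -> (Mw m w <= t) = false.
  move=> mn; apply/negbTE; rewrite -ltNge; apply: lt_le_trans tM _.
  by apply: lmax_lens_le => // k; exact: cU01.
suff h m : (m <= n.+1)%N -> tn m w = m%:R by exact: h.
elim: m => [|m IH] mn; first by rewrite /tn /idle big_ord0 subr0.
by rewrite tnS M_gt// IH ?natr1// ltnW.
Qed.

(** Markov's inequality: on this event [tn n.+1] equals [n.+1], while its mean is at most
    [2 / t]. *)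
Lemma P_Mw_gt n : fine (P [set w | t < Mw n w]) <= 2 / t / n.+1%:R.
Proof.
have mA : measurable [set w | t < Mw n w].
  rewrite -[X in measurable X]setTI.
  by apply: (measurable_fun_ltr _ (mMw n)) => //; exact: measurable_cst.
rewrite -(EX_indic P mA) ler_pdivlMr ?ltr0n// mulrC -EX_Z; last exact/bmf_itg/bmf_indic.
apply: le_trans (EX_tn n.+1); apply: EX_le => [||w].
- by apply: bmf_itg; apply: bmfM; [exact: bmf_cst|exact: bmf_indic].
- exact/bmf_itg/bmf_tn.
rewrite indicE; case: (boolP (w \in _)) => [|_]; last by rewrite mulr0 tn_ge0.
by rewrite inE/= => /tn_full ->; rewrite mulr1.
Qed.

(* The default 0 matters only on the null event where some interval longer than t
   survives forever. *)
Definition en n w : R := if Mw n w <= t then tn n w else 0.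
Definition tau (w : T) : R := limn (en ^~ w).

Lemma en_cvg w : en n w @[n --> \oo] --> tau w.
Proof.
suff : cvgn (en ^~ w) by [].
have [[N MN]|h] := pselect (exists N, Mw N w <= t).
  apply/cvg_ex; exists (tn N w); apply: cvg_near_cst.
  exists N => // n /= Nn; have [M1 E1] := tn_stable MN Nn.
  by rewrite /en M1 E1.
rewrite (_ : en ^~ w = fun=> 0); first exact: is_cvg_cst.
by apply/funext => n; rewrite /en ifF//; apply/negbTE/negP => hn; apply: h; exists n.
Qed.

Lemma tauE N w : Mw N w <= t -> tau w = tn N w.
Proof.
move=> MN; apply: (cvg_lim (@Rhausdorff R)); apply: cvg_near_cst.
exists N => // n /= Nn; have [M1 E1] := tn_stable MN Nn.
by rewrite /en M1 E1.
Qed.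

Lemma men n : measurable_fun setT (en n).
Proof.
apply: measurable_fun_ifT => //; first exact: measurable_fun_ler (mMw n) (measurable_cst _).
by have [] := bmf_tn n.
Qed.

Lemma measurable_tau : measurable_fun setT tau.
Proof. by apply: (measurable_fun_cvg men) => w _; exact: en_cvg. Qed.

Lemma en_ge0 n w : 0 <= en n w.
Proof. by rewrite /en; case: ifP => _ //; exact: tn_ge0. Qed.

Lemma en_nd w m n : (m <= n)%N -> en m w <= en n w.
Proof.
move=> mn; rewrite {1}/en; case: ifP => [h|_]; last exact: en_ge0.
by have [M1 E1] := tn_stable h mn; rewrite /en M1 E1.
Qed.

(** The variables [en n] increase to [tau] and lie below [tn n], whose means are at most [2 / t];
    monotone convergence applies. Integrability of [tau] is required by the smoothing inequality. *)
Lemma itg_tau : P.-integrable setT (EFin \o tau).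
Proof.
have X0 w : 0 <= tau w.
  apply: limr_ge; first exact: (cvgP _ (@en_cvg w)).
  by apply: nearW => n; exact: en_ge0.
apply/integrableP; split; first by apply/measurable_EFinP; exact: measurable_tau.
under eq_integral do rewrite /= ger0_norm//.
have E : (\int[P]_w (tau w)%:E = limn (fun n => \int[P]_w (en n w)%:E))%E.
  rewrite -monotone_convergence//.
  - apply: eq_integral => w _; apply/esym/cvg_lim => //.
    by apply: cvg_EFin; [exact: nearW|exact: en_cvg].
  - by move=> n; apply/measurable_EFinP; exact: men.
  - by move=> n w _; rewrite lee_fin en_ge0.
  - by move=> w _ m n mn; rewrite lee_fin en_nd.
rewrite E; apply: (@le_lt_trans _ _ (2 / t)%:E); last exact: ltry.
apply: lime_le.
  apply: ereal_nondecreasing_is_cvgn => m n mn; apply: ge0_le_integral => //.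
  - by move=> w _; rewrite lee_fin en_ge0.
  - by apply/measurable_EFinP; exact: men.
  - by apply/measurable_EFinP; exact: men.
  - by move=> w _; rewrite lee_fin en_nd.
apply: nearW => n; apply: (@le_trans _ _ (\int[P]_w (tn n w)%:E)%E).
  have [mt _] := bmf_tn n.
  apply: ge0_le_integral => //.
  - by move=> w _; rewrite lee_fin en_ge0.
  - by apply/measurable_EFinP; exact: men.
  - exact/measurable_EFinP.
  - by move=> w _; rewrite lee_fin /en; case: ifP => // _; exact: tn_ge0.
have hb := bmf_itg P (bmf_tn n).
have := integrable_fin_num measurableT hb => /fineK <-.
by rewrite lee_fin; exact: EX_tn.
Qed.

Lemma prod_base (l : seq R) s : \prod_(x <- l) base s (x / t) =
  Complex (expR (vK R * s ^+ 2 / 2 * (\sum_(x <- l) x / t))) 0 *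
  cis (s * ((size l)%:R - 2 * (\sum_(x <- l) x / t))).
Proof.
elim: l => [|a l IH].
  rewrite !big_nil mulr0 expR0 mulr0 subr0 mulr0 (_ : cis 0 = 1) ?mulr1// cis0//.
rewrite !big_cons IH /base [LHS]mulrACA -cisD/= -(natr1 (size l)).
congr (_ * cis _); last by ring.
apply/eqP; rewrite eq_complex cReM cImM/= !mulr0 !mul0r subr0 addr0 eqxx andbT.
by rewrite -expRD -mulrDr.
Qed.

(** Once level [t] is reached the product involves [base] alone, and there are [n + 1] lengths of
    sum 1. The phase follows because [n + 1 - idle] is [tn n w + 1]. *)
Lemma mgale_small s n w : Mw n w <= t -> mgale s t (cU ^~ w) n =
  Complex (expR (vK R * s ^+ 2 / 2 / t)) 0 * cis (s * (tn n w + 1 - 2 / t)).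
Proof.
move=> Mt; rewrite /mgale.
have -> : \prod_(x <- lens (cU^~ w) n) rfix s (x / t) = \prod_(x <- lens (cU^~ w) n) base s (x / t).
  rewrite big_seq [RHS]big_seq; apply: eq_bigr => x xl; apply: rfix_le1.
  by rewrite ler_pdivrMr// mul1r (le_trans (lmax_ub xl)).
have u01 k : 0 <= cU k w <= 1 by exact: cU01.
rewrite prod_base -mulr_suml (sum_lens u01) size_lens// mul1r -mulrA -cisD mulrA.
by congr (_ * cis _); rewrite /tn -(natr1 n); ring.
Qed.

Lemma cbmf_cis_tau s : cbmf (fun w => cis (s * (tau w + 1 - 2 / t))).
Proof.
apply: (@cbmf_cm _ _ _ _ 1); last by move=> w; rewrite cabs_cis.
apply: cm_cis; apply: measurable_funM => //.
by apply: measurable_funB => //; apply: measurable_funD => //; exact: measurable_tau.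
Qed.

(** The mean of [mgale] is [rfix s (1 / t)] for every [n], and [mgale] has the value of
    [mgale_small] unless [Mw n] still exceeds [t]. That event has probability at most
    [2 / t / n.+1], and both quantities are bounded by [B] there; the difference is thus at most
    [4 * B / t / n.+1] for every [n], hence 0. *)
Lemma CE_tau s : CE P (fun w => cis (s * (tau w + 1 - 2 / t))) =
  Complex (expR (- (vK R * s ^+ 2 / 2 / t))) 0 * rfix s (1 / t).
Proof.
set c := Complex (expR (vK R * s ^+ 2 / 2 / t)) 0.
have cc : Complex (expR (- (vK R * s ^+ 2 / 2 / t))) 0 * c = 1.
  apply/eqP; rewrite eq_complex cReM cImM/= !mulr0 !mul0r subr0 addr0 eqxx andbT.
  by rewrite -expRD addNr expR0.
suff D : c * CE P (fun w => cis (s * (tau w + 1 - 2 / t))) = rfix s (1 / t).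
  by rewrite -D mulrA cc mul1r.
have ti : 0 < t^-1 by rewrite invr_gt0.
have s2 := sqr_ge0 s; have vb := vK_bounds R.
set B := expR (24 * s ^+ 2 / t).
have B0 : 0 < B by exact: expR_gt0.
have cB : cabs c <= B.
  rewrite cabs_real ger0_norm ?expR_ge0// ler_expR ler_pM2r//.
  have : vK R * s ^+ 2 <= 3 * s ^+ 2 by rewrite ler_wpM2r//; lra.
  lra.
have key n : cabs (c * CE P (fun w => cis (s * (tau w + 1 - 2 / t))) - rfix s (1 / t)) <=
    4 * B / t / n.+1%:R.
  rewrite -(CE_mgale s n).
  have b1 : cbmf (fun w => c * cis (s * (tau w + 1 - 2 / t))).
    by apply: cbmfM; [exact: cbmf_cst|exact: cbmf_cis_tau].
  have b2 : cbmf (fun w => mgale s t (cU ^~ w) n).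
    by apply: cbmf_mgale => //; [exact: mcU|move=> k w; exact: cU01].
  rewrite -CE_Z; last exact: cbmf_cis_tau.
  rewrite -(CE_B P b1 b2).
  have mA : measurable [set w | t < Mw n w].
    rewrite -[X in measurable X]setTI.
    by apply: (measurable_fun_ltr _ (mMw n)) => //; exact: measurable_cst.
  apply: (@le_trans _ _ (EX P (fun w => 2 * B * \1_[set w | t < Mw n w] w))).
    apply: CE_norm_le.
    - exact: cbmfB.
    - by apply: bmf_itg; apply: bmfM; [exact: bmf_cst|exact: bmf_indic].
    move=> w; have [Mt|Mt] := leP (Mw n w) t.
      rewrite mgale_small// (tauE Mt) subrr cabs0 mulr_ge0//; first by rewrite mulr_ge0// ltW.
    rewrite indicE mem_set//= mulr1 (le_trans (cabsB _ _))//.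
    rewrite cabsM cabs_cis mulr1.
    have : cabs (mgale s t (cU ^~ w) n) <= B by apply: mgale_bound => // k; exact: cU01.
    by move: cB; lra.
  rewrite EX_Z; last exact/bmf_itg/bmf_indic.
  rewrite EX_indic//.
  have := P_Mw_gt n => h.
  have -> : 4 * B / t / n.+1%:R = 2 * B * (2 / t / n.+1%:R) by ring.
  by rewrite ler_wpM2l// mulr_ge0// ltW.
set z := c * _ - _ in key.
have z0 : cabs z = 0.
  apply/eqP; rewrite eq_le cabs_ge0 andbT leNgt; apply/negP => zp.
  have C0 : 0 < 4 * B / t by rewrite !mulr_gt0.
  have := key (Num.truncn (4 * B / t / cabs z)).
  have h := truncnS_gt (4 * B / t / cabs z).
  rewrite ler_pdivlMr ?ltr0n// => k.
  move: h; rewrite ltr_pdivrMr// => h; rewrite (mulrC (cabs z)) in k.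
  by have := lt_le_trans h k; rewrite ltxx.
apply/eqP; rewrite -subr_eq0 -/z; apply/eqP.
exact: cabs_eq0 z0.
Qed.

Lemma probU2 (A B : set T) : measurable A -> measurable B -> (P (A `|` B) <= P A + P B)%E.
Proof. by move=> mA mB; exact: measureU2. Qed.

Lemma eq_prob_null (A B N : set T) : measurable A -> measurable B -> measurable N ->
  P N = 0%E -> A `<=` B `|` N -> B `<=` A `|` N -> P A = P B.
Proof.
move=> mA mB mN N0 AB BA; apply/eqP; rewrite eq_le; apply/andP; split.
  apply: (@le_trans _ _ (P (B `|` N))).
    by apply: le_measure; rewrite ?inE//; exact: measurableU.
  by apply: (le_trans (probU2 mB mN)); rewrite N0 adde0.
apply: (@le_trans _ _ (P (A `|` N))).
  by apply: le_measure; rewrite ?inE//; exact: measurableU.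
by apply: (le_trans (probU2 mA mN)); rewrite N0 adde0.
Qed.

Lemma never_null : P (\bigcap_n [set w | t < Mw n w]) = 0%E.
Proof.
have mA n : measurable [set w | t < Mw n w].
  rewrite -[X in measurable X]setTI.
  by apply: (measurable_fun_ltr _ (mMw n)) => //; exact: measurable_cst.
have mI : measurable (\bigcap_n [set w | t < Mw n w]) by exact: bigcapT_measurable.
have fin : P (\bigcap_n [set w | t < Mw n w]) \is a fin_num by exact: fin_num_measure.
rewrite -(fineK fin); congr EFin; apply/eqP; rewrite eq_le fine_ge0 ?measure_ge0// andbT.
rewrite leNgt; apply/negP => zp; set z := fine _ in zp.
have key n : z <= 2 / t / n.+1%:R.
  apply: le_trans (P_Mw_gt n); apply: fine_le => //; first exact: fin_num_measure.
  by apply: le_measure; rewrite ?inE// => w; exact.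
have C0 : 0 < 2 / t by rewrite mulr_gt0// invr_gt0.
have := key (Num.truncn (2 / t / z)).
have h := truncnS_gt (2 / t / z).
rewrite ler_pdivlMr ?ltr0n// => k.
move: h; rewrite ltr_pdivrMr// => h; rewrite (mulrC z) in k.
by have := lt_le_trans h k; rewrite ltxx.
Qed.

Lemma clamp_null : exists2 N : set T, measurable N /\ P N = 0%E &
  forall w, ~ N w -> forall k, U k w = cU k w.
Proof.
have nk k : P (U k @^-1` (~` `[0, 1]%classic)) = 0%E.
  have m01 : measurable (~` `[0, 1]%classic : set R) by exact: measurableC.
  rewrite -[LHS]/(distribution P (U k) (~` `[0, 1]%classic)) lawU//.
  by rewrite /uniform_prob integral_uniform_pdf setICl integral_set0.
have : P.-negligible (\bigcup_k (U k @^-1` (~` `[0, 1]%classic))).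
  apply: negligible_bigcup => k; exists (U k @^-1` (~` `[0, 1]%classic)); split; last by [].
    rewrite -[X in measurable X]setTI; apply: measurable_funP => //.
    exact: measurableC.
  exact: nk.
move=> [N [mN N0 sN]]; exists N => // w Nw k; rewrite /cU cl_id//.
apply: contrapT => h; apply: Nw; apply: sN; exists k => //=.
Qed.

(** Two null events are set aside: some [U k] leaves [0, 1], or level [t] is never reached, where
    [tau] takes its default 0. Elsewhere [Mn <= t] gives [tau = tn n <= n], and [Mn > t] gives
    [tau >= n + 1] through [tn_full]. *)
Lemma P_tau n : P [set w | Mn (fun k => U k w) n <= t] = P [set w | tau w <= n%:R].
Proof.
have [N [mN N0] hN] := clamp_null.
have mA k : measurable [set w | t < Mw k w].
  rewrite -[X in measurable X]setTI.
  by apply: (measurable_fun_ltr _ (mMw k)) => //; exact: measurable_cst.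
have mI : measurable (\bigcap_n [set w | t < Mw n w]) by exact: bigcapT_measurable.
apply: (@eq_prob_null _ _ (N `|` \bigcap_n [set w | t < Mw n w])).
- rewrite -[X in measurable X]setTI.
  have -> : [set w | Mn (fun k => U k w) n <= t] = [set w | lmax (lens (fun k => U k w) n) <= t].
    by apply/funext => w; rewrite /mkset MnE.
  have mU k : measurable_fun setT (U k) by exact: measurable_funP.
  by apply: (measurable_fun_ler (measurable_lmax_lens mU n)) => //; exact: measurable_cst.
- rewrite -[X in measurable X]setTI.
  by apply: (measurable_fun_ler measurable_tau) => //; exact: measurable_cst.
- exact: measurableU.
- apply/eqP; rewrite eq_le measure_ge0 andbT.
  by apply: (le_trans (probU2 mN mI)); rewrite N0 add0e never_null.
- move=> w /=; rewrite MnE => h; have [Nw|Nw] := pselect (N w); first by right; left.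
  left; have E : lens (U ^~ w) n = lens (cU ^~ w) n by apply: lens_ext => k _; exact: hN.
  move: h; rewrite [lens _ _]E => h; rewrite (tauE h) /tn lerBlDr lerDl.
  by have /andP[] := idle_bounds t (cU ^~ w) n.
- move=> w /= h; have [Nw|Nw] := pselect (N w); first by right; left.
  have [[m Mm]|h'] := pselect (exists m, Mw m w <= t); last first.
    right; right => m _ /=; rewrite ltNge; apply/negP => h2; apply: h'; by exists m.
  left; rewrite MnE.
  have E : lens (U ^~ w) n = lens (cU ^~ w) n by apply: lens_ext => k _; exact: hN.
  rewrite [lens _ _]E leNgt; apply/negP => tM.
  have f := tn_full tM.
  have nm : (n < m)%N.
    rewrite ltnNge; apply/negP => mn.
    have [h1 _] := tn_stable Mm mn; by move: tM; rewrite ltNge -/(Mw n w) h1.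
  have mono j : (n.+1 <= j)%N -> n.+1%:R <= tn j w.
    elim: j => // j IH; rewrite leq_eqVlt => /predU1P[<-|]; first by rewrite f.
    rewrite ltnS => /IH h1; rewrite tnS; case: ifP => _; lra.
  have := mono m nm; rewrite -(tauE Mm) => h3.
  have := le_trans h3 h; rewrite ler_nat; lia.
Qed.
End stopping.

(** * A smoothing inequality *)

Section measurability.
Context d (T : measurableType d) (R : realType).
Implicit Types f g : T -> R.

Lemma measurable_fcos f : measurable_fun setT f -> measurable_fun setT (fun x => cos (f x)).
Proof.
move=> mf; apply: (measurableT_comp (f := @cos R)) => //.
by apply: continuous_measurable_fun; exact: continuous_cos.
Qed.

Lemma measurable_finv f : measurable_fun setT f -> (forall x, 0 < f x) ->
  measurable_fun setT (fun x => (f x)^-1).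
Proof.
move=> mf f0.
have -> : (fun x => (f x)^-1) = (fun x => expR (- ln (f x))).
  by apply/funext => x; rewrite expRN lnK// posrE.
apply: (measurableT_comp (f := expR)) => //; apply: measurable_funN.
exact: measurableT_comp (@measurable_ln R) mf.
Qed.

Lemma measurable_fclamp f : measurable_fun setT f -> measurable_fun setT (fun x => cl (f x)).
Proof. by move=> mf; apply: (measurableT_comp (f := @cl R)) => //; exact: measurable_cl. Qed.
End measurability.

Ltac meas := do 20 ? [exact: measurable_cst | exact: measurable_fst | exact: measurable_snd
  | exact: measurable_id | assumption | apply: measurable_fcos | apply: measurable_fclamp | apply: measurable_maxr
  | apply: measurable_funX | apply: measurable_funB | apply: measurable_funD
  | apply: measurable_funM | apply: measurable_funN].

Section kernel.
Variable R : realType.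
Implicit Types s z a b : R.
Local Notation lam := (lam R).

Lemma cl01 (u : R) : 0 <= cl u <= 1. Proof. by rewrite cl_ge0 cl_le1. Qed.

Lemma onem_cl (u : R) : `|1 - cl u| <= 1.
Proof. by have := cl01 u => h; rewrite ger0_norm; lra. Qed.

(* bspl is the cosine transform of the nonnegative function 12 (1 - cos (z / 2))^2 / z^4, so
   its primitive sstep is a monotone smoothing of the sign function, with error O(z^-3). *)
Definition bspl s : R := (1 - s) ^+ 3 - 4 * Num.max (1 / 2 - s) 0 ^+ 3.

Lemma bspl_bounds s : 0 <= s <= 1 -> 0 <= bspl s <= 1.
Proof.
move=> /andP[s0 s1]; rewrite /bspl.
have h0 : 0 <= (1 - s) ^+ 3 <= 1.
  by rewrite exprn_ge0 ?exprn_ile1//=; lra.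
case: (leP (1 / 2 - s) 0) => h; first by move: h0; rewrite expr0n/=; lra.
have h1 : 0 <= (1 / 2 - s) ^+ 3 by rewrite exprn_ge0// ltW.
have h2 : (2 * (1 / 2 - s)) ^+ 3 <= (1 - s) ^+ 3 by rewrite lerXn2r ?nnegrE//; lra.
by move: h2; rewrite exprMn; lra.
Qed.

Lemma measurable_bspl d (T : measurableType d) (f : T -> R) : measurable_fun setT f ->
  measurable_fun setT (fun x => bspl (f x)).
Proof.
by move=> mf; rewrite /bspl; meas.
Qed.

Lemma bspl_cl (u : R) : 0 <= bspl (cl u) <= 1. Proof. exact/bspl_bounds/cl01. Qed.

Lemma EX_cos s a b : s != 0 ->
  (b - a) * EX lam (fun u => cos (s * (a + (b - a) * cl u))) = (sin (s * b) - sin (s * a)) / s.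
Proof.
move=> s0; rewrite -EX_Z; last first.
  apply: bmf_itg; split; first meas.
  by exists 1 => u; exact: cos_max.
rewrite (@EX_lam_cl _ (fun u => (b - a) * cos (s * (a + (b - a) * u)))); last 2 first.
- meas.
- by exists `|b - a| => x _; rewrite normrM ler_piMr//; exact: cos_max.
rewrite (@IL_FTC _ 0 1 (fun u => sin (s * (a + (b - a) * u)) / s))//.
- by rewrite mulr0 addr0 mulr1 subrKC mulrBl.
- by move=> x _; eapply deq; [dtac|rewrite /=; field].
Qed.

(** The function [sin (s * z) / s], written as an integral so that it takes the value [z] at [s = 0]
    and the bound [|z|] is immediate. *)
Definition sinc s z : R := z * EX lam (fun u => cos (s * (z * cl u))).

Lemma sincE s z : s != 0 -> sinc s z = sin (s * z) / s.
Proof.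
move=> s0; have := EX_cos 0 z s0; rewrite mulr0 sin0 !subr0 => <-.
by rewrite /sinc; congr (_ * EX _ _); apply/funext => u; rewrite add0r.
Qed.

Lemma sinc_norm s z : `|sinc s z| <= `|z|.
Proof.
rewrite /sinc normrM ler_piMr//; apply: EX_norm_le => [|x]; last exact: cos_max.
by split; [meas|exists 1 => u; exact: cos_max].
Qed.

Lemma sincN s z : sinc s (- z) = - sinc s z.
Proof.
rewrite /sinc mulNr; congr (- (_ * EX _ _)); apply/funext => u.
by rewrite mulNr mulrN cosN.
Qed.

Lemma sinc_diff s a b : sinc s b - sinc s a =
  (b - a) * EX lam (fun u => cos (s * (a + (b - a) * cl u))).
Proof.
have [->|s0] := eqVneq s 0; last by rewrite !sincE// EX_cos// mulrBl.
rewrite /sinc; have h (f : R -> R) : EX lam (fun u => cos (0 * f u)) = 1.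
  by rewrite -[RHS](EX_cst lam); congr (EX _ _); apply/funext => u; rewrite mul0r cos0.
by rewrite (h (fun u => b * cl u)) (h (fun u => a * cl u)) (h (fun u => a + (b - a) * cl u)) !mulr1.
Qed.

Lemma measurable_sinc d (T : measurableType d) (f g : T -> R) : measurable_fun setT f ->
  measurable_fun setT g -> measurable_fun setT (fun x => sinc (f x) (g x)).
Proof.
move=> mf mg; apply: measurable_funM => //.
have := @measurable_EX _ _ _ _ _ lam (fun xu : T * measurableTypeR R =>
  cos (f xu.1 * (g xu.1 * cl xu.2))).
apply; apply: measurable_fcos; apply: measurable_funM; last apply: measurable_funM.
- by apply: (measurableT_comp mf); exact: measurable_fst.
- by apply: (measurableT_comp mg); exact: measurable_fst.
- meas.
Qed.

Definition dstep z : R := EX lam (fun u => bspl (cl u) * cos (cl u * z)).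
Definition sstep z : R := EX lam (fun u => bspl (cl u) * sinc (cl u) z).

Lemma bmf_dstep z : bmf (fun u : measurableTypeR R => bspl (cl u) * cos (cl u * z)).
Proof.
split; first by apply: measurable_funM; [apply: measurable_bspl|]; meas.
exists 1 => u; rewrite normrM mulr_ile1 ?cos_max//.
by have /andP[h0 h1] := bspl_cl u; rewrite ger0_norm.
Qed.

Lemma bmf_sstep z : bmf (fun u : measurableTypeR R => bspl (cl u) * sinc (cl u) z).
Proof.
split; first by apply: measurable_funM; [apply: measurable_bspl|apply: measurable_sinc]; meas.
exists `|z| => u; rewrite normrM (le_trans _ (sinc_norm (cl u) z))//.
by have /andP[h0 h1] := bspl_cl u; rewrite ler_piMl// ger0_norm.
Qed.

Lemma measurable_dstep d (T : measurableType d) (f : T -> R) : measurable_fun setT f ->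
  measurable_fun setT (fun x => dstep (f x)).
Proof.
move=> mf; have := @measurable_EX _ _ _ _ _ lam (fun xu : T * measurableTypeR R =>
  bspl (cl xu.2) * cos (cl xu.2 * f xu.1)).
apply; apply: measurable_funM; first by apply: measurable_bspl; meas.
apply: measurable_fcos; apply: measurable_funM; first by meas.
by apply: (measurableT_comp mf); exact: measurable_fst.
Qed.

Lemma measurable_sstep d (T : measurableType d) (f : T -> R) : measurable_fun setT f ->
  measurable_fun setT (fun x => sstep (f x)).
Proof.
move=> mf; have := @measurable_EX _ _ _ _ _ lam (fun xu : T * measurableTypeR R =>
  bspl (cl xu.2) * sinc (cl xu.2) (f xu.1)).
apply; apply: measurable_funM; first by apply: measurable_bspl; meas.
apply: measurable_sinc; first by meas.
by apply: (measurableT_comp mf); exact: measurable_fst.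
Qed.

Lemma dstep_norm z : `|dstep z| <= 1.
Proof.
apply: EX_norm_le => [|u]; first exact: bmf_dstep.
rewrite normrM mulr_ile1 ?cos_max//.
by have /andP[h0 h1] := bspl_cl u; rewrite ger0_norm.
Qed.

(** After an exchange of integrals, [dstep] appears as the derivative of [sstep], in the integrated
    form from which monotonicity and tail bounds are read off. *)
Lemma sstep_diff a b : sstep b - sstep a = (b - a) * EX lam (fun u => dstep (a + (b - a) * cl u)).
Proof.
rewrite -EX_B; [|exact/bmf_itg/bmf_sstep..].
transitivity (EX lam (fun u => (b - a) * EX lam (fun v => bspl (cl u) * cos (cl u * (a + (b - a) * cl v))))).
  congr (EX _ _); apply/funext => u; rewrite -mulrBr sinc_diff mulrCA; congr (_ * _).
  by rewrite EX_Z//; apply: bmf_itg; split; [meas|exists 1 => v; exact: cos_max].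
have bf : bmf (fun xu : measurableTypeR R * measurableTypeR R =>
    bspl (cl xu.1) * cos (cl xu.1 * (a + (b - a) * cl xu.2))).
  split; first by apply: measurable_funM; [apply: measurable_bspl|]; meas.
  exists 1 => u; rewrite normrM mulr_ile1 ?cos_max//.
  by have /andP[h0 h1] := bspl_cl u.1; rewrite ger0_norm.
rewrite EX_Z; last first.
  apply: bmf_itg; split.
    by have [+ _] := bf => /(@measurable_EX _ _ _ _ _ lam).
  exists 1 => u; apply: EX_norm_le; first exact: (bmf_section1 _ bf).
  move=> v; rewrite normrM mulr_ile1 ?cos_max//.
  by have /andP[h0 h1] := bspl_cl u; rewrite ger0_norm.
have E : EX lam (fun x => EX lam (fun v => bspl (cl x) * cos (cl x * (a + (b - a) * cl v)))) =
    EX lam (fun v => EX lam (fun x => bspl (cl x) * cos (cl x * (a + (b - a) * cl v)))).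
  exact: (EX_fubini lam lam bf).
by rewrite E.
Qed.

Lemma IL_cube a z : 0 <= a -> z != 0 -> IL 0 a (fun s => (a - s) ^+ 3 * cos (s * z)) =
  6 * (cos (a * z) - 1 + (a * z) ^+ 2 / 2) / z ^+ 4.
Proof.
move=> a0 z0; rewrite (@IL_FTC _ 0 a (fun s => (a - s) ^+ 3 * sin (s * z) / z
   - 3 * (a - s) ^+ 2 * cos (s * z) / z ^+ 2
   - 6 / z ^+ 2 * ((a - s) * sin (s * z) / z - cos (s * z) / z ^+ 2)))//.
- by rewrite subrr !mul0r cos0 sin0; field.
- by move=> x _; eapply deq; [dtac|rewrite /=; field].
Qed.

Lemma bmf_cube a z : bmf (fun u : measurableTypeR R => (a - cl u) ^+ 3 * cos (cl u * z)).
Proof.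
split; first by meas.
exists ((`|a| + 1) ^+ 3) => u; rewrite normrM -[leRHS]mulr1 ler_pM//; last exact: cos_max.
rewrite normrX lerXn2r ?nnegrE ?addr_ge0// (le_trans (ler_normB _ _))// lerD2l.
by rewrite ger0_norm ?cl_ge0 ?cl_le1.
Qed.

(** The coefficient 4 and the knot 1/2 of [bspl] cancel the [z ^+ 2] terms of the two cubes and
    leave a square: with [c = cos (z / 2)], the numerator is [6 * cos z - 24 * c + 18 = 12 * (1 - c)
    ^+ 2]. *)
Lemma dstepE z : z != 0 -> dstep z = 12 * (1 - cos (z / 2)) ^+ 2 / z ^+ 4.
Proof.
move=> z0.
have -> : dstep z = EX lam (fun u => (1 - cl u) ^+ 3 * cos (cl u * z)) -
    4 * EX lam (fun u => Num.max (1 / 2 - cl u) 0 ^+ 3 * cos (cl u * z)).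
  have bm : bmf (fun u : measurableTypeR R => Num.max (1 / 2 - cl u) 0 ^+ 3 * cos (cl u * z)).
    split; first by meas.
    exists 1 => u; rewrite normrM mulr_ile1 ?cos_max//.
    rewrite normrX exprn_ile1// ger0_norm ?le_max ?lexx ?orbT// ge_max ler01 andbT.
    by have := cl_ge0 u; lra.
  rewrite -EX_Z; last exact: bmf_itg.
  rewrite -EX_B; last 2 first.
  - exact/bmf_itg/bmf_cube.
  - by apply: bmf_itg; apply: bmfM => //; exact: bmf_cst.
  by congr (EX _ _); apply/funext => u; rewrite /bspl; ring.
rewrite (@EX_lam_cl _ (fun s => (1 - s) ^+ 3 * cos (s * z))); last 2 first.
- meas.
- exists 1 => s s01; rewrite normrM mulr_ile1 ?cos_max//.
  by rewrite normrX exprn_ile1// ger0_norm//; move: s01; lra.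
rewrite IL_cube//.
rewrite (@EX_lam_cl _ (fun s => Num.max (1 / 2 - s) 0 ^+ 3 * cos (s * z))); last 2 first.
- by meas.
- exists 1 => s s01; rewrite normrM mulr_ile1 ?cos_max//.
  rewrite normrX exprn_ile1// ger0_norm ?le_max ?lexx ?orbT// ge_max ler01 andbT.
  by move: s01; lra.
rewrite (@IL_cat _ 0 (1 / 2) 1); last 3 first.
- lra.
- by meas.
- exists 1 => s s01; rewrite normrM mulr_ile1 ?cos_max//.
  rewrite normrX exprn_ile1// ger0_norm ?le_max ?lexx ?orbT// ge_max ler01 andbT.
  by move: s01; lra.
rewrite (@IL_eq _ 0 (1 / 2) _ (fun s => (1 / 2 - s) ^+ 3 * cos (s * z))); last first.
  by move=> s s01; rewrite max_l//; lra.
rewrite (@IL_eq _ (1 / 2) 1 _ (fun s => 0)); last first.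
  by move=> s s01; rewrite max_r ?expr0n ?mul0r//; lra.
have -> : IL (1 / 2) 1 (fun _ : R => 0) = 0 by rewrite /IL Rintegral_cst// mul0r.
rewrite IL_cube//.
have -> : cos (1 * z) = 2 * cos (z / 2) ^+ 2 - 1.
  by rewrite mul1r [in LHS](splitr z) cosD -!expr2 sin2cos2; ring.
have -> : 1 / 2 * z = z / 2 by ring.
by field.
Qed.

Lemma dstep_ge0 z : 0 <= dstep z.
Proof.
have [->|z0] := eqVneq z 0.
  apply: EX_ge0 => u; rewrite mulr0 cos0 mulr1.
  by have /andP[] := bspl_cl u.
by rewrite dstepE//; apply: divr_ge0; [apply: mulr_ge0; [|exact: sqr_ge0]|exact: exprn_even_ge0].
Qed.

Lemma bmf_dstep_lin a b : bmf (fun u : measurableTypeR R => dstep (a + b * cl u)).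
Proof. by split; [apply: measurable_dstep; meas|exists 1 => u; exact: dstep_norm]. Qed.

Lemma sstep_le a b : a <= b -> sstep a <= sstep b.
Proof.
move=> ab; rewrite -subr_ge0 sstep_diff mulr_ge0 ?subr_ge0//.
by apply: EX_ge0 => u; exact: dstep_ge0.
Qed.

Lemma sstepN z : sstep (- z) = - sstep z.
Proof.
rewrite /sstep -EX_N; last exact/bmf_itg/bmf_sstep.
by congr (EX _ _); apply/funext => u; rewrite sincN mulrN.
Qed.

Lemma sstep0 : sstep 0 = 0.
Proof. by have := sstepN 0; rewrite oppr0 => h; lra. Qed.

Lemma dstep_le z : 0 < z -> dstep z <= 48 / z ^+ 4.
Proof.
move=> z0; rewrite dstepE ?gt_eqF// ler_pM2r ?invr_gt0 ?exprn_gt0//.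
have /andP[h1 h2] : -1 <= cos (z / 2) <= 1 by rewrite cos_geN1 cos_le1.
nra.
Qed.

Lemma sstep_tail a b : 0 < a -> a <= b -> sstep b - sstep a <= 16 / a ^+ 3.
Proof.
move=> a0 ab; rewrite sstep_diff.
have pos u : 0 <= u <= 1 -> a <= a + (b - a) * u.
  by move=> /andP[u0 u1]; rewrite lerDl mulr_ge0// subr_ge0.
have posc u := pos _ (cl01 u).
apply: (@le_trans _ _ (IL 0 1 (fun u => 48 * (b - a) / (a + (b - a) * u) ^+ 4))).
  have bF : bmf (fun u : measurableTypeR R => 48 * (b - a) / (a + (b - a) * cl u) ^+ 4).
    apply: bmfM; first exact: bmf_cst.
    split; first by apply: measurable_finv; [meas|move=> u; rewrite exprn_gt0// (lt_le_trans a0)].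
    exists (a ^+ 4)^-1 => u; have au := posc u.
    have a4 : 0 < a ^+ 4 by rewrite exprn_gt0.
    have h : a ^+ 4 <= (a + (b - a) * cl u) ^+ 4 by rewrite lerXn2r ?nnegrE ?(ltW a0)// (le_trans (ltW a0)).
    by rewrite ger0_norm ?invr_ge0 ?lef_pV2 ?posrE ?(lt_le_trans a4 h)// ltW// (lt_le_trans a4 h).
  rewrite -(@IL_eq _ 0 1 (fun u => 48 * (b - a) / (a + (b - a) * cl u) ^+ 4)); last first.
    by move=> u /andP[u0 u1]; rewrite cl_id// !ltW.
  rewrite -EX_lamE// -EX_Z; last exact/bmf_itg/bmf_dstep_lin.
  apply: EX_le.
  - by apply: bmf_itg; apply: bmfM; [exact: bmf_cst|exact: bmf_dstep_lin].
  - exact: bmf_itg.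
  - move=> u; rewrite mulrAC (mulrC (b - a)) ler_wpM2r ?subr_ge0// dstep_le//.
    by rewrite (lt_le_trans a0).
rewrite (@IL_FTC _ 0 1 (fun u => - 16 / (a + (b - a) * u) ^+ 3) _ ler01).
- rewrite mulr0 mulr1 addr0 subrKC !mulNr opprK gerDr oppr_le0 divr_ge0// exprn_ge0//.
  exact: le_trans (ltW a0) ab.
- move=> x /pos xp; have x0 : a + (b - a) * x != 0 by rewrite gt_eqF// (lt_le_trans a0).
  by eapply deq; [dtac; rewrite expf_neq0|rewrite /=; field].
- move=> x /pos xp; have x0 : a + (b - a) * x != 0 by rewrite gt_eqF// (lt_le_trans a0).
  by eapply dvb; dtac; rewrite expf_neq0.
Qed.

Lemma sstep_ge0 z : 0 <= z -> 0 <= sstep z.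
Proof. by move=> /sstep_le; rewrite sstep0. Qed.

(** Half the total mass of [dstep]. No closed form is computed; [sstep_lim_gt0] supplies the
    positivity by which the smoothing inequality is divided. *)
Definition sstep_lim : R := limn (fun n => sstep n%:R).

Lemma sstep_ub z : sstep z <= sstep 1 + 16.
Proof.
have [z1|z1] := leP z 1; first by rewrite (le_trans (sstep_le z1))// lerDl.
by rewrite -lerBlDl; have := sstep_tail ltr01 (ltW z1); rewrite expr1n divr1.
Qed.

Lemma sstep_cvg : sstep n%:R @[n --> \oo] --> sstep_lim.
Proof.
apply: nondecreasing_is_cvgn; first by move=> m n mn; apply: sstep_le; rewrite ler_nat.
by exists (sstep 1 + 16) => _ [n _ <-]; exact: sstep_ub.
Qed.

Lemma sstep_le_sstep_lim z : sstep z <= sstep_lim.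
Proof.
apply: limr_ge; first exact: cvgP sstep_cvg.
exists (Num.truncn z).+1 => // n /= zn; apply: sstep_le; apply: ltW.
by rewrite (lt_le_trans (truncnS_gt z))// ler_nat.
Qed.

Lemma sstep_lim_le z : 0 < z -> sstep_lim <= sstep z + 16 / z ^+ 3.
Proof.
move=> z0; apply: limr_le; first exact: cvgP sstep_cvg.
exists (Num.truncn z).+1 => // n /= zn; rewrite -lerBlDl sstep_tail//; apply: ltW.
by rewrite (lt_le_trans (truncnS_gt z))// ler_nat.
Qed.

(** On [1/2, 1] one has [1 - cos (z / 2) >= z ^+ 2 / 16], hence [dstep z >= 12 / 256 = 3 / 64]. *)
Lemma sstep_lim_gt0 : 0 < sstep_lim.
Proof.
apply: (@lt_le_trans _ _ (sstep 1)); last exact: sstep_le_sstep_lim.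
have h0 : 0 <= sstep (1 / 2) by apply: sstep_ge0; lra.
apply: (le_lt_trans h0); rewrite -subr_gt0 sstep_diff.
have : 3 / 64 <= EX lam (fun u => dstep (1 / 2 + (1 - 1 / 2) * cl u)).
  rewrite -[leLHS](EX_cst lam); apply: EX_le.
  - exact/bmf_itg/bmf_cst.
  - exact/bmf_itg/bmf_dstep_lin.
  move=> u; have := cl01 u; set z := 1 / 2 + _ => u01.
  have z0 : 0 < z by rewrite /z; lra.
  have z1 : z <= 1 by rewrite /z; lra.
  rewrite dstepE ?gt_eqF// ler_pdivlMr ?exprn_gt0//.
  have h : z ^+ 2 / 16 <= 1 - cos (z / 2).
    have := cos_taylor_le (z / 2); rewrite ler_norml => /andP[_].
    rewrite ger0_norm; last lra.
    have : z ^+ 4 <= z ^+ 2 by rewrite ler_wiXn2l// ltW.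
    rewrite !expr_div_n; lra.
  have : (z ^+ 2 / 16) ^+ 2 <= (1 - cos (z / 2)) ^+ 2.
    by rewrite lerXn2r// ?nnegrE ?(le_trans _ h) ?divr_ge0 ?sqr_ge0.
  by rewrite expr_div_n -exprM; lra.
lra.
Qed.

(** The value 1 at 0 makes [sgn (x - X)] match the closed event [X <= x]. *)
Definition sgn z : R := if 0 <= z then 1 else -1.

(** The Fejer kernel [(1 - cos z) / z ^+ 2]: nonnegative, of size [z ^- 2] away from its zeros, and
    with a transform supported in the unit band, so its mean only sees frequencies up to 1. *)
Definition fejer z : R := EX lam (fun u => (1 - cl u) * cos (cl u * z)).

Lemma bmf_fejer z : bmf (fun u : measurableTypeR R => (1 - cl u) * cos (cl u * z)).
Proof.
split; first by meas.
exists 1 => u; rewrite normrM mulr_ile1 ?cos_max//.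
exact: onem_cl.
Qed.

Lemma measurable_fejer d (T : measurableType d) (f : T -> R) : measurable_fun setT f ->
  measurable_fun setT (fun x => fejer (f x)).
Proof.
move=> mf; have := @measurable_EX _ _ _ _ _ lam (fun xu : T * measurableTypeR R =>
  (1 - cl xu.2) * cos (cl xu.2 * f xu.1)).
apply; apply: measurable_funM; first by meas.
apply: measurable_fcos; apply: measurable_funM; first by meas.
by apply: (measurableT_comp mf); exact: measurable_fst.
Qed.

Lemma fejer_norm z : `|fejer z| <= 1.
Proof.
apply: EX_norm_le => [|u]; first exact: bmf_fejer.
by rewrite normrM mulr_ile1 ?cos_max// onem_cl.
Qed.

Lemma fejerE z : z != 0 -> fejer z = (1 - cos z) / z ^+ 2.
Proof.
move=> z0; rewrite /fejer (@EX_lam_cl _ (fun s => (1 - s) * cos (s * z))); last 2 first.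
- meas.
- by exists 1 => s s01; rewrite normrM mulr_ile1 ?cos_max//; rewrite ger0_norm; lra.
rewrite (@IL_FTC _ 0 1 (fun s => (1 - s) * sin (s * z) / z - cos (s * z) / z ^+ 2))//.
- by rewrite !mul0r !mul1r cos0 sin0; field.
- by move=> x _; eapply deq; [dtac|rewrite /=; field].
Qed.

Lemma EX_lam_onem : EX lam (fun u => 1 - cl u) = 1 / 2.
Proof.
rewrite (@EX_lam_cl _ (fun s => 1 - s)); last 2 first.
- meas.
- by exists 1 => s s01; rewrite ger0_norm; lra.
rewrite (@IL_FTC _ 0 1 (fun s => s - s ^+ 2 / 2))//.
- by rewrite expr1n expr0n/=; field.
- by move=> x _; eapply deq; [dtac|rewrite /=; field].
Qed.

Lemma fejer_small z : `|z| <= 1 / 2 -> 1 / 4 <= fejer z.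
Proof.
move=> z12; apply: (@le_trans _ _ (EX lam (fun u => 3 / 4 * (1 - cl u)))).
  have bo : bmf (fun u : measurableTypeR R => 1 - cl u).
    by split; [meas|exists 1 => u; exact: onem_cl].
  rewrite EX_Z; last exact: bmf_itg.
  rewrite EX_lam_onem; lra.
apply: EX_le.
- apply: bmf_itg; apply: bmfM; first exact: bmf_cst.
  by split; [meas|exists 1 => u; exact: onem_cl].
- exact/bmf_itg/bmf_fejer.
move=> u; rewrite mulrC ler_wpM2l//; first by have := cl01 u; lra.
have := cos_sub1_le (cl u * z); rewrite ler_norml => /andP[h _].
have : (cl u * z) ^+ 2 <= (1 / 2) ^+ 2.
  rewrite -(real_normK (num_real (cl u * z))) lerXn2r ?nnegrE//.
  by rewrite normrM (le_trans _ z12)// ler_piMl// ger0_norm ?cl_ge0 ?cl_le1.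
by rewrite expr_div_n expr1n; lra.
Qed.

Lemma fejer_ge0 z : 0 <= fejer z.
Proof.
have [->|z0] := eqVneq z 0.
  by rewrite (le_trans _ (fejer_small _))// ?normr0; lra.
by rewrite fejerE// divr_ge0 ?sqr_ge0// subr_ge0 cos_le1.
Qed.

Lemma pi_le4 : pi <= 4 :> R.
Proof. by have := pihalf_lt2 R; lra. Qed.

(* The translate by pi compensates the zeros of fejer. *)
Lemma fejer_large z : 1 / 2 <= `|z| -> 2 / (81 * z ^+ 2) <= fejer z + fejer (z - pi).
Proof.
move=> z12.
have z0 : z != 0 by rewrite -normr_gt0; lra.
have z2 : 0 < z ^+ 2 by rewrite exprn_even_gt0.
have p0 := pi_gt0 R; have p4 := pi_le4.
have [zp|zp] := eqVneq z pi.
  rewrite (le_trans _ (_ : fejer z <= _))//; last by rewrite lerDl fejer_ge0.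
  rewrite fejerE// zp cospi ler_pdivlMr; last by rewrite -zp.
  have -> : 2 / (81 * pi ^+ 2) * pi ^+ 2 = 2 / 81 :> R.
    by rewrite -zp; field.
  lra.
rewrite fejerE// fejerE ?subr_eq0// cosB cospi sinpi mulr0 addr0 mulrN1 opprK.
have h : (z - pi) ^+ 2 <= 81 * z ^+ 2.
  rewrite -(real_normK (num_real (z - pi))) -(real_normK (num_real z)).
  have : `|z - pi| <= 9 * `|z|.
    by rewrite (le_trans (ler_normB _ _))// (ger0_norm (ltW p0)); lra.
  move=> hh; have -> : 81 * `|z| ^+ 2 = (9 * `|z|) ^+ 2 by ring.
  by rewrite lerXn2r ?nnegrE// mulr_ge0.
have zp2 : 0 < (z - pi) ^+ 2 by rewrite exprn_even_gt0//= subr_eq0.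
have /andP[h1 h2] : -1 <= cos z <= 1 by rewrite cos_geN1 cos_le1.
have -> : 2 / (81 * z ^+ 2) = (1 - cos z) / (81 * z ^+ 2) + (1 + cos z) / (81 * z ^+ 2) by ring.
have z81 : 0 < 81 * z ^+ 2 by lra.
have z82 : z ^+ 2 <= 81 * z ^+ 2 by lra.
by apply: lerD; (apply: ler_wpM2l; first lra); rewrite lef_pV2 ?posrE.
Qed.

(** For [|z| <= 1 / 2] the error is at most [sstep_lim] while [fejer] is at least 1/4. For larger
    [|z|] the error [16 / |z| ^+ 3] is at most [32 / z ^+ 2], and [32 = 1296 * 2 / 81] with the
    bound of [fejer_large]. *)
Definition sgn_cst : R := 4 * sstep_lim + 1296.

Lemma sgn_cst_gt0 : 0 < sgn_cst.
Proof. by have := sstep_lim_gt0; rewrite /sgn_cst; lra. Qed.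

Lemma sgn_approx z : `|sstep_lim * sgn z - sstep z| <= sgn_cst * (fejer z + fejer (z - pi)).
Proof.
rewrite /sgn_cst.
have c0 := sstep_lim_gt0.
have f0 := fejer_ge0 z; have f1 := fejer_ge0 (z - pi).
have abs0 : `|sstep_lim * sgn z - sstep z| = sstep_lim - sstep `|z|.
  rewrite /sgn; case: leP => z0.
    by rewrite mulr1 (ger0_norm z0) ger0_norm// subr_ge0 sstep_le_sstep_lim.
  rewrite mulrN1 (ltr0_norm z0) sstepN ler0_norm; first by rewrite opprB !opprK addrC.
  by have := sstep_le_sstep_lim (- z); rewrite sstepN; lra.
rewrite abs0; have [z12|z12] := leP `|z| (1 / 2).
  have := fejer_small z12; have : 0 <= sstep `|z| by exact: sstep_ge0.
  move=> h1 h2; apply: (@le_trans _ _ (4 * sstep_lim * fejer z)); first by nra.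
  by rewrite ler_pM//; lra.
have zp : 0 < `|z| by lra.
have h := fejer_large (ltW z12); have h2 := sstep_lim_le zp.
apply: (@le_trans _ _ (1296 * (fejer z + fejer (z - pi)))); last by nra.
apply: (@le_trans _ _ (1296 * (2 / (81 * z ^+ 2)))); last by lra.
rewrite -(real_normK (num_real z)).
apply: (@le_trans _ _ (16 / `|z| ^+ 3)); first by lra.
have -> : 1296 * (2 / (81 * `|z| ^+ 2)) = 32 * `|z| / `|z| ^+ 3 :> R.
  by field; rewrite gt_eqF.
by rewrite ler_pM2r ?invr_gt0 ?exprn_gt0//; lra.
Qed.

(** Comparison on the open interval: the hypothesis on the difference of characteristic functions in
    [smoothing] concerns positive frequencies. *)
Lemma EX_lam_le (f g : measurableTypeR R -> R) : bmf f -> bmf g ->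
  (forall u : R, 0 < u < 1 -> f u <= g u) -> EX lam f <= EX lam g.
Proof.
move=> bf bg fg; rewrite !EX_lamE//; apply: le_Rintegral => //.
- by have [mf [M fM]] := bf; apply: itv_itg => //; exists M.
- by have [mf [M fM]] := bg; apply: itv_itg => //; exists M.
Qed.

Lemma cos_sub_pihalf (y : R) : cos (pi / 2 - y) = sin y.
Proof. by rewrite cosB cos_pihalf sin_pihalf mul0r mul1r add0r. Qed.

Section expectations.
Context d (T : measurableType d) (P : probability T R) (X : T -> R).
Hypothesis mX : measurable_fun setT X.
Hypothesis iX : P.-integrable setT (EFin \o X).
Variable x : R.

Lemma m_subX : measurable_fun setT (fun w => x - X w).
Proof. exact: measurable_funB. Qed.

Lemma mX_le : measurable [set w | X w <= x].
Proof.
by rewrite -[X in measurable X]setTI; apply: (measurable_fun_ler mX) => //; exact: measurable_cst.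
Qed.

Lemma sgn_indic w : sgn (x - X w) = 2 * \1_[set w | X w <= x] w - 1.
Proof.
rewrite /sgn subr_ge0 indicE; case: leP => h.
  by rewrite mem_set//= mulr1; lra.
by rewrite memNset ?mulr0 ?add0r//= => /le_lt_trans /(_ h); rewrite ltxx.
Qed.

Lemma bmf_sgn : bmf (fun w => sgn (x - X w)).
Proof.
apply: (eq_bmf (fun w => esym (sgn_indic w))); apply: bmfB; last exact: bmf_cst.
by apply: bmfM; [exact: bmf_cst|apply: bmf_indic; exact: mX_le].
Qed.

Lemma EX_sgn : EX P (fun w => sgn (x - X w)) = 2 * fine (P [set w | X w <= x]) - 1.
Proof.
have bi : bmf (\1_[set w | X w <= x] : T -> R) by apply: bmf_indic; exact: mX_le.
rewrite -(EX_indic P (mX_le)) -EX_Z; last exact: bmf_itg.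
rewrite -[X in _ = _ - X](EX_cst P) -EX_B.
- by congr (EX _ _); apply/funext => w; exact: sgn_indic.
- by apply: bmf_itg; apply: bmfM => //; exact: bmf_cst.
- exact/bmf_itg/bmf_cst.
Qed.

Lemma bmf_sstepX : bmf (fun w => sstep (x - X w)).
Proof.
split; first exact/measurable_sstep/m_subX.
exists sstep_lim => w; rewrite ler_norml sstep_le_sstep_lim andbT lerNl -sstepN; exact: sstep_le_sstep_lim.
Qed.

Lemma bmf_fejerX : bmf (fun w => fejer (x - X w)).
Proof. by split; [exact/measurable_fejer/m_subX|exists 1 => w; exact: fejer_norm]. Qed.

Lemma bmf_cosX s (th : R) : bmf (fun w => cos (s * X w + th)).
Proof. by split; [meas|exists 1 => w; exact: cos_max]. Qed.

Lemma itg_subX : P.-integrable setT (EFin \o (fun w => x - X w)).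
Proof.
have h : P.-integrable setT (EFin \o (fun _ : T => x)) by exact/bmf_itg/bmf_cst.
exact: (integrableB measurableT h iX).
Qed.

Lemma itg_sincX s : P.-integrable setT (EFin \o (fun w => sinc s (x - X w))).
Proof.
apply: (@le_integrable _ _ _ P setT _ _ (EFin \o (fun w => x - X w))) => //.
- by apply/measurable_EFinP; apply: measurable_sinc; [exact: measurable_cst|exact: m_subX].
- by move=> w _; rewrite /= lee_fin sinc_norm.
- exact: itg_subX.
Qed.

(** The integrand is dominated by [|x - X|], uniformly in the frequency; this is where integrability
    of [X] allows Fubini. *)
Lemma EX_sstepX : EX P (fun w => sstep (x - X w)) =
  EX lam (fun u => bspl (cl u) * EX P (fun w => sinc (cl u) (x - X w))).
Proof.
pose F (wu : T * measurableTypeR R) : R := bspl (cl wu.2) * sinc (cl wu.2) (x - X wu.1).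
have mF : measurable_fun setT F.
  apply: measurable_funM; first by apply: measurable_bspl; meas.
  apply: measurable_sinc; first by meas.
  by apply: (measurableT_comp m_subX); exact: measurable_fst.
have Fle w u : `|F (w, u)| <= `|x - X w|.
  rewrite /F/= normrM (le_trans _ (sinc_norm (cl u) _))// ler_piMl//.
  by have /andP[h0 h1] := bspl_cl u; rewrite ger0_norm.
have iF : (P \x lam)%E.-integrable setT (EFin \o F).
  apply/integrable12ltyP; first exact/measurable_EFinP.
  have /integrableP[_ h] := itg_subX.
  apply: (le_lt_trans _ h); apply: ge0_le_integral => //.
  - by move=> w _; apply: integral_ge0.
  - apply: (measurable_fun_fubini_tonelli_F (m2 := lam) (fun wu => (`|F wu|)%:E)) => //.
    by apply/measurable_EFinP; exact: measurableT_comp.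
  - by apply/measurable_EFinP; apply: measurableT_comp => //; exact: m_subX.
  move=> w _; rewrite -[leRHS]mule1 -(probability_setT lam) -integral_cst//.
  apply: ge0_le_integral => //.
  - apply/measurable_EFinP; apply: measurableT_comp => //.
    by apply: (measurableT_comp mF); exact: measurable_pair1.
  - by move=> u _; rewrite lee_fin.
have E := EX_fubini_itg iF.
transitivity (EX lam (fun u => EX P (fun w => F (w, u)))).
  apply: E.
  - by move=> w; apply: bmf_itg; exact: (bmf_sstep (x - X w)).
  - move=> u; apply: (@le_integrable _ _ _ P setT _ _ (EFin \o (fun w => x - X w))) => //.
    + by apply/measurable_EFinP; apply: (measurableT_comp mF); exact: measurable_pair2.
    + by move=> w _; rewrite /= lee_fin Fle.
    + exact: itg_subX.
by congr (EX _ _); apply/funext => u; rewrite -EX_Z//; exact: itg_sincX.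
Qed.

Lemma EX_fejerX : EX P (fun w => fejer (x - X w)) =
  EX lam (fun u => (1 - cl u) * EX P (fun w => cos (cl u * X w - cl u * x))).
Proof.
have bF : bmf (fun wu : T * measurableTypeR R => (1 - cl wu.2) * cos (cl wu.2 * (x - X wu.1))).
  split; last first.
    by exists 1 => u; rewrite normrM mulr_ile1 ?cos_max// onem_cl.
  apply: measurable_funM; first by meas.
  apply: measurable_fcos; apply: measurable_funM; first by meas.
  by apply: (measurableT_comp m_subX); exact: measurable_fst.
transitivity (EX lam (fun u => EX P (fun w => (1 - cl u) * cos (cl u * (x - X w))))).
  exact: (EX_fubini P lam bF).
congr (EX _ _); apply/funext => u; rewrite -EX_Z; last exact/bmf_itg/bmf_cosX.
congr (EX _ _); apply/funext => w; congr (_ * _); rewrite -cosN; congr cos; ring.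
Qed.

(** A sine is a cosine with phase shifted by [pi / 2]. Cosines with an arbitrary phase [th] thus
    stand for the full complex characteristic function in [smoothing]. *)
Lemma EX_sincX s : s != 0 ->
  EX P (fun w => sinc s (x - X w)) = EX P (fun w => cos (s * X w + (pi / 2 - s * x))) / s.
Proof.
move=> s0; rewrite mulrC -EX_Z; last exact/bmf_itg/bmf_cosX.
congr (EX _ _); apply/funext => w; rewrite sincE// mulrC; congr (_ * _).
by rewrite -cos_sub_pihalf; congr cos; ring.
Qed.

Lemma bmf_EX_sincX : bmf (fun u : measurableTypeR R => bspl (cl u) * EX P (fun w => sinc (cl u) (x - X w))).
Proof.
split.
  apply: measurable_funM; first by apply: measurable_bspl; meas.
  have := @measurable_EX _ _ _ _ _ P (fun uw : measurableTypeR R * T => sinc (cl uw.1) (x - X uw.2)).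
  apply; apply: measurable_sinc; first by meas.
  by apply: (measurableT_comp m_subX); exact: measurable_snd.
exists (EX P (fun w => `|x - X w|)) => u; rewrite normrM.
apply: (@le_trans _ _ `|EX P (fun w => sinc (cl u) (x - X w))|).
  by have /andP[h0 h1] := bspl_cl u; rewrite ler_piMl// ger0_norm.
rewrite (le_trans (EX_norm (itg_sincX _)))//; apply: EX_le.
- exact/itg_norm/itg_sincX.
- exact/itg_norm/itg_subX.
- by move=> w; exact: sinc_norm.
Qed.

Lemma bmf_EX_cosX : bmf (fun u : measurableTypeR R =>
  (1 - cl u) * EX P (fun w => cos (cl u * X w - cl u * x))).
Proof.
split.
  apply: measurable_funM; first by meas.
  have := @measurable_EX _ _ _ _ _ P (fun uw : measurableTypeR R * T => cos (cl uw.1 * X uw.2 - cl uw.1 * x)).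
  apply; apply: measurable_fcos; apply: measurable_funB; last by meas.
  apply: measurable_funM; first by meas.
  by apply: (measurableT_comp mX); exact: measurable_snd.
exists 1 => u; rewrite normrM mulr_ile1 ?onem_cl//.
by apply: EX_norm_le => [|w]; [exact: bmf_cosX|exact: cos_max].
Qed.

Lemma EX_fejerX_le (A : R -> R) : bmf (fun u : measurableTypeR R => A (cl u)) ->
  (forall s (th : R), 0 <= s <= 1 -> `|EX P (fun w => cos (s * X w + th))| <= A s) ->
  EX P (fun w => fejer (x - X w)) <= EX lam (fun u => A (cl u)).
Proof.
move=> bA hA; rewrite EX_fejerX; apply: EX_le.
- exact/bmf_itg/bmf_EX_cosX.
- exact: bmf_itg.
move=> u; rewrite (le_trans (ler_norm _))// normrM.
rewrite (le_trans _ (hA (cl u) (- (cl u * x)) (cl01 u)))// ler_piMl//; exact: onem_cl.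
Qed.
End expectations.

(** By [sgn_approx], replacing the indicator costs a mean of Fejer kernels at [x] and at [x - pi];
    each is an average of characteristic functions over frequencies in [0, 1], bounded there by
    [A]. *)
Lemma sstep_smoothing d (T : measurableType d) (P : probability T R) (X : T -> R)
    (A : R -> R) (x : R) :
  measurable_fun setT X -> bmf (fun u : measurableTypeR R => A (cl u)) ->
  (forall s (th : R), 0 <= s <= 1 -> `|EX P (fun w => cos (s * X w + th))| <= A s) ->
  `|sstep_lim * (2 * fine (P [set w | X w <= x]) - 1) - EX P (fun w => sstep (x - X w))| <=
  sgn_cst * 2 * EX lam (fun u => A (cl u)).
Proof.
move=> mX bA hA; have c0 := sstep_lim_gt0.
have bs := bmf_sgn mX x; have bS := bmf_sstepX mX x.
rewrite -(EX_sgn P mX x) -EX_Z; last exact: bmf_itg.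
have bs' : bmf (fun w => sstep_lim * sgn (x - X w)) by apply: bmfM => //; exact: bmf_cst.
rewrite -EX_B; [|exact: bmf_itg..].
rewrite (le_trans (EX_norm (bmf_itg _ (bmfB bs' bS))))//.
have bf := bmf_fejerX mX x; have bf' := bmf_fejerX mX (x - pi).
apply: (@le_trans _ _ (EX P (fun w => sgn_cst * (fejer (x - X w) + fejer (x - pi - X w))))).
  apply: EX_le.
  - by apply: bmf_itg; apply: bmf_norm; exact: bmfB.
  - by apply: bmf_itg; apply: bmfM; [exact: bmf_cst|exact: bmfD].
  by move=> w; rewrite (addrAC x) sgn_approx.
rewrite EX_Z; last exact/bmf_itg/bmfD.
rewrite -mulrA ler_wpM2l; [by []|exact: ltW sgn_cst_gt0|].
rewrite EX_D; [|exact: bmf_itg..].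
by rewrite mulr_natl mulr2n; apply: lerD; exact: EX_fejerX_le.
Qed.

(* Only s in [0, 1] matters, since both bspl and the Fejer weight 1 - s live there. *)
Lemma smoothing d1 (T1 : measurableType d1) (P1 : probability T1 R) (X1 : T1 -> R)
    d2 (T2 : measurableType d2) (P2 : probability T2 R) (X2 : T2 -> R) (A D : R -> R) (x : R) :
  measurable_fun setT X1 -> P1.-integrable setT (EFin \o X1) ->
  measurable_fun setT X2 -> P2.-integrable setT (EFin \o X2) ->
  bmf (fun u : measurableTypeR R => A (cl u)) ->
  bmf (fun u : measurableTypeR R => D (cl u)) ->
  (forall s (th : R), 0 <= s <= 1 -> `|EX P1 (fun w => cos (s * X1 w + th))| <= A s) ->
  (forall s (th : R), 0 <= s <= 1 -> `|EX P2 (fun w => cos (s * X2 w + th))| <= A s) ->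
  (forall s (th : R), 0 < s <= 1 -> `|EX P1 (fun w => cos (s * X1 w + th)) -
     EX P2 (fun w => cos (s * X2 w + th))| <= s * D s) ->
  2 * sstep_lim * `|fine (P1 [set w | X1 w <= x]) - fine (P2 [set w | X2 w <= x])| <=
  sgn_cst * 4 * EX lam (fun u => A (cl u)) + EX lam (fun u => D (cl u)).
Proof.
move=> m1 i1 m2 i2 bA bD h1 h2 hD; have c0 := sstep_lim_gt0.
have k1 := sstep_smoothing x m1 bA h1; have k2 := sstep_smoothing x m2 bA h2.
have k3 : `|EX P1 (fun w => sstep (x - X1 w)) - EX P2 (fun w => sstep (x - X2 w))| <=
    EX lam (fun u => D (cl u)).
  have b1 := bmf_EX_sincX m1 i1 x; have b2 := bmf_EX_sincX m2 i2 x.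
  rewrite !EX_sstepX// -EX_B; [|exact: bmf_itg..].
  rewrite (le_trans (EX_norm (bmf_itg _ (bmfB b1 b2))))//.
  apply: EX_lam_le => //; first by apply: bmf_norm; exact: bmfB.
  move=> u u01; have cu : cl u = u by apply: cl_id; move: u01; lra.
  have u0 : u != 0 by rewrite gt_eqF//; move: u01; lra.
  rewrite cu -mulrBr normrM (@le_trans _ _ `|EX P1 (fun w => sinc u (x - X1 w)) - EX P2 (fun w => sinc u (x - X2 w))|)//.
    by rewrite ler_piMl//; have := bspl_cl u; rewrite cu => /andP[h0 h1']; rewrite ger0_norm.
  rewrite !EX_sincX// -mulrBl normrM normfV ler_pdivrMr ?normr_gt0//.
  have up : 0 < u by move: u01; lra.
  rewrite [leRHS]mulrC (ger0_norm (ltW up)); apply: hD; move: u01; lra.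
move: k1 k2 k3.
set p1 := fine _; set p2 := fine _; set a := EX lam _; set b := EX lam _.
set e1 := EX P1 _; set e2 := EX P2 _ => k1 k2 k3.
have -> : 2 * sstep_lim * `|p1 - p2| = `|sstep_lim * (2 * p1 - 1) - sstep_lim * (2 * p2 - 1)|.
  have -> : sstep_lim * (2 * p1 - 1) - sstep_lim * (2 * p2 - 1) = (2 * sstep_lim) * (p1 - p2) by ring.
  by rewrite normrM (@ger0_norm _ (2 * sstep_lim))//; lra.
have -> : sstep_lim * (2 * p1 - 1) - sstep_lim * (2 * p2 - 1) =
  (sstep_lim * (2 * p1 - 1) - e1) - (sstep_lim * (2 * p2 - 1) - e2) + (e1 - e2) by ring.
rewrite (le_trans (ler_normD _ _))//.
have := ler_normB (sstep_lim * (2 * p1 - 1) - e1) (sstep_lim * (2 * p2 - 1) - e2).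
lra.
Qed.
End kernel.

(** * The normal characteristic function *)

Section normal.
Variable R : realType.
Implicit Types a s th x : R.
Local Notation mu := (@lebesgue_measure R).

Definition gaussP : probability (measurableTypeR R) R := normal_prob 0 1.

Definition gpdf (x : R) : R := normal_pdf 0 1 x.

Lemma gpdfE x : gpdf x = normal_peak 1 * expR (- (x ^+ 2 / 2)).
Proof.
rewrite /gpdf normal_pdfE ?oner_neq0// /normal_fun subr0 expr1n mulNr.
by [].
Qed.

Lemma measurable_gpdf : measurable_fun setT gpdf. Proof. exact: measurable_normal_pdf. Qed.

Lemma gpdf_ge0 x : 0 <= gpdf x. Proof. exact: normal_pdf_ge0. Qed.

Lemma normal_integral_ge0 (U : set R) (f : R -> \bar R) : measurable U ->
  measurable_fun U f -> (forall x, 0 <= f x)%E ->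
  (\int[gaussP]_(x in U) f x = \int[mu]_(x in U) (f x * (gpdf x)%:E))%E.
Proof.
move=> mU mf f0.
have dom : (gaussP : set (measurableTypeR R) -> \bar R) `<< mu by exact: normal_prob_dominates.
rewrite -(Radon_Nikodym_SigmaFinite.change_of_variables dom)//=.
have iRN := Radon_Nikodym_SigmaFinite.f_integrable dom.
apply: ae_eq_integral => //.
- apply: emeasurable_funM => //; apply: (measurable_int mu).
  by apply: (integrableS _ _ (@subsetT _ _)) => //=.
- apply: emeasurable_funM => //; apply/measurable_EFinP.
  by apply/measurable_funTS; exact: measurable_gpdf.
- apply: ae_eqe_mul2l; apply: integral_ae_eq => //=.
  + exact: integrableS iRN.
  + by apply/measurable_EFinP; apply/measurable_funTS; exact: measurable_gpdf.
  + by move=> E E01 mE; rewrite -Radon_Nikodym_SigmaFinite.f_integral.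
Qed.

Lemma maxe0M (y g : \bar R) : (0 <= g)%E -> (maxe y 0 * g = maxe (y * g) 0)%E.
Proof.
move=> g0; have [h|h] := leP y 0%E; first by rewrite mul0e max_r// mule_le0_ge0.
by rewrite max_l// mule_ge0// ltW.
Qed.

Lemma normal_integral (U : set R) (f : R -> \bar R) : measurable U ->
  gaussP.-integrable U f ->
  (\int[gaussP]_(x in U) f x = \int[mu]_(x in U) (f x * (gpdf x)%:E))%E.
Proof.
move=> mU /integrableP[mf _]; rewrite integralE [RHS]integralE.
rewrite !normal_integral_ge0//.
- congr (_ - _)%E; apply: eq_integral => x _.
    by rewrite !funeposE/= maxe0M// lee_fin gpdf_ge0.
  by rewrite !funenegE/= -mulNe maxe0M// lee_fin gpdf_ge0.
- exact: measurable_funeneg.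
- exact: measurable_funepos.
Qed.

Lemma itg_id : gaussP.-integrable setT (EFin \o (fun x : R => x)).
Proof.
apply/integrableP; split; first by apply/measurable_EFinP; exact: measurable_id.
rewrite normal_integral_ge0//; last first.
  by apply: measurableT_comp => //; apply/measurable_EFinP; exact: measurable_id.
(* Since [|x| <= expR (x ^+ 2 / 4)], the integrand is dominated by a multiple of the normal density
   of variance 2. *)
pose s2 : R := Num.sqrt 2.
have s20 : s2 != 0 by rewrite gt_eqF// sqrtr_gt0.
have pk0 : 0 < normal_peak s2 by exact: normal_peak_gt0.
pose c := normal_peak 1 / normal_peak s2.
have : (mu.-integrable setT (fun x => c%:E * (normal_pdf 0 s2 x)%:E))%E.
  by apply: integrableZl => //; exact: integrable_normal_pdf.
move=> /integrableP[_]; apply: le_lt_trans; apply: ge0_le_integral => //.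
- by move=> x _; rewrite mule_ge0 ?lee_fin ?gpdf_ge0.
- apply/measurable_EFinP; apply: measurable_funM; last exact: measurable_gpdf.
  exact: normr_measurable.
- apply: measurableT_comp => //; apply/measurable_EFinP; apply: measurable_funM => //.
  exact: measurable_normal_pdf.
move=> x _ /=; rewrite -!EFinM lee_fin gpdfE normal_pdfE// (le_trans _ (ler_norm _))//.
rewrite /normal_fun subr0 sqr_sqrtr// /c.
have -> : normal_peak 1 / normal_peak s2 * (normal_peak s2 * expR (- x ^+ 2 / (2 *+ 2))) =
   normal_peak 1 * expR (- x ^+ 2 / (2 *+ 2)) :> R by field; rewrite gt_eqF.
rewrite mulrCA ler_wpM2l ?normal_peak_ge0//.
have -> : expR (- (x ^+ 2 / 2)) = expR (- x ^+ 2 / (2 *+ 2)) / expR (x ^+ 2 / 4) :> R.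
  by rewrite -expRN -expRD; congr expR; field.
rewrite mulrA ler_pdivrMr ?expR_gt0// mulrC ler_pM2l ?expR_gt0//.
apply: le_trans (expR_ge1Dx _).
by have := sqr_ge0 (`|x| / 2 - 1); rewrite sqrrB expr_div_n real_normK ?num_real// expr1n; lra.
Qed.

Lemma EX_normal_itv a b (f : R -> R) : measurable_fun setT f ->
  gaussP.-integrable setT (EFin \o f) ->
  EX gaussP (fun x => f x * \1_`]a, b[ x) = IL a b (fun x => f x * gpdf x).
Proof.
move=> mf iF; rewrite /EX /IL /Rintegral; congr fine.
transitivity (\int[gaussP]_(x in `]a, b[) (f x)%:E)%E.
  rewrite [RHS]integral_mkcond; apply: eq_integral => x _.
  rewrite patchE indicE; case: ifP => _; first by rewrite mulr1.
  by rewrite mulr0.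
have iU : gaussP.-integrable `]a, b[ (EFin \o f) by exact: integrableS iF.
have := @normal_integral `]a, b[%classic (EFin \o f) _ iU.
by move=> ->//.
Qed.

Lemma gauss_cvg0 : expR (- (n%:R ^+ 2)) @[n --> \oo] --> (0 : R).
Proof. exact: (cvg_comp _ _ (@cvgr_idn R) (@cvg_gauss_fun R)). Qed.

Lemma itv_indic_cvg (f : R -> R) (b : R) x : 0 < b ->
  f x * \1_`]- (b * n%:R), (b * n%:R)[ x @[n --> \oo] --> f x.
Proof.
move=> b0; apply: cvg_near_cst; exists (Num.truncn (`|x| / b)).+1 => // n /= xn.
have : `|x| < b * n%:R.
  rewrite mulrC -ltr_pdivrMr// (lt_le_trans (truncnS_gt _))// ler_nat//.
by rewrite ltr_norml => h; rewrite indicE mem_set/= ?in_itv ?mulr1.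
Qed.

(** Stein's identity for the sine: the difference of the two integrands, times the density, is the
    derivative of [- sin (a * x + th)] times the density, so only boundary terms remain. *)
Lemma stein a th : EX gaussP (fun x => x * sin (a * x + th)) = a * EX gaussP (fun x => cos (a * x + th)).
Proof.
have msin : measurable_fun setT (fun x : R => sin (a * x + th)).
  apply: (measurableT_comp (f := @sin R)); first by apply: continuous_measurable_fun; exact: continuous_sin.
  by meas.
have mcs : measurable_fun setT (fun x : R => cos (a * x + th)) by meas.
have ic : gaussP.-integrable setT (EFin \o (fun x : R => cos (a * x + th))).
  by apply: bmf_itg; split => //; exists 1 => x; exact: cos_max.
have is' : gaussP.-integrable setT (EFin \o (fun x : R => x * sin (a * x + th))).
  apply: (le_integrable _ _ _ itg_id) => //.
    by apply/measurable_EFinP; exact: measurable_funM.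
  by move=> x _; rewrite /= lee_fin normrM ler_piMr// sin_max.
pose h x := x * sin (a * x + th) - a * cos (a * x + th).
have mh : measurable_fun setT h by apply: measurable_funB; apply: measurable_funM.
have iac : gaussP.-integrable setT (EFin \o (fun x : R => a * cos (a * x + th))).
  by apply: bmf_itg; apply: bmfM; [exact: bmf_cst|split => //; exists 1 => x; exact: cos_max].
have ih : gaussP.-integrable setT (EFin \o h) by exact: (integrableB measurableT is' iac).
suff : EX gaussP h = 0 by rewrite /h EX_B// EX_Z// => /subr0_eq.
(* Truncating at [r * n] turns the boundary factor [expR (- (x ^+ 2 / 2))] into
   [expR (- n ^+ 2)]. *)
pose r : R := Num.sqrt 2; have r0 : 0 < r by rewrite sqrtr_gt0.
have c1 : EX gaussP (fun x => h x * \1_`]- (r * n%:R), (r * n%:R)[ x) @[n --> \oo] --> EX gaussP h.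
  apply: (@EX_cvg_dom _ _ _ gaussP (fun n x => h x * \1_`]- (r * n%:R), (r * n%:R)[ x) h (fun x => `|h x|)).
  - move=> n; apply: measurable_funM => //; exact: measurable_indic.
  - exact: itg_norm.
  - move=> n x; rewrite normrM ler_piMr// indicE; case: (_ \in _) => /=; by rewrite ?normr1 ?normr0.
  - by move=> x; exact: itv_indic_cvg.
have c2 : EX gaussP (fun x => h x * \1_`]- (r * n%:R), (r * n%:R)[ x) @[n --> \oo] --> 0.
  pose e (n : nat) : R := normal_peak 1 * expR (- n%:R ^+ 2) * 2.
  have ce : e n @[n --> \oo] --> 0.
    have -> : 0 = normal_peak 1 * 0 * 2 :> R by ring.
    by apply: cvgM; [apply: cvgM; [exact: cvg_cst|exact: gauss_cvg0]|exact: cvg_cst].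
  apply/norm_cvg0P; apply: (squeeze_cvgr _ _ ce); last exact: cvg_cst.
  apply: nearW => n; rewrite normr_ge0/= EX_normal_itv//.
  have ab : - (r * n%:R) <= r * n%:R by rewrite -subr_ge0 opprK addr_ge0// mulr_ge0// ltW.
  rewrite (@IL_eq _ _ _ _ (fun x => normal_peak 1 * (h x * expR (- (x ^+ 2 / 2))))); last first.
    by move=> x _; rewrite gpdfE mulrCA.
  rewrite (@IL_FTC _ _ _ (fun x => normal_peak 1 * (- sin (a * x + th) * expR (- (x ^+ 2 / 2)))) _ ab).
  - rewrite sqrrN exprMn sqr_sqrtr//.
    have -> : 2 * n%:R ^+ 2 / 2 = n%:R ^+ 2 :> R by field.
    rewrite -mulrBr -mulrBl !normrM (ger0_norm (normal_peak_ge0 _)) (ger0_norm (expR_ge0 _)).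
    rewrite /e -mulrA ler_wpM2l ?normal_peak_ge0// mulrC ler_wpM2l ?expR_ge0//.
    rewrite (le_trans (ler_normB _ _))// !normrN.
    have := sin_max (a * - (r * n%:R) + th); have := sin_max (a * (r * n%:R) + th); lra.
  - by move=> x _; rewrite /h; eapply deq; [dtac|rewrite /=; field].
  - by move=> x _; rewrite /h; eapply dvb; dtac.
exact: (cvg_unique _ c1 c2).
Qed.

Lemma d_normal_cos a th :
  isd (fun b => EX gaussP (fun x => cos (b * x + th))) a (- (a * EX gaussP (fun x => cos (a * x + th)))).
Proof.
have dE b x : ((fun b => cos (b * x + th))^`() b = - (x * sin (b * x + th)))%classic.
  rewrite derive1E; apply: derive_val.
  by eapply deq; [dtac|rewrite /=; ring].
have Ia : `]a - 1, a + 1[%classic a by rewrite /= in_itv/=; lra.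
have itf x : gaussP.-integrable setT (EFin \o (fun y : R => cos (x * y + th))).
  by apply: bmf_itg; split; [meas|exists 1 => y; exact: cos_max].
have df x (y : R) : derivable (fun b : R => cos (b * y + th) : R) x 1 by eapply dvb; dtac.
have iG : gaussP.-integrable setT (EFin \o (fun x : R => `|x|)) by exact: itg_norm itg_id.
have ub x (y : R) : `|partial1of2 (fun b y => cos (b * y + th)) x y| <= `|y|.
  by rewrite /partial1of2 dE normrN normrM ler_piMr// sin_max.
have D := @derivable_under_integral R _ _ gaussP (fun b y => cos (b * y + th)) setT measurableT a _ _ Ia
  (fun x _ => itf x) (fun x y _ _ => df x y) (fun x => `|x|) (fun y => normr_ge0 y) iG
  (fun x y _ _ => ub x y).
have E := @differentiation_under_integral R _ _ gaussP (fun b y => cos (b * y + th)) setT measurableT a _ _ Ia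
  (fun x _ => itf x) (fun x y _ _ => df x y) (fun x => `|x|) (fun y => normr_ge0 y) iG
  (fun x y _ _ => ub x y).
apply: (@DeriveDef _ _ _ _ _ _ _ D); rewrite -derive1E E -stein -EX_N.
  by congr (EX _ _); apply/funext => x; rewrite /partial1of2 dE.
apply: (le_integrable _ _ _ itg_id) => //.
  apply/measurable_EFinP; apply: measurable_funM => //.
  apply: (measurableT_comp (f := @sin R)); first by apply: continuous_measurable_fun; exact: continuous_sin.
  by meas.
by move=> x _; rewrite /= lee_fin normrM ler_piMr// sin_max.
Qed.

(** By [d_normal_cos] the mean solves the differential equation [f' = - a * f] in [a], so its
    product [F] with the inverse Gaussian factor has zero derivative. *)
Lemma normal_cos a th : EX gaussP (fun x => cos (a * x + th)) = cos th * expR (- (a ^+ 2 / 2)).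
Proof.
pose F b := EX gaussP (fun x => cos (b * x + th)) * expR (b ^+ 2 / 2).
have := @mvt_bound R F (fun=> 0) a 0; rewrite mul0r => h.
have : `|F a - F 0| <= 0.
  apply: h => x _; last by rewrite normr0.
  eapply deq; first by apply: dM; [exact: d_normal_cos|dtac].
  by rewrite /=; field.
rewrite normr_le0 subr_eq0 => /eqP; rewrite /F expr0n/= mul0r expR0 mulr1.
have -> : EX gaussP (fun x => cos (0 * x + th)) = cos th.
  by rewrite -[RHS](EX_cst gaussP); congr (EX _ _); apply/funext => x; rewrite mul0r add0r.
by move=> <-; rewrite -mulrA -expRD subrr expR0 mulr1.
Qed.
End normal.

(** * The central limit theorem for the number of splits *)

Section gauss_bounds.
Variable R : realType.
Implicit Types L s : R.
Local Notation lam := (lam R).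

Lemma vK_gt0 : 0 < vK R.
Proof.
suff h : 5 / 8 < ln 2 :> R by rewrite /vK; lra.
rewrite -ltr_expR lnK ?posrE//.
(* The bound [expR (5 / 8) < 2] is reached by squaring [expR (5 / 64)] three times, starting from
   [expR (- x) >= 1 - x]. *)
pose a : R := expR (5 / 64); have a0 : 0 < a by exact: expR_gt0.
have a1 : a <= 25 / 23.
  have := expR_ge1Dx (- (5 / 64) : R); rewrite expRN -/a => h.
  have : (1 - 5 / 64) * a <= 1 by rewrite -ler_pdivlMr// div1r; lra.
  lra.
have a2 : a ^+ 2 <= 13 / 11.
  have : a ^+ 2 <= (25 / 23) ^+ 2 by rewrite lerXn2r ?nnegrE ?(ltW a0)//; lra.
  lra.
have a4 : (a ^+ 2) ^+ 2 <= 7 / 5.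
  have : (a ^+ 2) ^+ 2 <= (13 / 11) ^+ 2 by rewrite lerXn2r ?nnegrE ?exprn_ge0 ?(ltW a0)//; lra.
  lra.
have a8 : ((a ^+ 2) ^+ 2) ^+ 2 < 2.
  have : ((a ^+ 2) ^+ 2) ^+ 2 <= (7 / 5) ^+ 2 by rewrite lerXn2r ?nnegrE ?exprn_ge0 ?(ltW a0)//; lra.
  lra.
have -> : 5 / 8 = 8%:R * (5 / 64) :> R by field.
by rewrite expRM_natl -/a; move: a8; rewrite -!exprM.
Qed.

Lemma bmf_gauss L (k : nat) : bmf (fun u : measurableTypeR R => (L * cl u) ^+ k * expR (- (L * cl u) ^+ 2)).
Proof.
have mL : measurable_fun setT (fun u : measurableTypeR R => L * cl u) by meas.
split.
  apply: measurable_funM; first exact: measurable_funX.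
  by apply: (measurableT_comp (f := expR)) => //; apply: measurable_funN; exact: measurable_funX.
exists (`|L| ^+ k) => u; rewrite normrM -[leRHS]mulr1 ler_pM//.
  by rewrite normrX lerXn2r ?nnegrE// normrM ler_piMr// ger0_norm ?cl_ge0 ?cl_le1.
by rewrite ger0_norm ?expR_ge0// -[leRHS]expR0 ler_expR oppr_le0 sqr_ge0.
Qed.

(** A majorant of the Gaussian with an elementary primitive; it gives the order [1 / L] of the
    averages over frequencies. *)
Lemma EX_inv_sqr L : 0 < L -> bmf (fun u : measurableTypeR R => (1 + L * cl u) ^- 2) /\
  EX lam (fun u => (1 + L * cl u) ^- 2) <= L^-1.
Proof.
move=> L0; have p (u : R) : 0 <= u -> 1 <= 1 + L * u.
  by move=> u0; rewrite lerDl mulr_ge0// ltW.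
have b : bmf (fun u : measurableTypeR R => (1 + L * cl u) ^- 2).
  split; first by apply: measurable_finv; [meas|move=> u; rewrite exprn_gt0// (lt_le_trans ltr01)// p// cl_ge0].
  exists 1 => u; have h := p (cl u) (cl_ge0 u).
  rewrite ger0_norm ?invr_ge0 ?sqr_ge0// invf_le1 ?exprn_ege1// exprn_gt0//.
  exact: lt_le_trans ltr01 h.
split => //; rewrite EX_lamE//.
rewrite (@IL_eq _ _ _ _ (fun u => (1 + L * u) ^- 2)); last first.
  by move=> u /andP[u0 u1]; rewrite cl_id// !ltW.
have nz (u : R) : 0 <= u <= 1 -> 1 + L * u != 0.
  by move=> /andP[u0 _]; rewrite gt_eqF// (lt_le_trans ltr01)// p.
rewrite (@IL_FTC _ 0 1 (fun u => - (L * (1 + L * u))^-1) _ ler01).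
- rewrite mulr0 addr0 !mulr1 opprK addrC gerBl invr_ge0 mulr_ge0 ?addr_ge0 ?ler01 ?(ltW L0)//.
- move=> x /nz x0; have L0' : L != 0 by rewrite gt_eqF.
  by eapply deq; [dtac; rewrite mulf_neq0|rewrite /=; field; rewrite x0].
- by move=> x /nz x0; eapply dvb; dtac; rewrite expf_neq0.
Qed.

Lemma gauss_le (u : R) : 0 <= u -> expR (- u ^+ 2) <= 2 * (1 + u) ^- 2.
Proof.
move=> u0; rewrite expRN -[_ ^- 2]/((_ ^+ 2)^-1) ler_pdivlMr ?exprn_gt0//; last lra.
rewrite mulrC ler_pdivrMr ?expR_gt0//.
have := expR_ge1Dx (u ^+ 2); have := sqr_ge0 (u - 1); rewrite sqrrB sqrrD !expr1n; lra.
Qed.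

Lemma gauss2_le (u : R) : 0 <= u -> u ^+ 2 * expR (- u ^+ 2) <= 6 * (1 + u) ^- 2.
Proof.
move=> u0; rewrite expRN -[_ ^- 2]/((_ ^+ 2)^-1) ler_pdivlMr ?exprn_gt0//; last lra.
rewrite mulrAC ler_pdivrMr ?expR_gt0//.
have := expR_ge1Dx (u ^+ 2); have := @expR_ge1Dxn R _ 1 (sqr_ge0 u).
have := sqr_ge0 (u - 1); rewrite sqrrB sqrrD !expr1n => h1 h2 h3.
have e2 : 2`!%:R = 2 :> R by []. rewrite e2 in h2.
have : u ^+ 2 * (1 + 1 * u *+ 2 + u ^+ 2) <= u ^+ 2 * (2 + 2 * u ^+ 2).
  by rewrite ler_wpM2l ?sqr_ge0//; lra.
have := sqr_ge0 u; lra.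
Qed.

Lemma EX_gauss L : 0 < L -> EX lam (fun u => expR (- (L * cl u) ^+ 2)) <= 2 / L.
Proof.
move=> L0; have [b h] := EX_inv_sqr L0.
apply: (@le_trans _ _ (EX lam (fun u => 2 * (1 + L * cl u) ^- 2))).
  apply: EX_le.
  - apply: bmf_itg; apply: eq_bmf (bmf_gauss L 0) => u; by rewrite expr0 mul1r.
  - by apply: bmf_itg; apply: bmfM => //; exact: bmf_cst.
  - by move=> u; apply: gauss_le; rewrite mulr_ge0 ?cl_ge0// ltW.
by rewrite EX_Z ?ler_pM2l//; exact: bmf_itg.
Qed.

Lemma EX_gauss2 L : 0 < L -> EX lam (fun u => (L * cl u) ^+ 2 * expR (- (L * cl u) ^+ 2)) <= 6 / L.
Proof.
move=> L0; have [b h] := EX_inv_sqr L0.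
apply: (@le_trans _ _ (EX lam (fun u => 6 * (1 + L * cl u) ^- 2))).
  apply: EX_le.
  - exact: bmf_itg (bmf_gauss L 2).
  - by apply: bmf_itg; apply: bmfM => //; exact: bmf_cst.
  - by move=> u; apply: gauss2_le; rewrite mulr_ge0 ?cl_ge0// ltW.
by rewrite EX_Z ?ler_pM2l//; exact: bmf_itg.
Qed.
End gauss_bounds.

Section berry_esseen.
Context d (T : measurableType d) (R : realType) (P : probability T R)
  (U : nat -> {RV P >-> R}).
Hypothesis indU : mutually_independent U.
Hypothesis lawU : forall k (A : set R), measurable A ->
     distribution P (U k) A = uniform_prob (@ltr01 R) A.

Definition ctau (t : R) (w : T) : R := tau U t w + 1 - 2 / t.

Lemma measurable_ctau (t : R) : 0 < t -> measurable_fun setT (ctau t).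
Proof. by move=> t0; rewrite /ctau; have := measurable_tau U t => h; meas. Qed.

Lemma itg_ctau (t c : R) : 0 < t -> P.-integrable setT (EFin \o (fun w => c * ctau t w)).
Proof.
move=> t0; have iX := itg_tau indU lawU t0.
have ic (a : R) : P.-integrable setT (EFin \o (fun _ : T => a)) by exact/bmf_itg/bmf_cst.
have h : P.-integrable setT (EFin \o (ctau t)).
  have h1 := integrableD measurableT iX (ic 1).
  by have := integrableB measurableT h1 (ic (2 / t)).
exact: (integrableZl measurableT c h).
Qed.

Lemma EX_cos_ctau (t s th : R) : 0 < t -> EX P (fun w => cos (s * ctau t w + th)) =
  expR (- (vK R * s ^+ 2 / 2 / t)) * complex.Re (cis th * rfix s (1 / t)).
Proof.
move=> t0; have E := CE_tau indU lawU t0 s.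
have -> : EX P (fun w => cos (s * ctau t w + th)) =
    complex.Re (CE P (fun w => cis th * cis (s * (tau U t w + 1 - 2 / t)))).
  rewrite /CE/=; congr (EX _ _); apply/funext => w.
  by rewrite cosD; ring.
rewrite CE_Z; last exact: cbmf_cis_tau.
by rewrite E mulrCA cReM/= mul0r subr0.
Qed.

(** The restriction [s <= vK / (4 * K)] makes the error exponent [K * s ^+ 3 / t] at most half of
    the Gaussian exponent, so half of the Gaussian decay survives in both bounds. The second bound
    also uses [expR q - 1 <= q * expR q]. *)
Lemma ctau_cf : exists s1 K : R, [/\ 0 < s1, 0 < K & forall t s th : R, 0 < t <= 1 / 2 -> 0 <= s <= s1 ->
  `|EX P (fun w => cos (s * ctau t w + th))| <= expR (- (vK R * s ^+ 2 / 4 / t)) /\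
  `|EX P (fun w => cos (s * ctau t w + th)) - cos th * expR (- (vK R * s ^+ 2 / 2 / t))| <=
   K * s ^+ 3 / t * expR (- (vK R * s ^+ 2 / 4 / t))].
Proof.
have [s0 [K [s00 K0 fix_]]] := fixpoint_solution R.
have v0 := vK_gt0 R.
exists (Num.min s0 (vK R / (4 * K))), K; split => //.
  by rewrite lt_min s00 divr_gt0// mulr_gt0.
move=> t s th /andP[t0 t2] /andP[s0' ]; rewrite le_min => /andP[ss0 sK].
have ti : 0 < t^-1 by rewrite invr_gt0.
have y2 : 2 <= 1 / t by rewrite ler_pdivlMr//; lra.
have := fix_ s; rewrite (ger0_norm s0') => /(_ ss0 (1 / t) y2) rb.
set e := expR (- (vK R * s ^+ 2 / 2 / t)).
set q := K * s ^+ 3 * (1 / t) in rb.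
have e0 : 0 < e by exact: expR_gt0.
have q0 : 0 <= q by rewrite /q !mulr_ge0 ?exprn_ge0 ?(ltW K0) ?ler01 ?(ltW ti).
have q1 : q <= vK R * s ^+ 2 / 4 / t.
  rewrite /q div1r ler_pM2r// exprS.
  have : K * s <= vK R / 4.
    by move: sK; rewrite ler_pdivlMr ?mulr_gt0//; lra.
  move=> h; have := ler_wpM2r (sqr_ge0 s) h; lra.
have eq_ : e * expR q <= expR (- (vK R * s ^+ 2 / 4 / t)).
  rewrite /e -expRD ler_expR; move: q1; set a := vK R * s ^+ 2; lra.
rewrite EX_cos_ctau// -/e.
split.
  rewrite normrM (ger0_norm (ltW e0)) (le_trans _ eq_)// ler_pM2l//.
  rewrite (le_trans (cabs_Re _))// cabsM cabs_cis mul1r.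
  have -> : rfix s (1 / t) = (rfix s (1 / t) - 1) + 1 by rewrite subrK.
  by rewrite (le_trans (cabsD _ _))// cabs1; lra.
have -> : e * complex.Re (cis th * rfix s (1 / t)) - cos th * e =
    e * complex.Re (cis th * (rfix s (1 / t) - 1)).
  have RB (z w : R[i]) : complex.Re (z * (w - 1)) = complex.Re (z * w) - complex.Re z.
    by rewrite mulrBr mulr1 cReD cReN.
  have -> : cos th = complex.Re (cis th) by [].
  rewrite RB; move: (complex.Re (cis th * rfix s (1 / t))) (complex.Re (cis th)) => y1 y3; ring.
rewrite normrM (ger0_norm (ltW e0)).
apply: (@le_trans _ _ (e * (expR q - 1))).
  by rewrite ler_pM2l// (le_trans (cabs_Re _))// cabsM cabs_cis mul1r.
apply: (@le_trans _ _ (e * (q * expR q))).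
  rewrite ler_pM2l//; have := expR_ge1Dx (- q); rewrite expRN => h.
  have : (1 - q) * expR q <= 1 by rewrite -ler_pdivlMr ?expR_gt0// div1r.
  lra.
have qE : K * s ^+ 3 / t = q by rewrite /q div1r.
by rewrite qE mulrCA ler_wpM2l.
Qed.

(** [ctau t] is scaled by the constant [s1], not by its standard deviation: frequencies in [0, 1]
    then sweep exactly the range of [ctau_cf], and Gaussian averages over them are of the order of
    the inverse standard deviation, that is of [Num.sqrt t]. *)
Lemma berry_esseen_ctau : exists2 C : R, 0 <= C & forall t x : R, 0 < t <= 1 / 2 ->
  `|fine (P [set w | ctau t w <= x]) - fine (gaussP R [set g | Num.sqrt (vK R / t) * g <= x])| <=
  C * Num.sqrt t.
Proof.
have [s1 [K [s10 K0 cf]]] := ctau_cf.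
have v0 := vK_gt0 R; have c0 := sstep_lim_gt0 R; have f0 := sgn_cst_gt0 R.
set v := vK R in v0 cf *.
(* [C1] and [C2] combine the constants of [smoothing] with the bounds [2 / L] and [6 / L] for the
   [L] chosen below; the remaining factor times [Num.sqrt t] is [L^-1]. *)
pose C1 := sgn_cst R * 8; pose C2 := 24 * K * s1 / v.
exists ((C1 + C2) * (2 / (s1 * Num.sqrt v)) / (2 * sstep_lim R)).
  rewrite divr_ge0// ?mulr_ge0// ?invr_ge0 ?mulr_ge0 ?sqrtr_ge0// ?ltW//.
  by rewrite addr_gt0 /C1 /C2 ?divr_gt0 ?mulr_gt0.
move=> t x t02; have t0 : 0 < t by move: t02; lra.
pose b := Num.sqrt (v / t).
have b2 : b ^+ 2 = v / t by rewrite sqr_sqrtr// divr_ge0// ltW.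
have b0 : 0 < b by rewrite sqrtr_gt0 divr_gt0.
(* Chosen so that [(L * s) ^+ 2] is the exponent of [ctau_cf] at frequency [s * s1], which is
   [Ls]. *)
pose L := s1 * b / 2; have L0 : 0 < L by rewrite divr_gt0 ?mulr_gt0.
have Ls (s : R) : (L * s) ^+ 2 = v * (s * s1) ^+ 2 / 4 / t.
  have -> : (L * s) ^+ 2 = b ^+ 2 * (s * s1) ^+ 2 / 4 by rewrite /L; field.
  by rewrite b2; field; exact: lt0r_neq0.
pose A s := expR (- (L * s) ^+ 2).
(* The second bound of [ctau_cf] at frequency [s * s1], divided by [s] and rewritten in terms of
   [L * s]. *)
pose D s := 4 * K * s1 / v * ((L * s) ^+ 2 * expR (- (L * s) ^+ 2)).
have bA : bmf (fun u : measurableTypeR R => A (cl u)).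
  by apply: eq_bmf (bmf_gauss L 0) => u; rewrite expr0 mul1r.
have bD : bmf (fun u : measurableTypeR R => D (cl u)).
  by apply: bmfM; [exact: bmf_cst|exact: bmf_gauss].
have Pset (X : T -> R) (c : R) : 0 < c -> [set w | X w <= x] = [set w | c * X w <= c * x].
  by move=> cp; apply/seteqP; split => w /=; rewrite ler_pM2l.
have Nset (c : R) : 0 < c -> [set g : R | b * g <= x] = [set g | c * b * g <= c * x].
  by move=> cp; apply/seteqP; split => w /=; rewrite -mulrA ler_pM2l.
rewrite -/b (Pset _ s1)// (Nset s1)//.
have ss1 (s : R) : 0 <= s <= 1 -> 0 <= s * s1 <= s1.
  by move=> /andP[? ?]; rewrite mulr_ge0 ?ler_piMl// ltW.
have cE (s th : R) w : cos (s * (s1 * ctau t w) + th) = cos (s * s1 * ctau t w + th) by rewrite mulrA.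
have nE (s th : R) : EX (gaussP R) (fun g => cos (s * (s1 * b * g) + th)) = cos th * expR (- (v * (s * s1) ^+ 2 / 2 / t)).
  have -> : (fun g : R => cos (s * (s1 * b * g) + th)) = (fun g => cos (s * s1 * b * g + th)).
    by apply/funext => g; rewrite !mulrA.
  rewrite normal_cos !exprMn b2; congr (_ * expR (- _)); field; exact: lt0r_neq0.
have K1 := @smoothing R _ T P (fun w => s1 * ctau t w) _ _ (gaussP R) (fun g => s1 * b * g) A D (s1 * x).
have {K1} : 2 * sstep_lim R * `|fine (P [set w | s1 * ctau t w <= s1 * x]) - fine (gaussP R [set g | s1 * b * g <= s1 * x])| <=
  sgn_cst R * 4 * EX (lam R) (fun u => A (cl u)) + EX (lam R) (fun u => D (cl u)).
  apply: K1 => //.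
  - by apply: measurable_funM => //; exact: measurable_ctau.
  - exact: itg_ctau.
  - exact: measurable_funM.
  - exact: (integrableZl measurableT (s1 * b) (itg_id R)).
  - move=> s th s01; under eq_fun do rewrite cE.
    by have [+ _] := cf t (s * s1) th t02 (ss1 s s01); rewrite -Ls.
  - move=> s th s01; rewrite nE normrM (ger0_norm (expR_ge0 _)).
    rewrite (@le_trans _ _ (expR (- (v * (s * s1) ^+ 2 / 2 / t))))//.
      by rewrite ler_piMl ?expR_ge0 ?cos_max.
    rewrite /A ler_expR lerN2 Ls ler_pM2r ?invr_gt0//.
    by have := mulr_ge0 (ltW v0) (sqr_ge0 (s * s1)); lra.
  - move=> s th /andP[sp s1']; under eq_fun do rewrite cE.
    have s01 : 0 <= s <= 1 by rewrite ltW.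
    rewrite nE; have [_] := cf t (s * s1) th t02 (ss1 s s01); rewrite -Ls => /le_trans; apply.
    rewrite /D [in leRHS]mulrA [in leRHS]mulrA ler_wpM2r ?expR_ge0//.
    by rewrite Ls !exprMn le_eqVlt; apply/orP; left; apply/eqP; field; rewrite !gt_eqF.
have gA := EX_gauss L0; have gD := EX_gauss2 L0.
have -> : EX (lam R) (fun u => D (cl u)) = 4 * K * s1 / v *
    EX (lam R) (fun u => (L * cl u) ^+ 2 * expR (- (L * cl u) ^+ 2)).
  by rewrite EX_Z//; exact: bmf_itg (bmf_gauss L 2).
move=> h; rewrite -ler_pdivlMl in h *; last by rewrite mulr_gt0.
apply: (le_trans h); rewrite [leRHS]mulrAC [leRHS]mulrC ler_wpM2l ?invr_ge0 ?mulr_ge0 ?(ltW c0)//.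
have -> : (C1 + C2) * (2 / (s1 * Num.sqrt v)) * Num.sqrt t = C1 / L + C2 / L.
  rewrite -mulrDl -mulrA; congr (_ * _).
  rewrite /L /b sqrtrM ?ltW// sqrtrV ?ltW//; field.
  by rewrite !gt_eqF ?sqrtr_gt0.
apply: lerD.
  have -> : C1 / L = sgn_cst R * 4 * (2 / L) by rewrite /C1; ring.
  by rewrite ler_wpM2l// mulr_ge0// ltW.
have -> : C2 / L = 4 * K * s1 / v * (6 / L) by rewrite /C2; ring.
by rewrite ler_wpM2l// divr_ge0 ?mulr_ge0// ltW.
Qed.
End berry_esseen.

(** * From the number of splits to the longest interval *)

Section Phi_theory.
Variable R : realType.
Implicit Types a b x : R.
Local Notation gaussP := (gaussP R).

Lemma PhiE x : Phi x = fine (gaussP `]-oo, x]%classic). Proof. by []. Qed.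

Lemma gaussP_fin (A : set R) : measurable A -> gaussP A \is a fin_num.
Proof. by move=> mA; exact: fin_num_measure. Qed.

Lemma gaussP_Phi b x : 0 < b -> fine (gaussP [set g : R | b * g <= x]) = Phi (x / b).
Proof.
move=> b0; rewrite PhiE; congr (fine (gaussP _)); apply/seteqP; split => g /=; rewrite in_itv/=.
  by rewrite ler_pdivlMr// mulrC.
by rewrite ler_pdivlMr// mulrC.
Qed.

Lemma gpdf_le x : gpdf x <= expR (- (x ^+ 2 / 2)).
Proof.
rewrite gpdfE ler_piMl ?expR_ge0// /normal_peak invf_le1.
  rewrite -[leLHS]sqrtr1 ler_wsqrtr// expr1n mul1r mulr2n.
  by have := pi_ge2 R; lra.
by rewrite sqrtr_gt0 expr1n mul1r mulrn_wgt0// pi_gt0.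
Qed.

Lemma gpdf_le1 x : gpdf x <= 1.
Proof.
rewrite (le_trans (gpdf_le x))// -[leRHS]expR0 ler_expR oppr_le0.
by rewrite divr_ge0 ?sqr_ge0.
Qed.

Lemma Phi_diff a b (M : R) : a <= b -> (forall z, a <= z <= b -> gpdf z <= M) ->
  0 <= Phi b - Phi a <= M * (b - a).
Proof.
move=> ab gM; rewrite !PhiE.
have E : gaussP `]-oo, b]%classic = (gaussP `]-oo, a]%classic + gaussP `]a, b]%classic)%E.
  rewrite -measureU//.
    congr (gaussP _); apply/seteqP; split => z /=; rewrite !in_itv/=.
      by move=> zb; case: (leP z a) => za; [left|right].
    by move=> [/le_trans->//|/andP[]].
  by apply/seteqP; split => z //=; rewrite !in_itv/= => -[za /andP[/lt_le_trans/(_ za)]]; rewrite ltxx.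
rewrite E fineD ?gaussP_fin// addrC addKr.
apply/andP; split; first by rewrite fine_ge0.
rewrite -lee_fin fineK ?gaussP_fin//.
have -> : (M * (b - a))%:E = (\int[@lebesgue_measure R]_(x in `]a, b]) M%:E)%E.
  have L : lebesgue_measure (`]a, b]%classic : set R) = (b - a)%:E.
    rewrite lebesgue_measure_itv/= lte_fin -EFinD.
    by case: ltgtP ab => // -> _; rewrite subrr.
  by rewrite integral_cst// [X in (_ * X)%E]L -EFinM.
apply: ge0_le_integral => //.
- by move=> x _; rewrite lee_fin gpdf_ge0.
- by apply/measurable_EFinP; apply: measurable_funTS; exact: measurable_gpdf.
- by move=> x; rewrite /= in_itv/= => /andP[ax xb]; rewrite lee_fin gM// (ltW ax).
Qed.

Lemma Phi_lip a b (M : R) : (forall z, a <= z <= b \/ b <= z <= a -> gpdf z <= M) ->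
  `|Phi b - Phi a| <= M * `|b - a|.
Proof.
have [ab|ba] := leP a b => h.
  have /andP[h0 h1] := @Phi_diff a b M ab (fun z zab => h z (or_introl zab)).
  by rewrite (ger0_norm h0) (@ger0_norm _ (b - a)) ?subr_ge0.
have /andP[h0 h1] := @Phi_diff b a M (ltW ba) (fun z zab => h z (or_intror zab)).
by rewrite distrC (ger0_norm h0) (distrC b) (@ger0_norm _ (a - b)) ?subr_ge0 ?(ltW ba).
Qed.

Lemma Phi_mono a b : a <= b -> Phi a <= Phi b.
Proof.
move=> ab; have := @Phi_diff a b 1 ab (fun z _ => gpdf_le1 z).
by rewrite subr_ge0 => /andP[].
Qed.

Lemma Phi_shift a b : `|Phi b - Phi a| <= `|b - a|.
Proof. by rewrite -[leRHS]mul1r; apply: Phi_lip => z _; exact: gpdf_le1. Qed.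

(* The Gaussian decay of the density absorbs the factor x ^+ 2 of the displacement. *)
Lemma Phi_scale x (k : R) : 0 <= k -> `|x * k| <= 1 / 2 ->
  `|Phi (x / Num.sqrt (1 + x * k)) - Phi x| <= 6 * k.
Proof.
move=> k0 xk; set q := Num.sqrt _.
have /andP[xk1 xk2] : - (1 / 2) <= x * k <= 1 / 2 by rewrite -ler_norml.
have q2 : q ^+ 2 = 1 + x * k by rewrite sqr_sqrtr//; lra.
have q0 : 0 < q by rewrite sqrtr_gt0; lra.
have qu : q <= 5 / 4 by nra.
have ql : 2 / 3 <= q by nra.
have d1 : `|x / q - x| <= 3 / 2 * (x ^+ 2 * k).
  have -> : x / q - x = x * ((1 - q) / q) by field; rewrite gt_eqF.
  have -> : (1 - q) / q = - (x * k) / (q * (1 + q)).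
    have -> : x * k = q ^+ 2 - 1 by rewrite q2; ring.
    have q00 : q != 0 by rewrite gt_eqF.
    have q10 : 1 + q != 0 by rewrite gt_eqF//; lra.
    by field; rewrite ?q00 ?q10.
  rewrite mulrA mulrN mulNr normrN mulrA -expr2 normrM normfV.
  have xx0 : 0 <= x ^+ 2 * k by apply: mulr_ge0 => //; exact: sqr_ge0.
  rewrite (ger0_norm xx0) mulrC ler_wpM2r//.
  have h : 2 / 3 <= q * (1 + q) by nra.
  rewrite ger0_norm; last by rewrite mulr_ge0// ?addr_ge0// ltW.
  by rewrite -[3 / 2]invrK lef_pV2 ?posrE ?invf_div//; lra.
(* As [q <= 5 / 4], every point between [x] and [x / q] has modulus at least [4 / 5 * |x|], which
   gives the exponent [8 / 25]. *)
have d2 : `|Phi (x / q) - Phi x| <= expR (- (8 / 25 * x ^+ 2)) * `|x / q - x|.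
  apply: Phi_lip => z hz; rewrite (le_trans (gpdf_le z))// ler_expR lerN2.
  have qi : 4 / 5 <= q^-1 by rewrite -[4 / 5]invrK lef_pV2 ?posrE ?invf_div//; lra.
  suff : (4 / 5) ^+ 2 * x ^+ 2 <= z ^+ 2 by lra.
  rewrite -exprMn -(real_normK (num_real z)) -(real_normK (num_real (4 / 5 * x))).
  rewrite lerXn2r ?nnegrE// normrM (@ger0_norm _ (4 / 5)); last lra.
  have [x0|x0] := leP 0 x.
    have : 4 / 5 * x <= x / q by rewrite mulrC ler_wpM2l.
    move=> h; have z1 : 4 / 5 * x <= z by case: hz; lra.
    by rewrite (ger0_norm x0) (le_trans z1)// ler_norm.
  have : x / q <= 4 / 5 * x by rewrite [leRHS]mulrC ler_wnM2l// ltW.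
  move=> h; have z1 : z <= 4 / 5 * x by case: hz; lra.
  rewrite (ltr0_norm x0); have := ler_norm (- z); rewrite normrN; lra.
apply: (le_trans d2); rewrite (le_trans (ler_wpM2l (expR_ge0 _) d1))//.
have h : expR (- (8 / 25 * x ^+ 2)) * x ^+ 2 <= 4.
  rewrite expRN mulrC ler_pdivrMr ?expR_gt0//.
  have := expR_ge1Dx (8 / 25 * x ^+ 2); have := sqr_ge0 x; lra.
have := ler_wpM2r k0 h; lra.
Qed.

(** Markov's inequality with this first moment is enough for the tails of [Phi], which are needed to
    order [1 / sqrt n] at a distance of order [sqrt n]. *)
Definition gabs : R := EX gaussP (fun g => `|g|).

Lemma gabs_ge0 : 0 <= gabs. Proof. exact: EX_ge0. Qed.

Lemma Phi_tailN a : 0 < a -> Phi (- a) <= gabs / a.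
Proof.
move=> a0; rewrite PhiE -EX_indic// mulrC -EX_Z; last exact: itg_norm (itg_id R).
apply: EX_le.
- exact/bmf_itg/bmf_indic.
- exact: (integrableZl measurableT a^-1 (itg_norm (itg_id R))).
move=> g; rewrite indicE; case: (boolP (_ \in _)) => [|_] /=; last first.
  by rewrite mulr_ge0// invr_ge0 ltW.
rewrite inE/= in_itv/= => h; rewrite mulrC ler_pdivlMr// mul1r.
by rewrite -normrN (le_trans _ (ler_norm _))//; move: h; lra.
Qed.

Lemma Phi_tail a : 0 < a -> 1 - gabs / a <= Phi a.
Proof.
move=> a0; rewrite PhiE -EX_indic// lerBlDr.
have ia := integrableZl measurableT a^-1 (itg_norm (itg_id R)).
rewrite [gabs / a]mulrC -EX_Z; last exact: itg_norm (itg_id R).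
rewrite -EX_D; [|exact/bmf_itg/bmf_indic|exact: ia].
rewrite -[leLHS](EX_cst gaussP); apply: EX_le.
- exact/bmf_itg/bmf_cst.
- have ii : gaussP.-integrable setT (EFin \o (\1_`]-oo, a] : R -> R)) by exact/bmf_itg/bmf_indic.
  exact: (integrableD measurableT ii ia).
move=> g; rewrite indicE; case: (boolP (_ \in _)) => [_|] /=.
  by rewrite lerDl mulr_ge0// invr_ge0 ltW.
rewrite notin_setE/= in_itv/= => /negP; rewrite -ltNge => h.
rewrite add0r mulrC ler_pdivlMr// mul1r (le_trans (ltW h))//; exact: ler_norm.
Qed.

Lemma Phi_le1 x : Phi x <= 1.
Proof.
rewrite PhiE -lee_fin fineK ?gaussP_fin//; exact: probability_le1.
Qed.

Lemma Phi_ge0 x : 0 <= Phi x.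
Proof. by rewrite PhiE fine_ge0. Qed.
End Phi_theory.

(** * Distribution function of the longest interval *)

Section assembly.
Context d (T : measurableType d) (R : realType) (P : probability T R)
  (U : nat -> {RV P >-> R}).
Hypothesis indU : mutually_independent U.
Hypothesis lawU : forall k (A : set R), measurable A ->
     distribution P (U k) A = uniform_prob (@ltr01 R) A.
Implicit Types (n : nat) (x : R).

Definition M_le n x : set T := [set w | Mn (fun k => U k w) n <= x].

Lemma measurable_M_le n x : measurable (M_le n x).
Proof.
rewrite -[X in measurable X]setTI.
have -> : M_le n x = [set w | lmax (lens (fun k => U k w) n) <= x].
  by apply/funext => w; rewrite /M_le /mkset MnE.
have mU k : measurable_fun setT (U k) by exact: measurable_funP.
by apply: (measurable_fun_ler (measurable_lmax_lens mU n)) => //; exact: measurable_cst.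
Qed.

Definition cdfM n x : R := fine (P (M_le n x)).

Lemma cdfM_fin n x : P (M_le n x) \is a fin_num.
Proof. by apply: fin_num_measure; exact: measurable_M_le. Qed.

Lemma cdfM_le1 n x : cdfM n x <= 1.
Proof.
rewrite /cdfM -lee_fin fineK ?cdfM_fin//; exact: (probability_le1 P (measurable_M_le n x)).
Qed.

Lemma cdfM_ge0 n x : 0 <= cdfM n x. Proof. exact/fine_ge0. Qed.

Lemma cdfM_mono n x y : x <= y -> cdfM n x <= cdfM n y.
Proof.
move=> xy; rewrite /cdfM -lee_fin !fineK ?cdfM_fin//.
apply: le_measure; rewrite ?inE; try exact: measurable_M_le.
by move=> w /= h; exact: le_trans h xy.
Qed.

(* In the variable x, the level is t = 2 / n * (1 + x * kappa n). *)
Definition kappa n : R := Num.sqrt (vK R / 2) / Num.sqrt n%:R.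

(** With [q ^+ 2 = 1 + x * k], the threshold for [ctau] in units of its standard deviation is
    exactly [x / q + q / (k * N)]. Three errors of order [1 / sqrt n] add up: that of
    [berry_esseen_ctau], the shift [q / (k * N)] coming from the 1 in [tau + 1], and the factor
    [1 / q], handled by [Phi_scale]. The condition on [n] keeps [t <= 1 / 2]. *)
Lemma cdfM_mid : exists2 C : R, 0 <= C & forall n x, (6 <= n)%N -> `|x * kappa n| <= 1 / 2 ->
  `|cdfM n (2 / n%:R * (1 + x * kappa n)) - Phi x| <= C / Num.sqrt n%:R.
Proof.
have [C C0 BE] := berry_esseen_ctau indU lawU.
have v0 := vK_gt0 R; set v := vK R in v0 BE *.
pose sv := Num.sqrt (v / 2); have sv0 : 0 < sv by rewrite sqrtr_gt0 divr_gt0.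
have sv2 : sv ^+ 2 = v / 2 by rewrite sqr_sqrtr// divr_ge0// ltW.
exists (2 * C + 5 / 4 / sv + 6 * sv).
  have := mulr_ge0 (ltW sv0) C0; have : 0 < 5 / 4 / sv by rewrite divr_gt0.
  lra.
move=> n x n6; set k := kappa n => xk.
set N : R := n%:R.
have N6 : 6 <= N by rewrite (ler_nat _ 6 n).
have N0 : 0 < N by lra.
set r := Num.sqrt N; have r0 : 0 < r by rewrite sqrtr_gt0.
have r2 : r ^+ 2 = N by rewrite sqr_sqrtr// ltW.
have kE : k = sv / r by [].
have k0 : 0 < k by rewrite kE divr_gt0.
have /andP[xk1 xk2] : - (1 / 2) <= x * k <= 1 / 2 by rewrite -ler_norml.
set q := Num.sqrt (1 + x * k).
have q2 : q ^+ 2 = 1 + x * k by rewrite sqr_sqrtr//; lra.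
have q0 : 0 < q by rewrite sqrtr_gt0; lra.
have qu : q <= 5 / 4 by nra.
set t := 2 / N * (1 + x * k).
have t0 : 0 < t by rewrite mulr_gt0 ?divr_gt0//; lra.
have t4 : t <= 4 / N.
  have -> : 4 / N = 2 / N * 2 by ring.
  by rewrite ler_pM2l ?divr_gt0//; lra.
have t12 : t <= 1 / 2.
  have -> : 1 / 2 = 2 / N * (N / 4) by field; rewrite gt_eqF.
  by rewrite ler_pM2l ?divr_gt0//; lra.
have st : Num.sqrt t <= 2 / r.
  have -> : 2 / r = Num.sqrt (4 / N).
    have -> : 4 / N = (2 / r) ^+ 2 by rewrite expr_div_n r2; congr (_ / _); ring.
    by rewrite sqrtr_sqr ger0_norm// divr_ge0// ltW.
  exact: ler_wsqrtr.
have E1 : cdfM n t = fine (P [set w | ctau U t w <= N + 1 - 2 / t]).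
  rewrite /cdfM /M_le (P_tau indU lawU t0); congr (fine (P _)).
  by apply/seteqP; split => w /=; rewrite /ctau -/N; lra.
have bE : Num.sqrt (v / t) = k * N / q.
  have -> : v / t = (k * N / q) ^+ 2.
    have k2 : k ^+ 2 = v / 2 / N by rewrite kE expr_div_n sv2 r2.
    rewrite expr_div_n exprMn k2 /t -q2; field.
    by rewrite !gt_eqF.
  by rewrite sqrtr_sqr ger0_norm// divr_ge0 ?mulr_ge0 ?(ltW N0) ?(ltW k0) ?(ltW q0).
have b0 : 0 < k * N / q by apply: divr_gt0 => //; exact: mulr_gt0.
have := BE t (N + 1 - 2 / t); rewrite t0 t12 => /(_ isT).
rewrite -E1 bE gaussP_Phi//.
have -> : (N + 1 - 2 / t) / (k * N / q) = x / q + q / (k * N).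
  have -> : x = (q ^+ 2 - 1) / k by rewrite q2; field; rewrite gt_eqF.
  by rewrite /t -q2; field; rewrite !gt_eqF.
move=> h1.
have h2 := Phi_shift (x / q) (x / q + q / (k * N)).
have h3 := Phi_scale (ltW k0) xk.
have e2 : `|x / q + q / (k * N) - x / q| <= 5 / 4 / sv / r.
  rewrite addrC addKr ger0_norm; last by rewrite divr_ge0 ?mulr_ge0 ?(ltW N0) ?(ltW k0) ?(ltW q0).
  have -> : 5 / 4 / sv / r = 5 / 4 / (k * N) by rewrite kE -r2; field; rewrite !gt_eqF.
  by rewrite ler_pM2r// invr_gt0 mulr_gt0.
have e1 : C * Num.sqrt t <= 2 * C / r.
  by rewrite (le_trans (ler_wpM2l C0 st))// mulrCA mulrA.
have -> : (2 * C + 5 / 4 / sv + 6 * sv) / r = 2 * C / r + 5 / 4 / sv / r + 6 * k by rewrite kE; ring.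
have -> : cdfM n t - Phi x = (cdfM n t - Phi (x / q + q / (k * N))) +
   (Phi (x / q + q / (k * N)) - Phi (x / q)) + (Phi (x / q) - Phi x) by ring.
rewrite (le_trans (ler_normD _ _))// lerD//.
rewrite (le_trans (ler_normD _ _))// lerD//; first exact: le_trans h1 e1.
exact: le_trans h2 e2.
Qed.

(** Outside the range of [cdfM_mid] both functions are monotone with values in [0, 1]. They are
    compared at the endpoint [X = 1 / (2 * k)] or its opposite, where the tail of [Phi] is at most
    [gabs R / X], of order [1 / sqrt n]. *)
Lemma cdfM_all : exists2 C : R, 0 <= C & forall n x, (0 < n)%N ->
  `|cdfM n (2 / n%:R * (1 + x * kappa n)) - Phi x| <= C / Num.sqrt n%:R.
Proof.
have [C C0 mid] := cdfM_mid.
have v0 := vK_gt0 R; set v := vK R in v0 *.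
pose sv := Num.sqrt (v / 2); have sv0 : 0 < sv by rewrite sqrtr_gt0 divr_gt0.
have m0 := gabs_ge0 R.
exists (C + 2 * sv * gabs R + 3).
  by rewrite !addr_ge0// !mulr_ge0// ltW.
move=> n x n0; set N : R := n%:R; have N0 : 0 < N by rewrite ltr0n.
set r := Num.sqrt N; have r0 : 0 < r by rewrite sqrtr_gt0.
have b1 y z : `|cdfM n y - Phi z| <= 1.
  rewrite ler_norml; have := cdfM_ge0 n y; have := cdfM_le1 n y; have := Phi_ge0 z; have := Phi_le1 z; lra.
have D0 : 0 <= C / r by rewrite divr_ge0// ltW.
have D1 : 0 <= 2 * sv * gabs R / r by rewrite !mulr_ge0 ?invr_ge0// ltW.
have D2 : 0 <= 3 / r by rewrite divr_ge0// ltW.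
have -> : (C + 2 * sv * gabs R + 3) / r = C / r + 2 * sv * gabs R / r + 3 / r by ring.
(* For [n < 6] the trivial bound 1 suffices, because [Num.sqrt n%:R <= 3]. *)
have [n6|n6] := leqP 6 n; last first.
  apply: (le_trans (b1 _ _)); suff : 1 <= 3 / r by lra.
  rewrite ler_pdivlMr// mul1r -[3]ger0_norm// -sqrtr_sqr ler_wsqrtr//.
  by rewrite -natrX ler_nat (leq_trans (ltnW n6)).
set k := kappa n; have k0 : 0 < k by rewrite /k /kappa divr_gt0.
have kE : k = sv / r by [].
pose X := (2 * k)^-1; have X0 : 0 < X by rewrite invr_gt0 mulr_gt0.
have Xk : X * k = 1 / 2 by rewrite /X; field; rewrite gt_eqF.
have mX : gabs R / X = 2 * sv * gabs R / r by rewrite /X invrK kE; ring.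
have [xk|xk] := leP `|x * k| (1 / 2); first by have := mid n x n6 xk; rewrite -/k -/N -/r; lra.
have h y z : y <= z -> cdfM n (2 / N * (1 + y * k)) <= cdfM n (2 / N * (1 + z * k)).
  by move=> yz; apply: cdfM_mono; rewrite ler_pM2l ?divr_gt0// lerD2l ler_pM2r.
have [x0|x0] := leP 0 x.
  have xX : X <= x.
    by rewrite ger0_norm ?mulr_ge0 ?(ltW k0)// in xk; rewrite -(ler_pM2r k0) Xk ltW.
  have := mid n X n6; rewrite Xk ger0_norm ?lexx// => /(_ isT); rewrite ler_norml => /andP[g1 _].
  have := h _ _ xX; rewrite Xk => g2; have g3 := Phi_tail X0; have g4 := Phi_mono xX.
  rewrite mX in g3; rewrite ler_norml.
  have := cdfM_le1 n (2 / N * (1 + x * k)); have := Phi_le1 x; rewrite -/k -/N -/r in g1 *; lra.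
have xX : x <= - X.
  by rewrite ltr0_norm ?pmulr_llt0// in xk; rewrite -(ler_pM2r k0) mulNr Xk; lra.
have := mid n (- X) n6; rewrite mulNr Xk normrN ger0_norm ?lexx// => /(_ isT).
rewrite ler_norml => /andP[_ g1].
have := h _ _ xX; rewrite mulNr Xk => g2; have g3 := Phi_tailN X0; have g4 := Phi_mono xX.
rewrite mX in g3; rewrite ler_norml.
have := cdfM_ge0 n (2 / N * (1 + x * k)); have := Phi_ge0 x; rewrite -/k -/N -/r in g1 *; lra.
Qed.

(** Since [16 * ln 2 - 10 = 2 * vK R], the normalising factor is [n / (2 * kappa n)], and undoing it
    turns [x] into the level [2 / n * (1 + x * kappa n)]. *)
Lemma scaled_event n x : (0 < n)%N ->
  [set w | Num.sqrt (n%:R ^+ 3 / (16 * ln 2 - 10)) * (Mn (fun k => U k w) n - 2 / n%:R) <= x] =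
  M_le n (2 / n%:R * (1 + x * kappa n)).
Proof.
move=> n0; have v0 := vK_gt0 R; have vE : 16 * ln 2 - 10 = 2 * vK R by rewrite /vK; ring.
rewrite vE; set v := vK R in v0 *; set N : R := n%:R; have N0 : 0 < N by rewrite ltr0n.
set k := kappa n; have k0 : 0 < k by rewrite /k /kappa divr_gt0// sqrtr_gt0// divr_gt0.
have k2 : k ^+ 2 = v / 2 / N.
  by rewrite /k /kappa expr_div_n !sqr_sqrtr// ?ltW// divr_gt0.
have -> : Num.sqrt (N ^+ 3 / (2 * v)) = N / (2 * k).
  have -> : N ^+ 3 / (2 * v) = (N / (2 * k)) ^+ 2.
    by rewrite expr_div_n exprMn k2; field; rewrite !gt_eqF.
  by rewrite sqrtr_sqr ger0_norm// divr_ge0 ?mulr_ge0 ?(ltW N0) ?(ltW k0).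
set c := N / (2 * k); have c0 : 0 < c by apply: divr_gt0 => //; exact: mulr_gt0.
have E : c * (2 / N * (1 + x * k) - 2 / N) = x by rewrite /c; field; rewrite !gt_eqF.
have EQ (M : R) : (c * (M - 2 / N) <= x) = (M <= 2 / N * (1 + x * k)).
  by rewrite -{1}E ler_pM2l// lerD2r.
by apply/seteqP; split => w /=; rewrite /M_le/= EQ.
Qed.
End assembly.

Theorem theorem1p2 (R : realType) (d : measure_display) (T : measurableType d)
  (P : probability T R) (U : nat -> {RV P >-> R}) :
  (* U k stands for U_{k+1}: i.i.d. uniform on [0,1] *)
  mutually_independent U ->
  (forall k (A : set R), measurable A ->
     distribution P (U k) A = uniform_prob (@ltr01 R) A) ->
  let sigma2 : R := 16 * ln 2 - 10 in
  exists C : R, 0 <= C /\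
    forall (n : nat), (0 < n)%N -> forall x : R,
      (`| P [set w | (Num.sqrt (n%:R ^+ 3 / sigma2) *
                       (Mn (fun k => U k w) n - 2 / n%:R) <= x)%R]
          - (Phi x)%:E | <= (C / Num.sqrt n%:R)%:E)%E.
Proof.
move=> indU lawU sigma2; have [C C0 h] := cdfM_all indU lawU.
exists C; split => // n n0 x; rewrite /sigma2 scaled_event//.
rewrite -(fineK (cdfM_fin U n _)) -EFinD/= lee_fin; exact: h.
Qed.
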